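(* Let $\kappa\in\{0,1,-1\}$ and consider on $\mathcal{G}_\kappa$ the Kähler structure $(g_\times,\mathcal{J})$. Let $S$ be a smooth, closed, quadratically convex surface in $M_\kappa$, let $\mathcal{M}\subset\mathcal{G}_\kappa$ be the submanifold of oriented geodesics tangent to $S$, and let $\ell\in\mathcal{M}$. Then the metric $g_\times$ degenerates on $T_\ell\mathcal{M}$, and for each vector $N\in T_\ell\mathcal{G}_\kappa$ that is $g_\times$-normal to $T_\ell\mathcal{M}$, the image of the geodesic of $(\mathcal{G}_\kappa,g_\times)$ with initial velocity $\mathcal{J}(N)$ is disjoint from $\mathcal{U}$.
   Context: $M_\kappa$ is the oriented complete simply connected Riemannian 3-manifold of constant curvature $\kappa$: $\mathbb{R}^3$, $S^3$, $H^3$ for $\kappa=0,1,-1$, with metric $\langle\,,\rangle_\kappa$ and cross product $\times$ on its tangent spaces. $\mathcal{G}_\kappa$ is the four-dimensional manifold of oriented complete geodesics of $M_\kappa$: classes $[\gamma]$ of unit speed geodesics modulo $\gamma(\cdot)\sim\gamma(\cdot+t_0)$. ''Smooth'' means $C^\infty$; a closed surface is a compact, connected, embedded surface without boundary; quadratically convex means that the shape operator is definite at every point. For a unit speed geodesic $\gamma$, let $\mathfrak{J}_\gamma$ be the space of Jacobi fields along $\gamma$ orthogonal to $\gamma'$; $T_{[\gamma]}\mathcal{G}_\kappa\cong\mathfrak{J}_\gamma$ via $J\mapsto\frac{d}{ds}|_0[\gamma_s]$, where $\gamma_s$ is any variation of $\gamma$ by unit speed geodesics with variation field $J$. Under this identification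 $\mathcal{J}(J)=\gamma'\times J$, and $g_\times$ is the pseudo-Riemannian metric with $2g_\times(I,J)=\langle I\times J'+J\times I',\gamma'\rangle_\kappa$ (constant along $\gamma$). $\mathcal{U}$ is the set of oriented geodesics not intersecting $S$ when $\kappa=0,-1$. When $\kappa=1$, $\mathcal{U}$ is the set of oriented great circles $c$ not intersecting $S$, minus the set $\mathcal{C}$ of those $c$ whose distance to one of the two points at which a great sphere containing $c$ is tangent to $S$ equals $\pi/2$. *)

(* Defs.v *)
From HB Require Import structures.
From mathcomp Require Import all_boot all_order all_algebra.
From mathcomp Require Import all_classical all_reals all_analysis.

Set Implicit Arguments.
Unset Strict Implicit.
Unset Printing Implicit Defensive.

Import Order.TTheory GRing.Theory Num.Theory numFieldNormedType.Exports.

Local Open Scope classical_set_scope.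
Local Open Scope ring_scope.

Section Smooth.
Context {R : realType} {U V : normedModType R}.

(* For finite-dimensional U and open W these are the usual classes C^k and
   C^oo: all iterated directional derivatives exist and are continuous. *)
Fixpoint Ck_on (k : nat) (W : set U) (f : U -> V) : Prop :=
  (forall x, W x -> {for x, continuous f}) /\
  match k with
  | 0%N => True
  | k'.+1 => (forall x v, W x -> derivable f x v) /\
             (forall v, Ck_on k' W ('D_v f))
  end.

Definition smooth_on (W : set U) (f : U -> V) : Prop :=
  forall k, Ck_on k W f.

End Smooth.

Section SpaceForms.
Context {R : realType}.
Local Notation E4 := 'rV[R]_4.

(* All definitions below are meant for kappa in {0, 1, -1}. *)
Variable kappa : R.

(* kappa x0 y0 + x1 y1 + x2 y2 + x3 y3; it restricts to the Riemannian metric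
   on the tangent spaces of the model [space_form] below. *)
Definition dotk (x y : E4) : R :=
  kappa * x 0 0 * y 0 0 + \sum_(i < 3) x 0 (lift 0 i) * y 0 (lift 0 i).

(* The affine hyperplane x0 = 1 (kappa = 0), the unit sphere (kappa = 1) and
   the upper sheet of the hyperboloid (kappa = -1). *)
Definition space_form : set E4 :=
  [set x | x 0 0 ^+ 2 + kappa * \sum_(i < 3) x 0 (lift 0 i) ^+ 2 = 1 /\
           (kappa <= 0 -> 0 < x 0 0)].

Definition tangent_form (p : E4) : set E4 :=
  [set u | p 0 0 * u 0 0 +
           kappa * \sum_(i < 3) p 0 (lift 0 i) * u 0 (lift 0 i) = 0].

(* On tangent vectors at p this is the Riemannian volume form, which fixes
   the orientation. *)
Definition vol (p u v w : E4) : R :=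
  \det (\matrix_(i < 4) tnth [tuple p; u; v; w] i).

(* The unique vector tangent at p with dotk (cross p u v) w = vol p u v w for
   all w tangent at p. *)
Definition cross (p u v : E4) : E4 :=
  \row_i ((if i == 0 then kappa else 1) * vol p u v (delta_mx 0 i)).

(* Orthogonal projection onto the tangent space at p (when kappa = 0 all the
   vectors to which it is applied are already tangent). *)
Definition tproj (p u : E4) : E4 := u - (kappa * dotk u p) *: p.

(* Covariant derivative along c, at time t, of the vector field X along c. *)
Definition covD (c X : R -> E4) (t : R) : E4 := tproj (c t) (derive1 X t).

Definition curvature (X Y Z : E4) : E4 :=
  kappa *: (dotk Y Z *: X - dotk X Z *: Y).

Definition unit_speed_geodesic (g : R -> E4) : Prop :=
  [/\ smooth_on setT g,
      forall t, space_form (g t),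
      forall t, dotk (derive1 g t) (derive1 g t) = 1
    & forall t, covD g (derive1 g) t = 0].

(* An oriented geodesic is the class [gamma], represented as a set of
   parametrizations. *)
Definition geod_class (g : R -> E4) : set (R -> E4) :=
  [set d | exists t0, d = (fun t => g (t + t0))].

Definition oriented_geodesics : set (set (R -> E4)) :=
  [set l | exists2 g, unit_speed_geodesic g & l = geod_class g].

(* Quotient topology from the unit tangent bundle. *)
Definition open_oriented_geodesics (O : set (set (R -> E4))) : Prop :=
  exists2 B : set (E4 * E4)%type, open B &
    forall g, unit_speed_geodesic g ->
      (O (geod_class g) <-> B (g 0, derive1 g 0)).

(* The space frakJ_g. *)
Definition jacobi_fields (g : R -> E4) : set (R -> E4) :=
  [set J | [/\ smooth_on setT J,
      forall t, tangent_form (g t) (J t),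
      forall t, dotk (J t) (derive1 g t) = 0
    & forall t,
        covD g (covD g J) t +
        curvature (J t) (derive1 g t) (derive1 g t) = 0]].

Definition cross_metric (g I J : R -> E4) : R :=
  2^-1 * dotk (cross (g 0) (I 0) (covD g J 0) + cross (g 0) (J 0) (covD g I 0))
              (derive1 g 0).

Definition complex_structure (g J : R -> E4) : R -> E4 :=
  fun t => cross (g t) (derive1 g t) (J t).

(* A smooth family of unit speed geodesics parametrized by W. By smooth
   dependence of geodesics on initial conditions, joint smoothness in (w, t)
   amounts to smoothness of the initial velocities. The maps
   w |-> geod_class (Gam w) are, locally, the smooth maps from W into the
   manifold of oriented geodesics. *)
Definition geodesic_family (U : normedModType R) (W : set U)
    (Gam : U -> R -> E4) : Prop :=
  [/\ forall w, W w -> unit_speed_geodesic (Gam w),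
      smooth_on W (fun w => Gam w 0)
    & smooth_on W (fun w => derive1 (Gam w) 0)].

(* The element of frakJ_(Gam w) that represents the derivative at w of
   w |-> geod_class (Gam w) in the direction e. The tangential component of
   the variation field is removed: it is a constant multiple of the velocity
   and only reflects the choice of the parametrizations. *)
Definition dfamily (U : normedModType R) (Gam : U -> R -> E4) (w e : U) :
    R -> E4 :=
  fun t => let X := 'D_e (fun w' => Gam w' t) w in
           X - dotk X (derive1 (Gam w) t) *: derive1 (Gam w) t.

Definition immersive (U : normedModType R) (W : set U)
    (Gam : U -> R -> E4) : Prop :=
  forall w e, W w -> dfamily Gam w e = (fun=> 0) -> e = 0.

Definition injective_family (U : normedModType R) (W : set U)
    (Gam : U -> R -> E4) : Prop :=
  forall w w', W w -> W w' ->
    geod_class (Gam w) = geod_class (Gam w') -> w = w'.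

(* The curve sigma of oriented geodesics is smooth near s0, goes through
   geod_class g at s0, and its velocity there corresponds to the Jacobi field
   J along g. *)
Definition has_velocity (sigma : R -> set (R -> E4)) (s0 : R) (g J : R -> E4) :
    Prop :=
  exists (A : set R) (Gam : R -> R -> E4),
    [/\ open A /\ A s0, geodesic_family A Gam,
        forall s, A s -> sigma s = geod_class (Gam s),
        Gam s0 = g & dfamily Gam s0 1 = J].

(* Local parametrizations (inverses of charts) of the four-dimensional
   manifold of oriented geodesics. *)
Definition local_parametrization (W : set E4) (Gam : E4 -> R -> E4) : Prop :=
  [/\ open W, geodesic_family W Gam, immersive W Gam & injective_family W Gam].

Definition metric_coef (Gam : E4 -> R -> E4) (w : E4) : 'M[R]_4 :=
  \matrix_(i, j) cross_metric (Gam w) (dfamily Gam w (delta_mx 0 i))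
                                      (dfamily Gam w (delta_mx 0 j)).

Definition christoffel (Gam : E4 -> R -> E4) (k i j : 'I_4) (w : E4) : R :=
  2^-1 * \sum_l invmx (metric_coef Gam w) k l *
    ('D_(delta_mx 0 i) (fun w' => metric_coef Gam w' j l) w +
     'D_(delta_mx 0 j) (fun w' => metric_coef Gam w' i l) w -
     'D_(delta_mx 0 l) (fun w' => metric_coef Gam w' i j) w).

(* sigma, defined on the open interval D, is a geodesic of the Levi-Civita
   connection of cross_metric. *)
Definition cross_geodesic (D : set R) (sigma : R -> set (R -> E4)) : Prop :=
  forall s0, D s0 ->
  exists (W : set E4) (Gam : E4 -> R -> E4) (A : set R) (x : R -> E4),
    [/\ local_parametrization W Gam,
        [/\ open A, A s0 & smooth_on A x],
        forall s, A s -> W (x s) /\ sigma s = geod_class (Gam (x s))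
      & forall s k, A s ->
          derive1 (derive1 x) s 0 k +
          \sum_i \sum_j
             christoffel Gam k i j (x s) *
             derive1 x s 0 i * derive1 x s 0 j = 0].

(* Embedded smooth hypersurface (three-dimensional submanifold) of the
   manifold of oriented geodesics: around each point there is an injective
   immersion from an open subset of R^3 that is a homeomorphism onto a
   relatively open subset. *)
Definition smooth_hypersurface (M : set (set (R -> E4))) : Prop :=
  M `<=` oriented_geodesics /\
  forall l, M l ->
  exists (W : set 'rV[R]_3) (Gam : 'rV[R]_3 -> R -> E4),
    [/\ open W,
        exists2 w, W w & l = geod_class (Gam w),
        [/\ geodesic_family W Gam, immersive W Gam & injective_family W Gam]
      & forall W1, open W1 -> W1 `<=` W ->
          exists2 O, open_oriented_geodesics O &
            [set geod_class (Gam w) | w in W1] = M `&` O].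

(* Tangent space of the submanifold M at the class of g, inside frakJ_g. *)
Definition submanifold_tangent (M : set (set (R -> E4))) (g : R -> E4) :
    set (R -> E4) :=
  [set J | jacobi_fields g J /\
     exists sigma, (\forall s \near 0, M (sigma s)) /\
                   has_velocity sigma 0 g J].

Definition cross_normal (g : R -> E4) (T : set (R -> E4)) : set (R -> E4) :=
  [set N | jacobi_fields g N /\ forall X, T X -> cross_metric g N X = 0].

Definition degenerate_on (g : R -> E4) (T : set (R -> E4)) : Prop :=
  exists N, [/\ T N, N <> (fun=> 0) & forall X, T X -> cross_metric g N X = 0].

Definition closed_surface (S : set E4) : Prop :=
  [/\ S `<=` space_form, compact S, connected S
    & forall p, S p ->
      exists (W : set 'rV[R]_2) (phi : 'rV[R]_2 -> E4),
        [/\ open W /\ smooth_on W phi,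
            exists2 w, W w & p = phi w,
            forall w w', W w -> W w' -> phi w = phi w' -> w = w',
            forall w e, W w -> 'D_e phi w = 0 -> e = 0
          & forall W1, open W1 -> W1 `<=` W ->
              exists2 O : set E4, open O & phi @` W1 = S `&` O]].

Definition surface_tangent (S : set E4) (p : E4) : set E4 :=
  [set u | exists (A : set R) (c : R -> E4),
     [/\ open A /\ A 0, smooth_on A c, forall s, A s -> S (c s),
         c 0 = p & derive1 c 0 = u]].

(* nu is (a local extension to an open set O of R^4 of) a smooth unit normal
   vector field on the part of S lying in O. *)
Definition unit_normal_field (S O : set E4) (nu : E4 -> E4) : Prop :=
  [/\ open O, smooth_on O nu
    & forall x, S x -> O x ->
        [/\ tangent_form x (nu x), dotk (nu x) (nu x) = 1
          & forall u, surface_tangent S x u -> dotk (nu x) u = 0]].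

Definition shape_operator (nu : E4 -> E4) (p u : E4) : E4 :=
  - tproj p ('D_u nu p).

Definition quadratically_convex (S : set E4) : Prop :=
  forall p, S p ->
  exists (O : set E4) (nu : E4 -> E4),
    [/\ O p, unit_normal_field S O nu
      & (forall u, surface_tangent S p u -> u <> 0 ->
           0 < dotk (shape_operator nu p u) u) \/
        (forall u, surface_tangent S p u -> u <> 0 ->
           dotk (shape_operator nu p u) u < 0)].

Definition tangent_geodesics (S : set E4) : set (set (R -> E4)) :=
  [set l | oriented_geodesics l /\
     exists g t, [/\ l g, S (g t) & surface_tangent S (g t) (derive1 g t)]].

Definition meets (S : set E4) (l : set (R -> E4)) : Prop :=
  exists g t, l g /\ S (g t).

(* The great sphere orthogonal to n <> 0 is tangent to S at p. *)
Definition great_sphere_tangent (S : set E4) (n p : E4) : Prop :=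
  [/\ n <> 0, S p, dotk p n = 0
    & forall u, surface_tangent S p u -> dotk u n = 0].

(* Only used for kappa = 1. *)
Definition sphere_distance (l : set (R -> E4)) (p : E4) : R :=
  inf [set d | exists g t, l g /\ d = acos (dotk (g t) p)].

(* The set calligraphic C. *)
Definition excluded_circles (S : set E4) : set (set (R -> E4)) :=
  [set l | oriented_geodesics l /\
     exists n p, [/\ great_sphere_tangent S n p,
        forall g t, l g -> dotk (g t) n = 0
      & sphere_distance l p = pi / 2]].

(* The set calligraphic U. *)
Definition billiard_table (S : set E4) : set (set (R -> E4)) :=
  [set l | [/\ oriented_geodesics l, ~ meets S l
             & kappa = 1 -> ~ excluded_circles S l]].

End SpaceForms.

(* Main.v *)
Require Import Defs.
From HB Require Import structures.
From mathcomp Require Import all_boot all_order all_algebra.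
From mathcomp Require Import all_classical all_reals all_analysis.
From mathcomp Require Import ring lra.

Set Implicit Arguments.
Unset Strict Implicit.
Unset Printing Implicit Defensive.

Import Order.TTheory GRing.Theory Num.Theory numFieldNormedType.Exports.

Local Open Scope classical_set_scope.
Local Open Scope ring_scope.

(* In the Pluecker embedding [g] |-> g /\ g', the space of oriented geodesics is
   the set { klein B B = 0, hform B B = 1 } of R^6, and the cross metric is
   -1/2 times the restriction of the Klein form. Its normal space at B is spanned
   by B and star B, so that a geodesic of the cross metric satisfies B'' = a B +
   b star B; if its velocity is null then b = 0 and a is constant. Hence the
   geodesic with initial point p /\ v and initial velocity p /\ u solves
   (p /\ B)'' = a (p /\ B) with zero initial data, and every oriented geodesic
   on it passes through p.
   If l touches S at p with direction v, the tangent space of the hypersurface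
   of tangent geodesics consists of the Jacobi fields tangent to S at p: it
   contains rotations of v in the tangent plane, rolling along v (this uses that
   the second fundamental form does not vanish on v) and displacements across v.
   A field normal to it vanishes at p, hence so does its image under the complex
   structure, whose bivector is therefore of the form p /\ u; and p is in S. *)

(** * Differential calculus in several variables *)

Section SmoothMaps.
Context {R : realType}.
Implicit Types U V : normedModType R.

(** The degenerate direction is the rotation of [l] about the contact point in the tangent plane: if
    w is tangent to [S] and orthogonal to v, its bivector p /\ w has zero Klein product with each of
    p /\ w, p /\ z and w /\ v + p /\ V3, which span the tangent space of the hypersurface. Pairing
    B'' = a B + b star B with B gives b = - klein B' B', which is why a null velocity removes the
    star term; then a = - hform B' B'. At B' = p /\ u this is - |u|^2, never positive, so a
    conserved energy forces the scalar functions klein (p /\ z) B to stay zero. Two analytic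
    obstacles shape the development. Smoothness is expressed by directional derivatives, so Frechet
    differentiability and the symmetry of second derivatives are derived from it. Submanifolds are
    given by parametrizations with relatively open images, so a curve in the submanifold has no
    smooth lift at hand; that its velocity lies in the range of the differential follows from a
    first-order estimate on preimages that are merely close to the base point. *)

Lemma near_eq_continuous (T : topologicalType) (V : topologicalType) (f g : T -> V) x :
  {near x, f =1 g} -> {for x, continuous f} -> {for x, continuous g}.
Proof.
move=> fg cf; rewrite /prop_for /continuous_at -(nbhs_singleton fg).
by apply: cvg_trans cf; apply: near_eq_cvg; apply: filterS fg => y ->.
Qed.

Lemma open_near_eq (T : topologicalType) (V : Type) (W : set T) (f g : T -> V) x :
  open W -> (forall y, W y -> f y = g y) -> W x -> {near x, f =1 g}.
Proof. by move=> oW fg Wx; apply: filterS fg _; exact: open_nbhs_nbhs. Qed.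

Lemma Ck_on_eq U V k (W : set U) (f g : U -> V) : open W ->
  (forall x, W x -> f x = g x) -> Ck_on k W f -> Ck_on k W g.
Proof.
move=> oW; elim: k f g => [|k IH] f g fg /= [cf H];
  have nfg x (Wx : W x) := open_near_eq oW fg Wx.
  by split=> // x Wx; exact: near_eq_continuous (nfg x Wx) (cf x Wx).
split=> [x Wx|]; first exact: near_eq_continuous (nfg x Wx) (cf x Wx).
split=> [x v Wx|v]; first exact: near_eq_derivable (nfg x Wx) (H.1 x v Wx).
by apply: IH (H.2 v) => x Wx; apply: near_eq_derive; exact: nfg.
Qed.

Lemma Ck_onS U V k (W : set U) (f : U -> V) : Ck_on k.+1 W f -> Ck_on k W f.
Proof.
elim: k f => [|k IH] f; first by case.
by move=> [cf [df Hf]]; split=> //; split=> // v; apply: IH; exact: Hf.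
Qed.

Lemma Ck_on_cst U V k (W : set U) (c : V) : Ck_on k W (fun=> c).
Proof.
elim: k c => [|k IH] c; first by split=> // x _; exact: cst_continuous.
split; first by move=> x _; exact: cst_continuous.
split=> [x v _|v]; first exact: derivable_cst.
rewrite (_ : 'D_v _ = (fun=> 0)); first exact: IH.
by apply/funext => x; rewrite derive_cst.
Qed.

Lemma Ck_onD U V k (W : set U) (f g : U -> V) : open W ->
  Ck_on k W f -> Ck_on k W g -> Ck_on k W (f \+ g).
Proof.
move=> oW; elim: k f g => [|k IH] f g [cf Hf] [cg Hg].
  by split=> // x Wx; apply: continuousD; [exact: cf|exact: cg].
split; first by move=> x Wx; apply: continuousD; [exact: cf|exact: cg].
split=> [x v Wx|v]; first exact: derivableD (Hf.1 x v Wx) (Hg.1 x v Wx).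
apply: (Ck_on_eq (f := 'D_v f \+ 'D_v g)) => //; last exact: IH (Hf.2 v) (Hg.2 v).
by move=> x Wx; rewrite deriveD //; [exact: Hf.1|exact: Hg.1].
Qed.

Lemma is_derive_scale U V (u : U -> R) (f : U -> V) x v :
  derivable u x v -> derivable f x v ->
  is_derive x v (fun y => u y *: f y) (u x *: 'D_v f x + 'D_v u x *: f x).
Proof.
move=> du df.
have cvgm : (fun h => h^-1 *: (((fun y => u y *: f y) \o shift x) (h *: v) -
    u x *: f x)) @ 0^' --> u x *: 'D_v f x + 'D_v u x *: f x.
  rewrite (_ : (fun h => _) = fun h : R => u (h *: v + x) *:
      (h^-1 *: (f (h *: v + x) - f x)) +
      (h^-1 *: (u (h *: v + x) - u x)) *: f x); last first.
    apply/funext => h /=; set y := h *: v + x.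
    have -> : u y *: f y - u x *: f x = u y *: (f y - f x) + (u y - u x) *: f x.
      by rewrite scalerBr scalerBl addrA subrK.
    by rewrite scalerDr !scalerA mulrC.
  apply: cvgD; last by apply: cvgZr_tmp; exact: du.
  apply: cvgZ; last exact: df.
  suff : {for 0, continuous (fun h : R => u (h *: v + x))}.
    by move=> /continuous_withinNx; rewrite scale0r add0r.
  exact/differentiable_continuous/derivable1_diffP/(derivable1P _ _ _).1.
split; first by apply/cvg_ex; eexists; exact: cvgm.
exact: cvg_lim cvgm.
Qed.

(** The Leibniz rule gives two products; in each of them the undifferentiated factor is lowered by
    one order, so the induction hypothesis applies to both. *)
Lemma Ck_on_scale U V k (W : set U) (u : U -> R) (f : U -> V) : open W ->
  Ck_on k W u -> Ck_on k W f -> Ck_on k W (fun x => u x *: f x).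
Proof.
move=> oW; elim: k u f => [|k IH] u f Hu Hf.
  have [[cu _] [cf _]] := (Hu, Hf).
  by split=> // x Wx; apply: continuousZ; [exact: cu|exact: cf].
have [[cu [du Du]] [cf [df Df]]] := (Hu, Hf).
split; first by move=> x Wx; apply: continuousZ; [exact: cu|exact: cf].
split=> [x v Wx|v].
  by have [] := is_derive_scale (du x v Wx) (df x v Wx).
apply: (Ck_on_eq (f := (fun x => u x *: 'D_v f x) \+ (fun x => 'D_v u x *: f x))) => //.
  by move=> x Wx; have [_ ->] := is_derive_scale (du x v Wx) (df x v Wx).
by apply: Ck_onD => //; apply: IH; [exact: Ck_onS Hu|exact: Df|exact: Du|exact: Ck_onS Hf].
Qed.

Lemma Ck_on_coord U k m n (W : set U) (f : U -> 'M[R]_(m, n)) i j : open W ->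
  Ck_on k W f -> Ck_on k W (fun x => f x i j).
Proof.
move=> oW; elim: k f => [|k IH] f [cf Hf].
  split=> // x Wx; apply: (@continuous_comp _ _ _ f (fun M : 'M[R]_(m, n) => M i j)).
    exact: cf.
  exact: coord_continuous.
split.
  move=> x Wx; apply: (@continuous_comp _ _ _ f (fun M : 'M[R]_(m, n) => M i j)).
    exact: cf.
  exact: coord_continuous.
split=> [x v Wx|v]; first exact: (derivable_mxP _ _ _).1 (Hf.1 x v Wx) i j.
apply: Ck_on_eq oW _ (IH _ (Hf.2 v)) => x Wx.
by rewrite (derive_mx (Hf.1 x v Wx)) mxE.
Qed.

Lemma smooth_onD U V (W : set U) (f g : U -> V) : open W ->
  smooth_on W f -> smooth_on W g -> smooth_on W (f \+ g).
Proof. by move=> oW Hf Hg k; exact: Ck_onD. Qed.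

Lemma smooth_onZ U V (W : set U) (c : R) (f : U -> V) : open W ->
  smooth_on W f -> smooth_on W (fun x => c *: f x).
Proof. by move=> oW Hf k; apply: Ck_on_scale => //; exact: Ck_on_cst. Qed.

Lemma smooth_on_derivable U V (W : set U) (f : U -> V) x v :
  smooth_on W f -> W x -> derivable f x v.
Proof. by move=> /(_ 1%N) [_ [df _]]; exact: df. Qed.

Lemma smooth_on_continuous U V (W : set U) (f : U -> V) x :
  smooth_on W f -> W x -> {for x, continuous f}.
Proof. by move=> /(_ 0%N) [cf _]; exact: cf. Qed.

Lemma smooth_on_derive U V (W : set U) (f : U -> V) v :
  smooth_on W f -> smooth_on W ('D_v f).
Proof. by move=> Hf k; have [_ [_]] := Hf k.+1; exact. Qed.

Definition line U (x e : U) (s : R) : U := x + s *: e.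

Lemma line_continuous U (x e : U) : continuous (line x e).
Proof.
by move=> s; apply: cvgD; [exact: cvg_cst|exact: scalel_continuous].
Qed.

Lemma open_line U (W : set U) (x e : U) : open W -> open (line x e @^-1` W).
Proof. by apply: open_comp => s _; exact: line_continuous. Qed.

(** Both sides are limits of the same difference quotient. Through this identity the calculus of one
    variable reaches maps of several variables. *)
Lemma derive_line U V (f : U -> V) (x e : U) (s a : R) :
  'D_a (f \o line x e) s = 'D_(a *: e) f (line x e s).
Proof.
rewrite /derive; congr (lim (_ @ 0^')); apply/funext => h /=.
by rewrite /line /= scalerDl scalerA addrCA.
Qed.

Lemma derivable_line U V (f : U -> V) (x e : U) (s a : R) :
  derivable f (line x e s) (a *: e) -> derivable (f \o line x e) s a.
Proof.
rewrite /derivable; set g1 := (fun h => _); set g2 := (fun h => _).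
suff -> : g1 = g2 by [].
by apply/funext => h; rewrite /g1 /g2 /= /line /= scalerDl scalerA addrCA.
Qed.

Lemma Ck_on_line U V k (W : set U) (f : U -> V) (x e : U) :
  Ck_on k W f -> Ck_on k (line x e @^-1` W) (f \o line x e).
Proof.
elim: k f => [|k IH] f [cf Hf].
  split=> // s Ws; apply: continuous_comp; first exact: line_continuous.
  exact: cf.
split=> [s Ws|].
  by apply: continuous_comp; [exact: line_continuous|exact: cf].
split=> [s v Ws|v]; first by apply: derivable_line; exact: Hf.1.
rewrite (_ : 'D_v _ = 'D_(v *: e) f \o line x e); first exact: IH (Hf.2 _).
by apply/funext => s; rewrite derive_line.
Qed.

End SmoothMaps.

(** * Frechet differentiability from continuous partial derivatives *)

Section FrechetDerivative.
Context {R : realType}.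
Implicit Types U V : normedModType R.

(** The parameter is bounded by absolute values so that one statement covers both signs of [a], as
    needed for coordinate increments. *)
Lemma MVT_line U (f : U -> R) x v (a : R) :
  (forall t : R, `|t| <= `|a| -> derivable f (x + t *: v) v) ->
  exists2 t : R, `|t| <= `|a| & f (x + a *: v) - f x = a * 'D_v f (x + t *: v).
Proof.
move=> df.
have dphi (t : R) : `|t| <= `|a| ->
    is_derive t 1 (f \o line x v) ('D_v f (x + t *: v)).
  move=> ta; split; last by rewrite derive_line scale1r.
  by apply: derivable_line; rewrite scale1r; exact: df.
have phi0 : f x = (f \o line x v) 0 by rewrite /= /line scale0r addr0.
have [a0|a0] := leP 0 a.
- have sub (t : R) : t \in `[0, a]%R -> `|t| <= `|a|.
    by rewrite in_itv /= => /andP[t0 ta]; rewrite !ger0_norm.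
  have [||t ta E] := MVT_segment (f := f \o line x v)
      (df := fun t => 'D_v f (x + t *: v)) a0.
  + by move=> t ta; apply: dphi; apply: sub; exact: subset_itv_oo_cc.
  + apply: derivable_within_continuous => t ta.
    by have [] := dphi t (sub t ta).
  by exists t; [exact: sub|rewrite phi0 -/(line x v a) E subr0 mulrC].
- have sub (t : R) : t \in `[a, 0]%R -> `|t| <= `|a|.
    by rewrite in_itv /= => /andP[t0 ta]; rewrite ler0_norm // ltr0_norm // lerN2.
  have [||t ta E] := MVT_segment (f := f \o line x v)
      (df := fun t => 'D_v f (x + t *: v)) (ltW a0).
  + by move=> t ta; apply: dphi; apply: sub; exact: subset_itv_oo_cc.
  + apply: derivable_within_continuous => t ta.
    by have [] := dphi t (sub t ta).
  exists t; first exact: sub.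
  by rewrite phi0 -[LHS]opprB [X in - X]E sub0r mulrN opprK mulrC.
Qed.

Lemma norm_coord m n (M : 'M[R]_(m, n)) i j : `|M i j| <= `|M|.
Proof. by rewrite [leRHS]/Num.norm /= mx_normrE; exact: (le_bigmax _ _ (i, j)). Qed.

Lemma norm_le_coord m n (M : 'M[R]_(m, n)) (e : R) : 0 <= e ->
  (forall i j, `|M i j| <= e) -> `|M| <= e.
Proof.
move=> e0 Me; rewrite [leLHS]/Num.norm /= mx_normrE.
by apply: bigmax_le => // -[i j] _; exact: Me.
Qed.

Lemma near_dist_le (V : normedModType R) (x : V) (e : R) : 0 < e ->
  \forall y \near x, `|x - y| <= e.
Proof.
by move=> e0; apply: filterS (nbhsx_ballx x e e0) => y; rewrite -ball_normE => /ltW.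
Qed.

Lemma mulmxr_continuous m n p (A : 'M[R]_(n, p)) :
  continuous (fun M : 'M[R]_(m, n) => M *m A).
Proof.
move=> M; apply/(@cvgrPdist_le _ _ _ (nbhs M)) => e e0.
set k := \sum_i \sum_j `|A i j| + 1.
have k0 : 0 < k.
  by apply: ltr_pwDr => //; apply: sumr_ge0 => i _; apply: sumr_ge0.
have ek0 : 0 < e / k by rewrite divr_gt0.
apply: filterS (near_dist_le M ek0) => N MN; rewrite -mulmxBl; apply: norm_le_coord; first exact: ltW.
move=> i j; rewrite mxE (le_trans (ler_norm_sum _ _ _)) //.
apply: (@le_trans _ _ (\sum_l `|A l j| * (e / k))).
  apply: ler_sum => l _; rewrite normrM mulrC ler_wpM2l //.
  exact: le_trans (norm_coord _ _ _) MN.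
rewrite -mulr_suml -[leRHS](@divfK _ k) ?gt_eqF // [leRHS]mulrC ler_wpM2r //.
  by rewrite divr_ge0 // ltW.
apply: (@le_trans _ _ (\sum_i0 \sum_j0 `|A i0 j0|)); last by rewrite lerDl.
by apply: ler_sum => l _; rewrite (bigD1 j) //= lerDl sumr_ge0.
Qed.

Lemma near_forall (T : topologicalType) (I : finType) (P : I -> T -> Prop) (x : T) :
  (forall i, \forall y \near x, P i y) -> \forall y \near x, forall i, P i y.
Proof. exact: filter_forall. Qed.

Lemma addr_continuous U (w : U) : continuous (fun h => w + h).
Proof. by move=> h; apply: cvgD; [exact: cvg_cst|exact: cvg_id]. Qed.

Lemma eps_differentiable U V (f : U -> V) (L : {linear U -> V}) x : continuous L ->
  (forall e : R, 0 < e ->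
    \forall h \near (0 : U), `|f (h + x) - (f x + L h)| <= e * `|h|) ->
  differentiable f x.
Proof.
move=> cL fL; apply/diff_locallyP.
have E : f \o shift x = cst (f x) + L +o_ 0 id.
  by apply/eqaddoP => e e0; exact: fL.
by rewrite (diff_unique cL E).
Qed.

(** The increment is telescoped along the coordinate axes. Each step is a mean value of one partial
    derivative at a point no further from [w] than |h|, and continuity compares it with the partial
    derivative at [w]. *)
Lemma C1_differentiable n (W : set 'rV[R]_n) (f : 'rV[R]_n -> R) w :
  open W -> Ck_on 1 W f -> W w -> differentiable f w.
Proof.
move=> oW [cf [df cdf]] Ww.
set A : 'cV[R]_n := \col_i 'D_(delta_mx 0 i) f w.
pose L (h : 'rV[R]_n) : R := (h *m A) 0 0.
have linL : linear L by move=> a x y; rewrite /L mulmxDl -scalemxAl !mxE.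
pose LM := GRing.isLinear.Build _ _ _ _ _ linL.
pose LL : {linear 'rV[R]_n -> R} := HB.pack L LM.
have cL : continuous L.
  have -> : L = (fun M : 'M[R]_(1, 1) => M 0 0 : R) \o (fun h => h *m A) by [].
  move=> h; apply: continuous_comp; first exact: mulmxr_continuous.
  exact: coord_continuous.
apply: (eps_differentiable (L := LL)) => // e e0.
(* The divisor is n + 1 rather than n because n may be 0; the n errors still add up to at most
   [e]. *)
have e'0 : 0 < e / n.+1%:R by rewrite divr_gt0.
have nW : \forall h \near (0 : 'rV[R]_n), forall i,
    W (w + h) /\ `|'D_(delta_mx 0 i) f (w + h) - 'D_(delta_mx 0 i) f w| <= e / n.+1%:R.
  have cw : (w + h) @[h --> (0 : 'rV[R]_n)] --> w.
    by have := @addr_continuous _ w 0; rewrite /continuous_at addr0.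
  apply: near_forall => i; apply: filterI.
    by apply: cw; exact: open_nbhs_nbhs.
  have := (cdf (delta_mx 0 i)).1 w Ww => /(cvg_comp _ _ cw) ci.
  by apply: filterS ((cvgrPdist_le _ _).1 ci _ e'0) => h /=; rewrite distrC.
have [r /= r0 Hr] := (nbhs_ballP _ _).1 nW.
apply: filterS (nbhs0_lt (V := 'rV[R]_n) r0) => h hr.
have {}Hr h' : `|h'| <= `|h| -> forall i, W (w + h') /\
    `|'D_(delta_mx 0 i) f (w + h') - 'D_(delta_mx 0 i) f w| <= e / n.+1%:R.
  move=> h'h; apply: Hr; rewrite -ball_normE /= sub0r normrN.
  exact: le_lt_trans h'h hr.
(* [tr k] keeps the first k coordinates of [h], so it runs from 0 to [h] changing one coordinate at
   a time; in the sup norm all intermediate points stay within |h|. *)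
pose tr k : 'rV[R]_n := \row_i (if (i < k)%N then h 0 i else 0).
have trS (i : 'I_n) (t : R) : `|t| <= `|h 0 i| -> `|tr i + t *: delta_mx 0 i| <= `|h|.
  move=> th; apply: norm_le_coord => // j l; rewrite ord1 !mxE eqxx /=.
  have [->|li] := eqVneq l i; first by rewrite ltnn add0r mulr1 (le_trans th) // norm_coord.
  rewrite mulr0 addr0; case: ifP => _; last by rewrite normr0.
  exact: norm_coord.
have trE (i : 'I_n) : tr i.+1 = tr i + h 0 i *: delta_mx 0 i.
  apply/rowP => l; rewrite !mxE eqxx /= ltnS leq_eqVlt.
  have [->|li] := eqVneq l i; first by rewrite eqxx ltnn add0r mulr1.
  by rewrite -[(_ == _ :> nat)]/(l == i) (negbTE li) mulr0 addr0.
have step (i : 'I_n) : `|f (w + tr i.+1) - f (w + tr i) - h 0 i * 'D_(delta_mx 0 i) f w|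
    <= e / n.+1%:R * `|h|.
  rewrite trE addrA.
  have [|t th ->] := @MVT_line _ f (w + tr i) (delta_mx 0 i) (h 0 i).
    move=> t th; apply: df; rewrite -addrA.
    exact: (Hr _ (trS _ _ th) i).1.
  rewrite -mulrBr normrM mulrC ler_pM //; last exact: norm_coord.
  by rewrite -addrA; exact: (Hr _ (trS _ _ th) i).2.
have sumE k : (k <= n)%N -> f (w + tr k) - f w =
    \sum_(i < n | (i < k)%N) (f (w + tr i.+1) - f (w + tr i)).
  elim: k => [|k IH] kn.
    rewrite big_pred0 // (_ : tr 0%N = 0) ?addr0 ?subrr //.
    by apply/rowP => l; rewrite !mxE.
  rewrite (bigD1 (Ordinal kn)) //= -(subrKA (f (w + tr k))) IH 1?ltnW //.
  congr (_ + _); apply: eq_bigl => i.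
  by rewrite ltnS -val_eqE /= [in RHS]leq_eqVlt; case: ltngtP.
have trn : tr n = h by apply/rowP => l; rewrite mxE ltn_ord.
have -> : f (h + w) - (f w + LL h) = \sum_(i < n)
    (f (w + tr i.+1) - f (w + tr i) - h 0 i * 'D_(delta_mx 0 i) f w).
  transitivity ((f (w + tr n) - f w) - L h).
    by rewrite trn [w + h]addrC opprD addrA.
  rewrite sumE // [in RHS]sumrB; congr (_ - _); first by apply: eq_bigl => i; rewrite ltn_ord.
  by rewrite /= /L mxE; apply: eq_bigr => i _; rewrite mxE.
apply: le_trans (ler_norm_sum _ _ _) _.
apply: (@le_trans _ _ (\sum_(i < n) e / n.+1%:R * `|h|)).
  by apply: ler_sum => i _; exact: step.
rewrite sumr_const card_ord -mulrnAl ler_wpM2r //.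
by rewrite -mulr_natr mulrAC ler_pdivrMr // ler_pM2l // ler_nat.
Qed.

End FrechetDerivative.

(** * Chain rule, symmetry of second derivatives, and curves in immersed images *)

Section ChainRule.
Context {R : realType}.
Implicit Types U V : normedModType R.

Lemma differentiable_coords U m (f : U -> 'rV[R]_m) x :
  (forall j, differentiable (fun y => f y 0 j) x) -> differentiable f x.
Proof.
move=> df.
have -> : f = \sum_j (fun y => f y 0 j *: (delta_mx 0 j : 'rV[R]_m)).
  by apply/funext => y; rewrite fct_sumE; exact: row_sum_delta.
by apply: differentiable_sum => j; exact: differentiableZl.
Qed.

Lemma C1_differentiable_row n m (W : set 'rV[R]_n) (f : 'rV[R]_n -> 'rV[R]_m) w :
  open W -> Ck_on 1 W f -> W w -> differentiable f w.
Proof.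
move=> oW Hf Ww; apply: differentiable_coords => j.
by apply: (C1_differentiable oW) => //; exact: Ck_on_coord.
Qed.

Lemma is_derive_comp_curve U V (f : U -> V) (c : R -> U) (s : R) :
  derivable c s 1 -> differentiable f (c s) ->
  is_derive s 1 (f \o c) ('D_(derive1 c s) f (c s)).
Proof.
move=> /derivable1_diffP dc df.
split; first by apply: diff_derivable; exact: differentiable_comp.
rewrite deriveE; last exact: differentiable_comp.
by rewrite diff_comp //= -derive1E' // -deriveE.
Qed.

Lemma deriveZdir U V (f : U -> V) x (a : R) v : differentiable f x ->
  'D_(a *: v) f x = a *: 'D_v f x.
Proof. by move=> df; rewrite !deriveE // linearZ. Qed.

Lemma deriveDdir U V (f : U -> V) x u v : differentiable f x ->
  'D_(u + v) f x = 'D_u f x + 'D_v f x.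
Proof. by move=> df; rewrite !deriveE // linearD. Qed.

Lemma derive_row n V (f : 'rV[R]_n -> V) x v : differentiable f x ->
  'D_v f x = \sum_i v 0 i *: 'D_(delta_mx 0 i) f x.
Proof.
move=> df; rewrite deriveE // {1}(row_sum_delta v) linear_sum.
by apply: eq_bigr => i _; rewrite linearZ deriveE.
Qed.

Lemma is_derive_translate U V (f : U -> V) (a x v : U) (l : V) :
  is_derive (x + a) v f l -> is_derive x v (fun y => f (y + a)) l.
Proof.
move=> [df <-]; split.
  move: df; rewrite /derivable; set g1 := (fun h => _); set g2 := (fun h => _).
  by suff -> : g1 = g2 by []; apply/funext => h; rewrite /g1 /g2 /= addrA.
rewrite /derive; set g1 := (fun h => _); set g2 := (fun h => _).
by suff -> : g1 = g2 by []; apply/funext => h; rewrite /g1 /g2 /= addrA.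
Qed.

(** The mean value theorem is used twice: along [u] for x |-> f (x + s v) - f x, then along [v] for
    the derivative of [f] in direction [u]. *)
Lemma second_difference U (f : U -> R) (w u v : U) (s : R) :
  (forall t t' : R, `|t| <= `|s| -> `|t'| <= `|s| ->
    derivable f (w + t *: u + t' *: v) u /\
    derivable ('D_u f) (w + t *: u + t' *: v) v) ->
  exists t t' : R, [/\ `|t| <= `|s|, `|t'| <= `|s| &
    f (w + s *: u + s *: v) - f (w + s *: u) - (f (w + s *: v) - f w) =
    s * (s * 'D_v ('D_u f) (w + t *: u + t' *: v))].
Proof.
move=> H.
pose g x := f (x + s *: v) - f x.
have dg (t : R) : `|t| <= `|s| -> is_derive (w + t *: u) u g
    ('D_u f (w + t *: u + s *: v) - 'D_u f (w + t *: u)).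
  move=> ts; apply: is_deriveB.
    apply: is_derive_translate; apply: derivableP.
    exact: (H t s ts (lexx _)).1.
  apply: derivableP; have := (H t 0 ts _).1.
  by rewrite scale0r addr0; apply; rewrite normr0.
have [t ts|t ts Eg] := @MVT_line _ _ g w u s; first by have [] := dg t ts.
have [t' ts'|t' ts' Ef] := @MVT_line _ _ ('D_u f) (w + t *: u) v s.
  exact: (H t t' ts ts').2.
exists t, t'; split=> //; rewrite -Ef.
by have [_ <-] := dg t ts; rewrite -Eg.
Qed.

Lemma continuous_dist_le U V (f : U -> V) x (e : R) : {for x, continuous f} -> 0 < e ->
  \forall y \near x, `|f x - f y| <= e.
Proof. by move=> /cvgrPdist_le; exact. Qed.

Lemma continuous_eq_nearby U (f g : U -> R) w :
  {for w, continuous f} -> {for w, continuous g} ->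
  (forall r : R, 0 < r -> exists x y, [/\ ball w r x, ball w r y & f x = g y]) ->
  f w = g w.
Proof.
move=> cf cg H; apply/eqP; rewrite -subr_eq0 -normr_le0.
apply/ler_addgt0Pr => e e0; rewrite add0r.
have e2 : 0 < e / 2 by rewrite divr_gt0.
have [r1 /= r10 H1] := (nbhs_ballP _ _).1 (continuous_dist_le cf e2).
have [r2 /= r20 H2] := (nbhs_ballP _ _).1 (continuous_dist_le cg e2).
have r0 : 0 < Num.min r1 r2 by rewrite lt_min r10.
have [x [y [wx wy fg]]] := H _ r0.
rewrite (splitr e) -(subrKA (f x)) {2}fg (le_trans (ler_normD _ _)) //.
apply: lerD; first by apply: H1; apply: le_ball wx; rewrite ge_min lexx.
by rewrite distrC; apply: H2; apply: le_ball wy; rewrite ge_min lexx orbT.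
Qed.

(** The second difference of equal step s is symmetric in [u] and [v], so each mixed derivative
    takes the same value somewhere near [w]; continuity of both carries the equality to [w]. *)
Lemma derive_symmetric U (W : set U) (f : U -> R) w u v : open W ->
  Ck_on 2 W f -> W w -> 'D_u ('D_v f) w = 'D_v ('D_u f) w.
Proof.
move=> oW [_ [df Hf]] Ww.
have c2 x y : {for w, continuous ('D_x ('D_y f))}.
  by have [_ [_ /(_ x) [+ _]]] := Hf y; exact.
have d2 x y z : W z -> derivable ('D_x f) z y.
  by move=> Wz; have [_ [+ _]] := Hf x; exact.
apply: (continuous_eq_nearby (c2 u v) (c2 v u)) => r r0.
have nWw : nbhs w W by exact: open_nbhs_nbhs.
have [r' /= r'0 Hr'] := (nbhs_ballP _ _).1 nWw.
pose r1 := Num.min r r'.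
have r10 : 0 < r1 by rewrite lt_min r0.
set k := `|u| + `|v| + 1.
have k0 : 0 < k by rewrite ltr_pwDr // addr_ge0.
(* Since [k] exceeds |u| + |v|, all points w + t u + t' v with |t|, |t'| <= s lie within r1 / 2 of
   [w]. *)
pose s := r1 / 2 / k.
have s0 : 0 < s by rewrite !divr_gt0.
have near_w (t t' : R) : `|t| <= `|s| -> `|t'| <= `|s| ->
    ball w r1 (w + t *: u + t' *: v).
  move=> ts ts'; rewrite -ball_normE /= -addrA opprD addNKr normrN.
  apply: (@le_lt_trans _ _ (s * k)); last first.
    by rewrite /s divfK ?gt_eqF // ltr_pdivrMr // ltr_pMr // ltr1n.
  apply: le_trans (ler_normD _ _) _; rewrite !normrZ.
  rewrite (gtr0_norm s0) in ts ts'.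
  rewrite mulrDr mulr1 mulrDr; apply: ler_wpDr; first exact: ltW.
  by apply: lerD; rewrite ler_wpM2r.
have ballr x : ball w r1 x -> ball w r x.
  by apply: le_ball; rewrite ge_min lexx.
have Wr x : ball w r1 x -> W x.
  by move=> wx; apply: Hr'; apply: le_ball wx; rewrite ge_min lexx orbT.
have [|t [t' [ts ts' E1]]] := @second_difference _ f w u v s.
  by move=> t t' ts ts'; have Wx := Wr _ (near_w t t' ts ts');
    split; [exact: df|exact: d2].
have [|z [z' [zs zs' E2]]] := @second_difference _ f w v u s.
  move=> t0 t0' ts0 ts0'; rewrite addrAC; have Wx := Wr _ (near_w _ _ ts0' ts0).
  by split; [exact: df|exact: d2].
exists (w + z' *: u + z *: v), (w + t *: u + t' *: v).
split; [exact/ballr/near_w|exact/ballr/near_w|].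
have sN0 : s != 0 by rewrite gt_eqF.
have key (a b c d X Y : R) : a - b - (c - d) = s * (s * X) ->
    a - c - (b - d) = s * (s * Y) -> Y = X.
  by move=> h1 h2; apply: (mulfI sN0); apply: (mulfI sN0); rewrite -h1 -h2; ring.
rewrite (addrAC w (s *: v)) (addrAC w (z *: v)) in E2.
exact: key E1 E2.
Qed.

Lemma differentiable_eps U V (f : U -> V) x (e : R) : 0 < e -> differentiable f x ->
  \forall h \near (0 : U), `|f (x + h) - f x - 'd f x h| <= e * `|h|.
Proof.
move=> e0 df; have /eqaddoP/(_ e e0) := diff_locally df.
apply: filterS => h; rewrite -[(_ - _) h]/(f (h + x) - (f x + 'd f x h)).
by rewrite [h + x]addrC opprD addrA.
Qed.

Lemma mulmxr_lipschitz m n p (A : 'M[R]_(n, p)) :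
  exists2 k : R, 0 < k & forall M : 'M[R]_(m, n), `|M *m A| <= k * `|M|.
Proof. exact: (linear_lipschitz (f := mulmxr A)) (@mulmxr_continuous _ m n p A). Qed.

(* Multiplying by Q = 1 - K L, where L K = 1, kills the first-order part of f,
   so that the increments of c are negligible modulo the rows of L. *)
Lemma immersion_curve_velocity n m (f : 'rV[R]_n -> 'rV[R]_m) w0
    (c : R -> 'rV[R]_m) C :
  differentiable f w0 -> row_free (jacobian f w0) ->
  is_derive (0 : R) 1 c C -> c 0 = f w0 ->
  (forall e : R, 0 < e -> \forall s \near (0 : R),
     exists2 w, `|w - w0| < e & f w = c s) ->
  exists e, 'D_e f w0 = C.
Proof.
move=> df /row_freeP[K LK] [dc <-] c0 Hc.
set L := jacobian f w0 in LK *; set C' := 'D_1 c 0.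
exists (C' *m K); rewrite deriveEjacobian // -/L.
pose Q := 1%:M - K *m L.
suff CQ0 : C' *m Q = 0.
  by apply/esym/eqP; rewrite -subr_eq0 -mulmxA -{1}(mulmx1 C') -mulmxBr -/Q CQ0.
have LQ : L *m Q = 0 by rewrite mulmxBr mulmx1 mulmxA LK mul1mx subrr.
have [kQ kQ0 HQ] := mulmxr_lipschitz 1 Q.
have [kK kK0 HK] := mulmxr_lipschitz 1 K.
(* [M] collects the two errors after multiplication by [Q]: kQ e s from the derivative of [c], and
   kQ e |h| from that of [f], where |h| <= 2 kK (|C'| + 1) s. *)
pose M := kQ * (1 + 2 * kK * (`|C'| + 1)).
have M0 : 0 < M.
  by rewrite mulr_gt0 // ltr_pwDl // !mulr_ge0 // ?ltW // ltr_pwDr.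
suff bound (e : R) : 0 < e -> e <= 1 -> e * kK <= 2^-1 -> `|C' *m Q| <= M * e.
  apply/eqP; rewrite -normr_eq0 eq_le normr_ge0 andbT.
  apply/ler_addgt0Pr => d d0; rewrite add0r.
  pose e := Num.min (d / M) (Num.min 1 ((2 * kK)^-1)).
  have e0 : 0 < e by rewrite !lt_min divr_gt0 // ltr01 invr_gt0 mulr_gt0.
  apply: le_trans (bound e e0 _ _) _.
  - by rewrite /e !ge_min lexx orbT.
  - by rewrite -ler_pdivlMr // -invfM /e !ge_min lexx !orbT.
  - by rewrite mulrC -ler_pdivlMr // /e !ge_min lexx.
move=> e0 e1 ek.
have [r /= r0 Hr] := (nbhs_ballP _ _).1 (differentiable_eps e0 df).
have := differentiable_eps e0 ((derivable1_diffP _ _).1 dc).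
have := Hc r r0 => nc nd.
have [d /= d0 Hd] := (nbhs_ballP _ _).1 (filterI nc nd).
pose s := d / 2.
have s0 : 0 < s by rewrite divr_gt0.
have [|[w wr fw] /=] := Hd s.
  by rewrite -ball_normE /= sub0r normrN gtr0_norm // ltr_pdivrMr // ltr_pMr // ltr1n.
rewrite add0r diff1E; last exact/derivable1_diffP.
rewrite derive1E -/C' c0 -fw (gtr0_norm s0) => ns.
have := Hr (w - w0); rewrite -ball_normE /= sub0r normrN => /(_ wr).
rewrite [w0 + _]addrC subrK.
have -> : 'd f w0 (w - w0) = (w - w0) *m L by rewrite mul_rV_lin1.
set h := w - w0; set D := f w - f w0 in ns * => nh.
have Dle : `|D| <= (`|C'| + 1) * s.
  rewrite -(subrK (s *: C') D) (le_trans (ler_normD _ _)) // normrZ (gtr0_norm s0).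
  rewrite mulrDl mul1r addrC [`|C'| * s]mulrC lerD2l (le_trans ns) //.
  by rewrite ler_piMl // ltW.
(* The preimage increment is recovered with [K]; its error is at most e kK |h| <= |h| / 2 and is
   absorbed on the left. *)
have hle : `|h| <= 2 * kK * `|D|.
  have E : h = D *m K - (D - h *m L) *m K.
    by rewrite -mulmxBl opprB addrC subrK -mulmxA LK mulmx1.
  have : `|h| <= kK * `|D| + 2^-1 * `|h|.
    rewrite {1}E (le_trans (ler_normB _ _)) // lerD ?HK //.
    rewrite (le_trans (HK _)) // (le_trans (ler_wpM2l (ltW kK0) nh)) //.
    by rewrite mulrA ler_wpM2r // mulrC.
  lra.
have E : s *: (C' *m Q) = (D - h *m L) *m Q - (D - s *: C') *m Q.
  by rewrite -mulmxBl opprB addrC addrA subrK mulmxBl -mulmxA LQ mulmx0 subr0 scalemxAl.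
have : s * `|C' *m Q| <= kQ * (e * `|h|) + kQ * (e * s).
  rewrite -{1}(gtr0_norm s0) -normrZ E (le_trans (ler_normB _ _)) // lerD //;
    apply: le_trans (HQ _) _; by rewrite ler_wpM2l // ltW.
have hs : `|h| <= 2 * kK * (`|C'| + 1) * s.
  by rewrite (le_trans hle) // -[leRHS]mulrA ler_wpM2l // mulr_ge0 // ltW.
have ehs : kQ * (e * `|h|) <= kQ * (e * (2 * kK * (`|C'| + 1) * s)).
  by rewrite (ler_wpM2l (ltW kQ0)) // (ler_wpM2l (ltW e0)).
move=> H; rewrite -(ler_pM2l s0) (le_trans H) // (le_trans (lerD ehs (lexx _))) //.
by rewrite le_eqVlt; apply/orP; left; apply/eqP; rewrite /M; ring.
Qed.

Lemma is_derive0_interval_cst (D : set R) (f : R -> R) : open D -> is_interval D -> D 0 ->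
  (forall s, D s -> is_derive s 1 f 0) -> forall s, D s -> f s = f 0.
Proof.
move=> oD iD D0 df.
have key a b : D a -> D b -> a <= b -> f b = f a.
  move=> Da Db ab.
  have sub x : x \in `[a, b]%R -> D x.
    by rewrite in_itv /= => /andP[ax xb]; apply: (iD a b Da Db); rewrite ax xb.
  have [||c _ /eqP] := MVT_segment (f := f) (df := fun=> 0) ab.
  - by move=> x xab; apply: df; apply: sub; exact: subset_itv_oo_cc.
  - apply: derivable_within_continuous => x xab.
    by have [] := df x (sub x xab).
  - by rewrite mul0r subr_eq0 => /eqP.
move=> s Ds; have [s0|s0] := leP 0 s; first exact: key.
by apply/esym; apply: key => //; exact: ltW.
Qed.

End ChainRule.

(** * Coordinates and the Klein form *)

Section Coordinates.
Context {R : realType}.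

(* Locked, so that [ring] compares coordinates only syntactically. *)
Definition crd {n} (k : nat) : 'rV[R]_n.+1 -> R :=
  locked (fun x : 'rV[R]_n.+1 => x 0 (inord k)).

Lemma crdE n k (x : 'rV[R]_n.+1) : crd k x = x 0 (inord k).
Proof. by rewrite /crd -lock. Qed.

Lemma crd_ord n (i : 'I_n.+1) (x : 'rV[R]_n.+1) : x 0 i = crd i x.
Proof. by rewrite crdE inord_val. Qed.

Lemma crdD n k (x y : 'rV[R]_n.+1) : crd k (x + y) = crd k x + crd k y.
Proof. by rewrite !crdE mxE. Qed.

Lemma crdN n k (x : 'rV[R]_n.+1) : crd k (- x) = - crd k x.
Proof. by rewrite !crdE mxE. Qed.

Lemma crdZ n k a (x : 'rV[R]_n.+1) : crd k (a *: x) = a * crd k x.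
Proof. by rewrite !crdE mxE. Qed.

Lemma crd0 n k : crd k (0 : 'rV[R]_n.+1) = 0.
Proof. by rewrite !crdE mxE. Qed.

Definition crdL := (crdD, crdN, crdZ, crd0).

Lemma row4P (x y : 'rV[R]_4) : crd 0 x = crd 0 y -> crd 1 x = crd 1 y ->
  crd 2 x = crd 2 y -> crd 3 x = crd 3 y -> x = y.
Proof.
move=> h0 h1 h2 h3; apply/rowP => i; rewrite !crd_ord.
by case: i => [[|[|[|[|]]]] ?].
Qed.

Lemma row6P (x y : 'rV[R]_6) : crd 0 x = crd 0 y -> crd 1 x = crd 1 y ->
  crd 2 x = crd 2 y -> crd 3 x = crd 3 y -> crd 4 x = crd 4 y ->
  crd 5 x = crd 5 y -> x = y.
Proof.
move=> h0 h1 h2 h3 h4 h5; apply/rowP => i; rewrite !crd_ord.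
by case: i => [[|[|[|[|[|[|]]]]]] ?].
Qed.

Lemma dotkE (k : R) x y : dotk k x y =
  k * crd 0 x * crd 0 y + (crd 1 x * crd 1 y + crd 2 x * crd 2 y + crd 3 x * crd 3 y).
Proof. by rewrite /dotk !big_ord_recl big_ord0 !crd_ord /= addr0 !addrA. Qed.

(** The form defining the space form and its tangent spaces: kform p p = 1 and kform p u = 0. For
    kappa = 1 or -1 it is kappa times [dotk]; for kappa = 0 the two are complementary degenerate
    forms, [kform] seeing only the zeroth coordinate and [dotk] the other three. *)
Definition kform (k : R) (x y : 'rV[R]_4) : R :=
  crd 0 x * crd 0 y + k * (crd 1 x * crd 1 y + crd 2 x * crd 2 y + crd 3 x * crd 3 y).

Lemma kformC k x y : kform k x y = kform k y x.
Proof. by rewrite /kform; ring. Qed.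

Lemma kform_sum k (x y : 'rV[R]_4) :
  x 0 0 * y 0 0 + k * \sum_(i < 3) x 0 (lift 0 i) * y 0 (lift 0 i) = kform k x y.
Proof. by rewrite !big_ord_recl big_ord0 !crd_ord /= /kform; ring. Qed.

Lemma tangent_formE k x y : tangent_form k x y <-> kform k x y = 0.
Proof. by rewrite -kform_sum. Qed.

Lemma space_formE k x :
  space_form k x <-> kform k x x = 1 /\ (k <= 0 -> 0 < crd 0 x).
Proof.
rewrite -kform_sum /space_form /= -(crd_ord ord0) expr2.
by under eq_bigr do rewrite expr2.
Qed.

(** The entries are a function of natural numbers, so that the minors have the same shape and the
    expansion can be iterated down to size 1. *)
Lemma det_matrix_expand n (f : nat -> nat -> R) :
  \det (\matrix_(i < n.+1, j < n.+1) f i j) =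
  \sum_(j < n.+1) (-1) ^+ j * f 0 j * \det (\matrix_(i < n, l < n) f i.+1 (bump j l)).
Proof.
rewrite (expand_det_row _ ord0); apply: eq_bigr => j _.
rewrite mxE /cofactor /= add0n mulrA [f _ _ * _]mulrC; congr (_ * \det _).
by apply/matrixP => i l; rewrite !mxE.
Qed.

Definition det3 (a1 a2 a3 b1 b2 b3 c1 c2 c3 : R) : R :=
  a1 * (b2 * c3 - b3 * c2) - a2 * (b1 * c3 - b3 * c1) + a3 * (b1 * c2 - b2 * c1).

Lemma volE (p u v w : 'rV[R]_4) : vol p u v w =
  crd 0 p * det3 (crd 1 u) (crd 2 u) (crd 3 u) (crd 1 v) (crd 2 v) (crd 3 v)
                 (crd 1 w) (crd 2 w) (crd 3 w)
  - crd 1 p * det3 (crd 0 u) (crd 2 u) (crd 3 u) (crd 0 v) (crd 2 v) (crd 3 v)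
                   (crd 0 w) (crd 2 w) (crd 3 w)
  + crd 2 p * det3 (crd 0 u) (crd 1 u) (crd 3 u) (crd 0 v) (crd 1 v) (crd 3 v)
                   (crd 0 w) (crd 1 w) (crd 3 w)
  - crd 3 p * det3 (crd 0 u) (crd 1 u) (crd 2 u) (crd 0 v) (crd 1 v) (crd 2 v)
                   (crd 0 w) (crd 1 w) (crd 2 w).
Proof.
pose f (i j : nat) := crd j (nth 0 [:: p; u; v; w] i).
have -> : vol p u v w = \det (\matrix_(i < 4, j < 4) f i j).
  rewrite /vol; congr (\det _); apply/matrixP => i j; rewrite !mxE /f crd_ord.
  by rewrite (tnth_nth 0).
have d1 (g : nat -> nat -> R) : \det (\matrix_(i < 1, j < 1) g i j) = g 0%N 0%N.
  by rewrite det_mx11 mxE.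
have d2 (g : nat -> nat -> R) : \det (\matrix_(i < 2, j < 2) g i j) =
    g 0%N 0%N * g 1%N 1%N - g 0%N 1%N * g 1%N 0%N.
  rewrite det_matrix_expand !big_ord_recl big_ord0.
  rewrite !(d1 (fun i l => g i.+1 (bump _ l))) /= /bump /=; ring.
have d3 (g : nat -> nat -> R) : \det (\matrix_(i < 3, j < 3) g i j) =
    det3 (g 0 0) (g 0 1) (g 0 2) (g 1 0) (g 1 1) (g 1 2) (g 2 0) (g 2 1) (g 2 2).
  rewrite det_matrix_expand !big_ord_recl big_ord0.
  rewrite !(d2 (fun i l => g i.+1 (bump _ l))) /= /bump /= /det3; ring.
rewrite det_matrix_expand !big_ord_recl big_ord0.
rewrite !(d3 (fun i l => f i.+1 (bump _ l))) /= /bump /= /f /= /det3; ring.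
Qed.

(** The coordinates are ordered 01, 02, 03, 23, 31, 12, so that complementary index pairs are three
    places apart and the wedge product of bivectors has only plus signs. *)
Definition plucker (x y : 'rV[R]_4) : 'rV[R]_6 := \row_a nth 0
  [:: crd 0 x * crd 1 y - crd 1 x * crd 0 y; crd 0 x * crd 2 y - crd 2 x * crd 0 y;
      crd 0 x * crd 3 y - crd 3 x * crd 0 y; crd 2 x * crd 3 y - crd 3 x * crd 2 y;
      crd 3 x * crd 1 y - crd 1 x * crd 3 y; crd 1 x * crd 2 y - crd 2 x * crd 1 y] a.

Lemma crd_plucker x y :
  (crd 0 (plucker x y) = crd 0 x * crd 1 y - crd 1 x * crd 0 y) *
  (crd 1 (plucker x y) = crd 0 x * crd 2 y - crd 2 x * crd 0 y) *
  (crd 2 (plucker x y) = crd 0 x * crd 3 y - crd 3 x * crd 0 y) *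
  (crd 3 (plucker x y) = crd 2 x * crd 3 y - crd 3 x * crd 2 y) *
  (crd 4 (plucker x y) = crd 3 x * crd 1 y - crd 1 x * crd 3 y) *
  (crd 5 (plucker x y) = crd 1 x * crd 2 y - crd 2 x * crd 1 y).
Proof. by do !split; rewrite [LHS]crdE mxE inordK. Qed.

Definition klein (X Y : 'rV[R]_6) : R :=
  crd 0 X * crd 3 Y + crd 1 X * crd 4 Y + crd 2 X * crd 5 Y +
  crd 3 X * crd 0 Y + crd 4 X * crd 1 Y + crd 5 X * crd 2 Y.

(** For kappa = 1 this is the Hodge star on bivectors; for every kappa it expresses [hform] through
    the Klein form. *)
Definition star (k : R) (X : 'rV[R]_6) : 'rV[R]_6 := \row_a nth 0
  [:: k * crd 3 X; k * crd 4 X; k * crd 5 X; crd 0 X; crd 1 X; crd 2 X] a.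

Lemma crd_star k X :
  (crd 0 (star k X) = k * crd 3 X) * (crd 1 (star k X) = k * crd 4 X) *
  (crd 2 (star k X) = k * crd 5 X) * (crd 3 (star k X) = crd 0 X) *
  (crd 4 (star k X) = crd 1 X) * (crd 5 (star k X) = crd 2 X).
Proof. by do !split; rewrite [LHS]crdE mxE inordK. Qed.

(** On x /\ y, with x a point and y tangent at x, the associated quadratic form takes the value
    |y|^2; it normalizes the Pluecker vector of an oriented geodesic. *)
Definition hform (k : R) (X Y : 'rV[R]_6) : R :=
  crd 0 X * crd 0 Y + crd 1 X * crd 1 Y + crd 2 X * crd 2 Y +
  k * (crd 3 X * crd 3 Y + crd 4 X * crd 4 Y + crd 5 X * crd 5 Y).

Lemma klein_star k X Y : klein X (star k Y) = hform k X Y.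
Proof. by rewrite /klein !crd_star /hform; ring. Qed.

Lemma kleinC X Y : klein X Y = klein Y X.
Proof. by rewrite /klein; ring. Qed.

Lemma kleinDl X X' Y : klein (X + X') Y = klein X Y + klein X' Y.
Proof. by rewrite /klein !crdL; ring. Qed.

Lemma kleinZl a X Y : klein (a *: X) Y = a * klein X Y.
Proof. by rewrite /klein !crdL; ring. Qed.

Lemma kleinDr X Y Y' : klein X (Y + Y') = klein X Y + klein X Y'.
Proof. by rewrite /klein !crdL; ring. Qed.

Lemma kleinZr a X Y : klein X (a *: Y) = a * klein X Y.
Proof. by rewrite /klein !crdL; ring. Qed.

Lemma klein0r X : klein X 0 = 0.
Proof. by rewrite -(scale0r 0) kleinZr mul0r. Qed.

Lemma klein_sumr (I : finType) X (F : I -> 'rV[R]_6) :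
  klein X (\sum_i F i) = \sum_i klein X (F i).
Proof.
elim/big_rec2: _ => [|i a Y _ <-]; first exact: klein0r.
by rewrite kleinDr.
Qed.

Lemma klein_suml (I : finType) X (F : I -> 'rV[R]_6) :
  klein (\sum_i F i) X = \sum_i klein (F i) X.
Proof. by rewrite kleinC klein_sumr; apply: eq_bigr => i _; rewrite kleinC. Qed.

Lemma kleinE X Y : klein X Y = (X *m (star 1 Y)^T) 0 0.
Proof.
rewrite mxE !big_ord_recl big_ord0 !mxE /= !crd_ord /= /klein; ring.
Qed.

(** The matrix of the Klein form is the coordinate permutation [star 1], so orthogonality to the
    rows of an invertible matrix forces [star 1 Y], hence [Y], to vanish. *)
Lemma klein_nondegenerate (M : 'M[R]_6) Y : M \in unitmx ->
  (forall i, klein (row i M) Y = 0) -> Y = 0.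
Proof.
move=> Mu H.
have M0 : M *m (star 1 Y)^T = 0.
  by apply/colP => i; rewrite [RHS]mxE -(H i) kleinE -row_mul [RHS]mxE.
have : star 1 Y = 0.
  by apply: trmx_inj; rewrite trmx0 -(mulKmx Mu (star 1 Y)^T) M0 mulmx0.
move=> s0; apply: row6P; rewrite crd0.
- by have := (crd_star 1 Y).1.1.2; rewrite s0 crd0.
- by have := (crd_star 1 Y).1.2; rewrite s0 crd0.
- by have := (crd_star 1 Y).2; rewrite s0 crd0.
- by have := (crd_star 1 Y).1.1.1.1.1; rewrite s0 crd0 mul1r.
- by have := (crd_star 1 Y).1.1.1.1.2; rewrite s0 crd0 mul1r.
- by have := (crd_star 1 Y).1.1.1.2; rewrite s0 crd0 mul1r.
Qed.

Lemma klein_plucker a b c d : klein (plucker a b) (plucker c d) = vol a b c d.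
Proof. by rewrite /klein !crd_plucker volE /det3; ring. Qed.

Lemma pluckerxx x : plucker x x = 0.
Proof. by apply: row6P; rewrite !(crdL, crd_plucker); ring. Qed.

Lemma pluckerZl a x z : plucker (a *: x) z = a *: plucker x z.
Proof. by apply: row6P; rewrite !(crdL, crd_plucker); ring. Qed.

Lemma pluckerDr x y z : plucker z (x + y) = plucker z x + plucker z y.
Proof. by apply: row6P; rewrite !(crdL, crd_plucker); ring. Qed.

Lemma pluckerZr a x z : plucker z (a *: x) = a *: plucker z x.
Proof. by apply: row6P; rewrite !(crdL, crd_plucker); ring. Qed.

Lemma vol_eq0_comb (a b c d : 'rV[R]_4) : vol a b c d = 0 ->
  exists r0 r1 r2 r3 : R, ~ [/\ r0 = 0, r1 = 0, r2 = 0 & r3 = 0] /\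
    r0 *: a + r1 *: b + r2 *: c + r3 *: d = 0.
Proof.
move=> /eqP/det0P[r r0 rM]; exists (crd 0 r), (crd 1 r), (crd 2 r), (crd 3 r).
split.
  move=> [h0 h1 h2 h3]; case/eqP: r0; apply: row4P; by rewrite crd0.
rewrite -[RHS]rM mulmx_sum_row !big_ord_recl big_ord0 !rowK !(tnth_nth 0) !crd_ord /=.
by rewrite addr0 !addrA.
Qed.

End Coordinates.

(** * Generalized trigonometric functions and positivity on tangent spaces *)

Section SpaceFormTrigonometry.
Context {R : realType}.
Variable kappa : R.
Hypothesis hkappa : [\/ kappa = 0, kappa = 1 | kappa = -1].
Local Notation E4 := 'rV[R]_4.

(** [ck] and [sk] are the solutions of f'' = - kappa f with initial data (1, 0) and (0, 1). The last
    branch, cosh and sinh, stands for kappa = -1. *)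
Definition ck (t : R) : R := if kappa == 0 then 1 else
  if kappa == 1 then cos t else (expR t + expR (- t)) / 2.

Definition sk (t : R) : R := if kappa == 0 then t else
  if kappa == 1 then sin t else (expR t - expR (- t)) / 2.

Lemma N1_neq01 : ((-1 == 0 :> R) = false) * ((-1 == 1 :> R) = false).
Proof. by split; apply/eqP; lra. Qed.

Lemma kappa3 : kappa * kappa * kappa = kappa.
Proof. by case: hkappa => ->; ring. Qed.

Lemma ck0 : ck 0 = 1.
Proof.
rewrite /ck; case: hkappa => ->; rewrite ?eqxx ?oner_eq0 ?N1_neq01 //.
  exact: cos0.
rewrite oppr0 expR0; lra.
Qed.

Lemma sk0 : sk 0 = 0.
Proof.
rewrite /sk; case: hkappa => ->; rewrite ?eqxx ?oner_eq0 ?N1_neq01 //.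
  exact: sin0.
rewrite oppr0 expR0; lra.
Qed.

Lemma ck2Dsk2 t : ck t * ck t + kappa * (sk t * sk t) = 1.
Proof.
rewrite /ck /sk; case: hkappa => ->; rewrite ?eqxx ?oner_eq0 ?N1_neq01.
- by rewrite mul0r addr0 mulr1.
- by rewrite mul1r -!expr2 cos2Dsin2.
- have : expR t * expR (- t) = 1 by rewrite -expRD subrr expR0.
  set a := expR t; set b := expR (- t) => ab.
  lra.
Qed.

Lemma is_derive_expRN (t : R) : is_derive t 1 (fun t => expR (- t)) (- expR (- t)).
Proof.
have H := is_derive_comp_curve (f := expR) (c := -%R) (s := t) _ _.
have {}H : is_derive t 1 (expR \o -%R) ('D_(derive1 -%R t) expR (- t)).
  by apply: H; [exact: derivable_opp|exact/derivable1_diffP/derivable_expR].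
apply: is_derive_eq H _.
have -> : derive1 -%R t = -1 *: (1 : R).
  by rewrite derive1E derive_val scaleN1r.
by rewrite deriveZdir ?derive_val ?scaleN1r //; exact/derivable1_diffP/derivable_expR.
Qed.

Lemma is_derive_ck (t : R) : is_derive t 1 ck (- kappa * sk t).
Proof.
rewrite /ck /sk; case: hkappa => ->; rewrite ?eqxx ?oner_eq0 ?N1_neq01.
- by rewrite oppr0 mul0r; exact: is_derive_cst.
- by rewrite mulN1r; exact: is_derive_cos.
- have H : is_derive t 1 (2^-1 *: (expR + (fun t : R => expR (- t))))
      (2^-1 *: (expR t + - expR (- t))).
    by apply: is_deriveZ; apply: is_deriveD; exact: is_derive_expRN.
  rewrite opprK mul1r mulrC.
  rewrite (_ : (fun _ => _) = 2^-1 *: (expR + (fun t : R => expR (- t)))) //.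
  by apply/funext => x; rewrite mulrC.
Qed.

Lemma is_derive_sk (t : R) : is_derive t 1 sk (ck t).
Proof.
rewrite /ck /sk; case: hkappa => ->; rewrite ?eqxx ?oner_eq0 ?N1_neq01.
- exact: is_derive_id.
- exact: is_derive_sin.
- have H : is_derive t 1 (2^-1 *: (expR - (fun t : R => expR (- t))))
      (2^-1 *: (expR t - - expR (- t))).
    by apply: is_deriveZ; apply: is_deriveB; exact: is_derive_expRN.
  rewrite opprK mulrC in H *.
  rewrite (_ : (fun _ => _) = 2^-1 *: (expR - (fun t : R => expR (- t)))) //.
  by apply/funext => x; rewrite mulrC.
Qed.

(** The conic a^2 + kappa b^2 = 1 is connected for kappa = 1 and has two components otherwise; the
    sign alternative accounts for the second one. *)
Lemma ck_sk_surj (a b : R) : a * a + kappa * (b * b) = 1 ->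
  exists t, a = ck t /\ b = sk t \/ kappa <= 0 /\ a = - ck t /\ b = - sk t.
Proof.
rewrite /ck /sk; case: hkappa => ->; rewrite ?eqxx ?oner_eq0 ?N1_neq01.
- rewrite mul0r addr0 => /eqP; rewrite -expr2 sqrf_eq1 => /orP[] /eqP ->.
  + by exists b; left.
  + by exists (- b); right; rewrite opprK.
- rewrite mul1r => ab.
  have a1 : -1 <= a <= 1 by apply/andP; split; nra.
  have [b0|b0] := leP 0 b.
  + exists (acos a); left; rewrite acosK //; split=> //.
    by rewrite sin_acos // -[LHS]ger0_norm // -sqrtr_sqr; congr Num.sqrt; lra.
  + exists (- acos a); left; rewrite cosN acosK //; split=> //.
    rewrite sinN sin_acos // -[LHS]opprK -(ltr0_norm b0) -sqrtr_sqr.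
    by congr (- Num.sqrt _); lra.
- move=> ab.
  have key (x y : R) : 0 < x -> x * x + -1 * (y * y) = 1 ->
      exists t, x = (expR t + expR (- t)) / 2 /\ y = (expR t - expR (- t)) / 2.
    move=> x0 xy; have xy0 : 0 < x + y by nra.
    (* As cosh t + sinh t = exp t, the parameter must be ln (x + y); the equation of the hyperbola
       says that the inverse of x + y is x - y. *)
    exists (ln (x + y)); rewrite expRN lnK //.
    have -> : (x + y)^-1 = x - y.
      apply: (mulfI (x := x + y)); first by rewrite gt_eqF.
      by rewrite divff ?gt_eqF //; lra.
    by split; field.
  have [a0|a0] := ltP 0 a.
    by have [t ?] := key a b a0 ab; exists t; left.
  have [||t [ta tb]] := key (- a) (- b); [nra|lra|].
  by exists t; right; rewrite -ta -tb !opprK; split=> //; lra.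
Qed.

(** A geodesic stays on its sheet. For kappa = -1 the Cauchy-Schwarz inequality gives (x0 y0)^2 <=
    (x0^2 - 1)(y0^2 + 1), so |y0| < x0, and the expression is half of exp t (x0 + y0) + exp (- t)
    (x0 - y0). *)
Lemma ck_sk_gt0 t (x y : E4) : kappa <= 0 -> kform kappa x x = 1 -> 0 < crd 0 x ->
  kform kappa x y = 0 -> dotk kappa y y = 1 -> 0 < ck t * crd 0 x + sk t * crd 0 y.
Proof.
rewrite /ck /sk dotkE /kform; case: hkappa => ->; rewrite ?eqxx ?oner_eq0 ?N1_neq01.
- move=> _ _ x0; rewrite !mul0r addr0 => /eqP; rewrite mulf_eq0 (gt_eqF x0) /=.
  by move=> /eqP -> _; rewrite mulr0 addr0 mul1r.
- by lra.
- move=> _ + x0.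
  move: (crd 0 x) (crd 1 x) (crd 2 x) (crd 3 x) x0 => x0 x1 x2 x3 x0_gt0.
  move: (crd 0 y) (crd 1 y) (crd 2 y) (crd 3 y) => y0 y1 y2 y3 xx xy yy.
  have L : (x0 * y0) * (x0 * y0) <=
      (x1 * x1 + x2 * x2 + x3 * x3) * (y1 * y1 + y2 * y2 + y3 * y3).
    have -> : x0 * y0 = x1 * y1 + x2 * y2 + x3 * y3 by lra.
    rewrite -subr_ge0.
    have -> : (x1 * x1 + x2 * x2 + x3 * x3) * (y1 * y1 + y2 * y2 + y3 * y3) -
      (x1 * y1 + x2 * y2 + x3 * y3) * (x1 * y1 + x2 * y2 + x3 * y3) =
      (x1 * y2 - x2 * y1) ^+ 2 + (x1 * y3 - x3 * y1) ^+ 2 + (x2 * y3 - x3 * y2) ^+ 2.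
      by ring.
    by rewrite !addr_ge0 // sqr_ge0.
  have E1 : x1 * x1 + x2 * x2 + x3 * x3 = x0 * x0 - 1 by lra.
  have E2 : y1 * y1 + y2 * y2 + y3 * y3 = y0 * y0 + 1 by lra.
  rewrite E1 E2 in L.
  have L' : y0 * y0 < x0 * x0 by nra.
  have h1 : 0 < x0 + y0 by nra.
  have h2 : 0 < x0 - y0 by nra.
  have := expR_gt0 t; have := expR_gt0 (- t).
  set a := expR t; set b := expR (- t) => b0 a0.
  have -> : (a + b) / 2 * x0 + (a - b) / 2 * y0 =
    (a * (x0 + y0) + b * (x0 - y0)) / 2 by field.
  by rewrite divr_gt0 // addr_gt0 // mulr_gt0.
Qed.

Lemma dotk_tangent_gt0 (x y : E4) : kform kappa x x = 1 -> kform kappa x y = 0 ->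
  y <> 0 -> 0 < dotk kappa y y.
Proof.
move=> xx xy yN0; rewrite lt_neqAle; apply/andP.
suff H : 0 <= dotk kappa y y /\ (dotk kappa y y = 0 -> y = 0).
  split; last exact: H.1.
  by apply/eqP => /esym /H.2.
move: xx xy; rewrite /kform dotkE.
have pos3 (a b c : R) : 0 <= a * a + b * b + c * c /\
    (a * a + b * b + c * c = 0 -> [/\ a = 0, b = 0 & c = 0]).
  split; first by nra.
  by move=> h; split; nra.
have [S0 SE] := pos3 (crd 1 y) (crd 2 y) (crd 3 y).
case: hkappa => -> xx xy.
- split; first by lra.
  move=> yy; have [h1 h2 h3] := SE ltac:(lra).
  apply: row4P; rewrite crd0 //.
  have : crd 0 x * crd 0 y = 0 by lra.
  move=> /eqP; rewrite mulf_eq0 => /orP[/eqP x0|/eqP //].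
  by move: xx; rewrite x0; lra.
- split; first by nra.
  move=> yy; have h0 : crd 0 y = 0 by nra.
  have [h1 h2 h3] := SE ltac:(rewrite h0 in yy; lra).
  by apply: row4P; rewrite crd0.
(* Hyperbolic case: by Lagrange's identity x0^2 times the squared length of y is at least its
   spatial part y1^2 + y2^2 + y3^2. *)
- have L : 0 <= (crd 0 x * crd 0 x) * (-1 * crd 0 y * crd 0 y +
      (crd 1 y * crd 1 y + crd 2 y * crd 2 y + crd 3 y * crd 3 y)) -
      (crd 1 y * crd 1 y + crd 2 y * crd 2 y + crd 3 y * crd 3 y).
    move: xx xy; move: (crd 0 x) (crd 1 x) (crd 2 x) (crd 3 x) => x0 x1 x2 x3.
    move: (crd 0 y) (crd 1 y) (crd 2 y) (crd 3 y) => y0 y1 y2 y3 xx xy.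
    have -> : x0 * x0 * (-1 * y0 * y0 + (y1 * y1 + y2 * y2 + y3 * y3)) -
      (y1 * y1 + y2 * y2 + y3 * y3) =
      (x0 * x0 - 1) * (y1 * y1 + y2 * y2 + y3 * y3) - (x0 * y0) * (x0 * y0) by ring.
    have -> : x0 * y0 = x1 * y1 + x2 * y2 + x3 * y3 by lra.
    have -> : x0 * x0 - 1 = x1 * x1 + x2 * x2 + x3 * x3 by lra.
    have -> : (x1 * x1 + x2 * x2 + x3 * x3) * (y1 * y1 + y2 * y2 + y3 * y3) -
      (x1 * y1 + x2 * y2 + x3 * y3) * (x1 * y1 + x2 * y2 + x3 * y3) =
      (x1 * y2 - x2 * y1) ^+ 2 + (x1 * y3 - x3 * y1) ^+ 2 + (x2 * y3 - x3 * y2) ^+ 2.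
      by ring.
    by rewrite !addr_ge0 // sqr_ge0.
  have x0 : 0 < crd 0 x * crd 0 x.
    have [X0 _] := pos3 (crd 1 x) (crd 2 x) (crd 3 x); lra.
  split; first by nra.
  move=> yy; rewrite yy mulr0 in L.
  have [h1 h2 h3] := SE ltac:(lra).
  apply: row4P; rewrite crd0 //; rewrite h1 h2 h3 in yy; nra.
Qed.

End SpaceFormTrigonometry.

(** * Geodesics and Jacobi fields in coordinates *)

Section BilinearMaps.
Context {R : realType}.

Definition bilinear_map (m n : nat) (V : lmodType R)
    (b : 'rV[R]_m -> 'rV[R]_n -> V) : Prop :=
  (forall a x x' y, b (a *: x + x') y = a *: b x y + b x' y) /\
  (forall a x y y', b x (a *: y + y') = a *: b x y + b x y').

Section Expansion.
Variables (m n : nat) (V : lmodType R) (b : 'rV[R]_m -> 'rV[R]_n -> V).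
Hypothesis bb : bilinear_map b.

Lemma bilinear0l y : b 0 y = 0.
Proof. by have := bb.1 (-1) 0 0 y; rewrite scaler0 addr0 scaleN1r addNr. Qed.

Lemma bilinear0r x : b x 0 = 0.
Proof. by have := bb.2 (-1) x 0 0; rewrite scaler0 addr0 scaleN1r addNr. Qed.

Lemma bilinear_expand x y :
  b x y = \sum_(i < m) \sum_(j < n) (x 0 i * y 0 j) *: b (delta_mx 0 i) (delta_mx 0 j).
Proof.
rewrite {1}(row_sum_delta x) {1}(row_sum_delta y).
transitivity (\sum_(i < m) x 0 i *: b (delta_mx 0 i) (\sum_(j < n) y 0 j *: delta_mx 0 j)).
  elim/big_rec2: _ => [|i z t _ <-]; first exact: bilinear0l.
  exact: bb.1.
apply: eq_bigr => i _; under [RHS]eq_bigr do rewrite -scalerA.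
rewrite -scaler_sumr; congr (_ *: _).
elim/big_rec2: _ => [|j z t _ <-]; first exact: bilinear0r.
exact: bb.2.
Qed.

End Expansion.

Lemma is_derive_crd (U : normedModType R) n (f : U -> 'rV[R]_n) x v l i :
  is_derive x v f l -> is_derive x v (fun y => f y 0 i) (l 0 i).
Proof.
move=> [df <-]; split; first exact: (derivable_mxP _ _ _).1 df 0 i.
by rewrite (derive_mx df) mxE.
Qed.

(** Expansion in the standard bases reduces the claim to products of coordinates, so one product
    rule serves [kform], [dotk], [klein], [hform] and [plucker]. *)
Lemma is_derive_bilinear (U V : normedModType R) m n
    (b : 'rV[R]_m -> 'rV[R]_n -> V) (bb : bilinear_map b)
    (f : U -> 'rV[R]_m) (g : U -> 'rV[R]_n) x v df dg :
  is_derive x v f df -> is_derive x v g dg ->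
  is_derive x v (fun y => b (f y) (g y)) (b df (g x) + b (f x) dg).
Proof.
move=> Df Dg.
have -> : (fun y => b (f y) (g y)) = \sum_(i < m) \sum_(j < n)
    (fun y => (f y 0 i * g y 0 j) *: b (delta_mx 0 i) (delta_mx 0 j)).
  apply/funext => y; rewrite (bilinear_expand bb) fct_sumE.
  by apply: eq_bigr => i _; rewrite fct_sumE.
apply: (@is_derive_eq _ _ _ _ _ _ _ (\sum_(i < m) \sum_(j < n)
    (f x 0 i * dg 0 j + g x 0 j * df 0 i) *: b (delta_mx 0 i) (delta_mx 0 j))).
  apply: is_derive_sum => i; apply: is_derive_sum => j.
  have D : is_derive x v ((fun y => f y 0 i) * (fun y => g y 0 j))
      (f x 0 i * dg 0 j + g x 0 j * df 0 i).
    exact: is_deriveM (is_derive_crd i Df) (is_derive_crd j Dg).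
  have [d3 e3] := D.
  apply: is_derive_eq (is_derive_scale d3 (derivable_cst _ _ _)) _.
  by rewrite derive_cst scaler0 add0r e3.
rewrite (bilinear_expand bb df) (bilinear_expand bb _ dg) -big_split.
apply: eq_bigr => i _; rewrite -big_split; apply: eq_bigr => j _ /=.
by rewrite -scalerDl addrC [g x 0 j * _]mulrC.
Qed.

Lemma Ck_on_sum (U V : normedModType R) k (W : set U) n (F : 'I_n -> U -> V) : open W ->
  (forall i, Ck_on k W (F i)) -> Ck_on k W (\sum_(i < n) F i).
Proof.
move=> oW HF; elim/big_ind: _ => // [|f g Hf Hg]; first exact: Ck_on_cst.
exact: Ck_onD.
Qed.

Lemma smooth_on_bilinear (U V : normedModType R) (W : set U) m n
    (b : 'rV[R]_m -> 'rV[R]_n -> V) (bb : bilinear_map b)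
    (f : U -> 'rV[R]_m) (g : U -> 'rV[R]_n) : open W ->
  smooth_on W f -> smooth_on W g -> smooth_on W (fun y => b (f y) (g y)).
Proof.
move=> oW Hf Hg k.
have -> : (fun y => b (f y) (g y)) = \sum_(i < m) \sum_(j < n)
    (fun y => (f y 0 i *: (g y 0 j : R)) *: b (delta_mx 0 i) (delta_mx 0 j)).
  apply/funext => y; rewrite (bilinear_expand bb) fct_sumE.
  by apply: eq_bigr => i _; rewrite fct_sumE.
apply: Ck_on_sum => // i; apply: Ck_on_sum => // j.
apply: Ck_on_scale => //; last exact: Ck_on_cst.
by apply: Ck_on_scale => //; apply: Ck_on_coord.
Qed.

Lemma bilinear_kform k : bilinear_map (kform k : _ -> _ -> R).
Proof. by split=> *; rewrite /kform !crdL /GRing.scale /=; ring. Qed.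

Lemma bilinear_dotk k : bilinear_map (dotk k : _ -> _ -> R).
Proof. by split=> *; rewrite !dotkE !crdL /GRing.scale /=; ring. Qed.

Lemma bilinear_klein : bilinear_map (klein : _ -> _ -> R).
Proof. by split=> *; rewrite /klein !crdL /GRing.scale /=; ring. Qed.

Lemma bilinear_hform k : bilinear_map (hform k : _ -> _ -> R).
Proof. by split=> *; rewrite /hform !crdL /GRing.scale /=; ring. Qed.

Lemma bilinear_plucker : bilinear_map (@plucker R).
Proof. by split=> *; apply: row6P; rewrite !(crdL, crd_plucker); ring. Qed.

End BilinearMaps.

(** * Geodesics and normal Jacobi fields as solutions of f'' = - kappa f in R^4 *)

Section Geodesics.
Context {R : realType}.
Variable kappa : R.
Hypothesis hkappa : [\/ kappa = 0, kappa = 1 | kappa = -1].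
Local Notation E4 := 'rV[R]_4.
Local Notation kf := (kform kappa).
Local Notation dk := (dotk kappa).
Local Notation ck := (ck kappa).
Local Notation sk := (sk kappa).

Lemma dotkC x y : dk x y = dk y x.
Proof. by rewrite !dotkE; ring. Qed.

(** The extra factor kappa makes the relation between the two forms hold for kappa = 0 as well,
    where both sides vanish. *)
Lemma kappa_dotk x y : kappa * dk x y = kappa * (kappa * kf x y).
Proof.
by rewrite dotkE /kform; case: hkappa => ->; ring.
Qed.

Lemma kappa_kform x y : kappa * kf x y = kappa * (kappa * dk x y).
Proof.
by rewrite dotkE /kform; case: hkappa => ->; ring.
Qed.

(** Only kappa = 0 uses tangency: there [y] has zeroth coordinate 0, because that of [x] is
    invertible. *)
Lemma kform_tangent x y z : kf x x = 1 -> kf x y = 0 -> kf y z = kappa * dk y z.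
Proof.
rewrite dotkE /kform; case: hkappa => -> xx xy; [|ring|ring].
have : crd 0 x * crd 0 y = 0 by lra.
have x2 : crd 0 x * crd 0 x = 1 by lra.
move=> /eqP; rewrite mulf_eq0 => /orP[/eqP x0|/eqP ->]; last by ring.
by move: x2; rewrite x0; lra.
Qed.

(** The solution of f'' = - kappa f with initial data [x] and [y]. Unit speed geodesics and their
    normal Jacobi fields both take this form. *)
Definition garc (x y : E4) (t : R) : E4 := ck t *: x + sk t *: y.

Lemma arc0 x y : garc x y 0 = x.
Proof. by rewrite /garc ck0 // sk0 // scale1r scale0r addr0. Qed.

Lemma is_derive_arc x y (t : R) : is_derive t 1 (garc x y) (garc y (- kappa *: x) t).
Proof.
have [d1 e1] := is_derive_ck hkappa t; have [d2 e2] := is_derive_sk hkappa t.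
have D1 := is_derive_scale d1 (derivable_cst x t 1).
have D2 := is_derive_scale d2 (derivable_cst y t 1).
apply: is_derive_eq (is_deriveD D1 D2) _.
rewrite e1 e2 !derive_cst !scaler0 !add0r addrC /garc; congr (_ + _).
by rewrite scalerA mulrC.
Qed.

Lemma derive1_arc x y : derive1 (garc x y) = garc y (- kappa *: x).
Proof.
by apply/funext => t; rewrite derive1E; have [_ ->] := is_derive_arc x y t.
Qed.

Lemma smooth_on_arc x y : smooth_on setT (garc x y).
Proof.
move=> k; elim: k x y => [|k IH] x y;
  have df t : differentiable (garc x y) t by
    apply/derivable1_diffP; have [] := is_derive_arc x y t.
  by split=> // t _; exact: differentiable_continuous.
split; first by move=> t _; exact: differentiable_continuous.
split=> [t v _|v]; first exact: diff_derivable.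
rewrite (_ : 'D_v _ = garc (v *: y) (v *: (- kappa *: x))); first exact: IH.
apply/funext => t; transitivity (v *: 'D_1 (garc x y) t).
  by have <- := deriveZdir v (1 : R) (df t); rewrite [v *: 1]mulr1.
have [_ ->] := is_derive_arc x y t; move: v => r.
by apply: row4P; rewrite /garc !crdL; ring.
Qed.

(** Variation of constants: ck J - sk J' and kappa sk J + ck J' have zero derivative, and ck^2 +
    kappa sk^2 = 1 recovers [J] from them. *)
Lemma eq_arc (J J' : R -> E4) : (forall t : R, is_derive t 1 J (J' t)) ->
  (forall t : R, is_derive t 1 J' (- kappa *: J t)) -> J = garc (J 0) (J' 0).
Proof.
move=> dJ dJ'.
have cst0 (F : R -> E4) : (forall t : R, is_derive t 1 F 0) -> forall t, F t = F 0.
  move=> dF t; apply/rowP => i.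
  apply: (is_derive0_interval_cst (D := setT) (f := fun t => F t 0 i)) => //.
  - exact: openT.
  - by move=> s _; have := is_derive_crd i (dF s); rewrite mxE.
pose A t := ck t *: J t + (- sk t) *: J' t.
pose B t := (kappa * sk t) *: J t + ck t *: J' t.
have dc t := is_derive_ck hkappa t; have ds t := is_derive_sk hkappa t.
have dA (t : R) : is_derive t 1 A 0.
  have [d1 e1] := dJ t; have [d2 e2] := dJ' t; have [d3 e3] := dc t.
  have D : is_derive t 1 (fun t => - sk t) (- ck t).
    by have := is_deriveN (ds t).
  have [d4 e4] := D.
  apply: is_derive_eq (is_deriveD (is_derive_scale d3 d1) (is_derive_scale d4 d2)) _.
  rewrite e1 e2 e3 e4; apply: row4P; rewrite !crdL; ring.
have dB (t : R) : is_derive t 1 B 0.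
  have [d1 e1] := dJ t; have [d2 e2] := dJ' t; have [d3 e3] := dc t.
  have D : is_derive t 1 (fun t => kappa * sk t) (kappa * ck t).
    by have := is_deriveZ kappa (ds t).
  have [d4 e4] := D.
  apply: is_derive_eq (is_deriveD (is_derive_scale d4 d1) (is_derive_scale d3 d2)) _.
  rewrite e1 e2 e3 e4; apply: row4P; rewrite !crdL; ring.
have A0 : A 0 = J 0 by rewrite /A ck0 // sk0 // scale1r oppr0 scale0r addr0.
have B0 : B 0 = J' 0 by rewrite /B ck0 // sk0 // scale1r mulr0 scale0r add0r.
apply/funext => t; rewrite /garc -A0 -B0 -(cst0 A dA t) -(cst0 B dB t).
rewrite -[LHS]scale1r -(ck2Dsk2 hkappa t) /A /B; apply: row4P; rewrite !crdL; ring.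
Qed.

Definition unit_tangent (x y : E4) : Prop :=
  [/\ space_form kappa x, kf x y = 0 & dk y y = 1].

Lemma unit_tangent_kform x y : unit_tangent x y -> kf x x = 1.
Proof. by move=> [/space_formE[]]. Qed.

Lemma arc_geodesic x y : unit_tangent x y -> unit_speed_geodesic kappa (garc x y).
Proof.
move=> [/space_formE[xx x0] xy yy].
have yyk : kf y y = kappa by rewrite (kform_tangent _ xx xy) yy mulr1.
have K1 : kappa * dk x y = 0 by rewrite kappa_dotk xy !mulr0.
have K2 : kappa * kappa * dk x x = kappa.
  by rewrite -mulrA kappa_dotk xx mulr1 mulrA kappa3.
have arc_sf t : space_form kappa (garc x y t).
  apply/space_formE; split; last first.
    move=> k0; rewrite /garc !crdL; apply: ck_sk_gt0 => //; exact: x0.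
  rewrite -(ck2Dsk2 hkappa t) /garc.
  transitivity (ck t * ck t * kf x x + (1 + 1) * ck t * sk t * kf x y + sk t * sk t * kf y y).
    by rewrite /kform !crdL; ring.
  by rewrite xx xy yyk; ring.
split=> [|//|t|t]; first exact: smooth_on_arc.
- rewrite derive1_arc /garc -(ck2Dsk2 hkappa t).
  transitivity (ck t * ck t * dk y y - (1 + 1) * ck t * sk t * (kappa * dk x y)
     + sk t * sk t * (kappa * kappa * dk x x)).
    by rewrite !dotkE !crdL; ring.
  by rewrite yy K1 K2; ring.
- rewrite /covD !derive1_arc /tproj.
  have -> : garc (- kappa *: x) (- kappa *: y) t = - kappa *: garc x y t.
    by rewrite /garc; apply: row4P; rewrite !crdL; ring.
  set p := garc x y t.
  have pp : kf p p = 1 by have /space_formE[] := arc_sf t.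
  have -> : kappa * dk (- kappa *: p) p = - (kappa * (kappa * dk p p)).
    by rewrite !dotkE !crdL; ring.
  by rewrite kappa_dotk pp mulr1 -scalerBl mulrA kappa3 // subrr scale0r.
Qed.

Lemma is_derive_derive1 (f : R -> E4) (t : R) : smooth_on setT f ->
  is_derive t 1 f (derive1 f t).
Proof.
move=> Hf; rewrite derive1E; apply: derivableP.
exact: smooth_on_derivable Hf I.
Qed.

Lemma smooth_on_derive1 (W : set R) (f : R -> E4) : smooth_on W f ->
  smooth_on W (derive1 f).
Proof.
move=> /(smooth_on_derive (1 : R)).
suff -> : 'D_1 f = derive1 f by [].
by apply/funext => t; rewrite derive1E.
Qed.

Lemma is_derive_cst0 (f : R -> R) c (t : R) l : (forall s, f s = c) ->
  is_derive t 1 f l -> l = 0.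
Proof.
move=> /funext -> [_ <-]; exact: derive_cst.
Qed.

Lemma geodesic_unit_tangent g t : unit_speed_geodesic kappa g ->
  unit_tangent (g t) (derive1 g t).
Proof.
move=> [sg gs gu _]; split=> //.
have gg s : kf (g s) (g s) = 1 by have /space_formE[] := gs s.
have D := is_derive_derive1 t sg.
have := is_derive_cst0 gg (is_derive_bilinear (bilinear_kform kappa) D D).
by rewrite [X in X + _]kformC; lra.
Qed.

(** A vanishing covariant derivative makes g'' a multiple of g, and differentiating kform g g' = 0
    shows that the factor is - kappa. *)
Lemma geodesic_arc g : unit_speed_geodesic kappa g -> g = garc (g 0) (derive1 g 0).
Proof.
move=> Hg; have [sg gs gu gc] := Hg.
apply: eq_arc => [t|t]; first exact: is_derive_derive1.
have D := is_derive_derive1 t sg.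
have D' := is_derive_derive1 t (smooth_on_derive1 sg).
apply: is_derive_eq D' _.
set a := derive1 (derive1 g) t.
have xy s : kf (g s) (derive1 g s) = 0 by have [] := geodesic_unit_tangent s Hg.
have D'' := is_derive_derive1 t (smooth_on_derive1 sg).
have := is_derive_cst0 xy (is_derive_bilinear (bilinear_kform kappa) D D'').
rewrite -/a => E.
have Ea : a = (kappa * dk a (g t)) *: g t.
  by apply/eqP; rewrite -subr_eq0; apply/eqP; exact: gc t.
rewrite Ea kappa_dotk kformC.
have -> : kf (g t) a = - kf (derive1 g t) (derive1 g t).
  by apply/eqP; rewrite -addr_eq0 addrC E.
congr (_ *: _); rewrite mulrN mulrN kappa_kform gu mulr1.
by rewrite mulrA kappa3.
Qed.

(** The wedge picks up the factor ck^2 + kappa sk^2 = 1. This makes the Pluecker vector independent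
    of the parametrization. *)
Lemma arc_derive_plucker x y t :
  plucker (garc x y t) (garc y (- kappa *: x) t) = plucker x y.
Proof.
rewrite -[RHS]scale1r -(ck2Dsk2 hkappa t) /garc.
by apply: row6P; rewrite !(crdL, crd_plucker); ring.
Qed.

(* The velocity of [plucker x y] along the Jacobi field with initial data J0, J1. *)
Definition bivector (x y J0 J1 : E4) : 'rV[R]_6 := plucker J0 y + plucker x J1.

Lemma bivector_arc x y J0 J1 t :
  bivector (garc x y t) (garc y (- kappa *: x) t) (garc J0 J1 t)
    (garc J1 (- kappa *: J0) t) = bivector x y J0 J1.
Proof.
rewrite -[RHS]scale1r -(ck2Dsk2 hkappa t) /garc /bivector.
by apply: row6P; rewrite !(crdL, crd_plucker); ring.
Qed.

Definition tangent_pair (x y J0 J1 : E4) : Prop :=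
  [/\ kf x J0 = 0, kf x J1 = 0, dk J0 y = 0 & dk J1 y = 0].

Lemma jacobi_arc x y J0 J1 : unit_tangent x y -> tangent_pair x y J0 J1 ->
  jacobi_fields kappa (garc x y) (garc J0 J1).
Proof.
move=> ut [xJ0 xJ1 J0y J1y].
have xx := unit_tangent_kform ut; have [xS xy yy] := ut.
have [_ _ gu _] := arc_geodesic ut.
have J0yk : kf J0 y = 0 by rewrite (kform_tangent _ xx xJ0) J0y mulr0.
have J1yk : kf J1 y = 0 by rewrite (kform_tangent _ xx xJ1) J1y mulr0.
have kJ0x : kappa * dk J0 x = 0 by rewrite kappa_dotk kformC xJ0 !mulr0.
have kJ1x : kappa * dk J1 x = 0 by rewrite kappa_dotk kformC xJ1 !mulr0.
have orth t : dk (garc J0 J1 t) (derive1 (garc x y) t) = 0.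
  rewrite derive1_arc /garc.
  transitivity (ck t * ck t * dk J0 y - ck t * sk t * (kappa * dk J0 x) +
      sk t * ck t * dk J1 y - sk t * sk t * (kappa * dk J1 x)).
    by rewrite !dotkE !crdL; ring.
  by rewrite J0y J1y kJ0x kJ1x; ring.
have tang a b t : kf x a = 0 -> kf x b = 0 -> kf a y = 0 -> kf b y = 0 ->
    kf (garc x y t) (garc a b t) = 0.
  move=> xa xb ay by_.
  transitivity (ck t * ck t * kf x a + ck t * sk t * kf x b + ck t * sk t * kf a y
     + sk t * sk t * kf b y); first by rewrite /garc /kform !crdL; ring.
  by rewrite xa xb ay by_; ring.
have covE a b : (forall t, kf (garc x y t) (garc b (- kappa *: a) t) = 0) ->
    covD kappa (garc x y) (garc a b) = garc b (- kappa *: a).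
  move=> H; apply/funext => t; rewrite /covD derive1_arc /tproj kappa_dotk kformC H.
  by rewrite !mulr0 scale0r subr0.
have kN (a b : E4) : kf a b = 0 -> kf a (- kappa *: b) = 0.
  by move=> ab; rewrite -[RHS](mulr0 (- kappa)) -ab /kform !crdL; ring.
have kN' (a b : E4) : kf a b = 0 -> kf (- kappa *: a) b = 0.
  by rewrite kformC => /kN; rewrite kformC.
split=> [|t|//|t]; first exact: smooth_on_arc.
  by apply/tangent_formE; exact: tang.
rewrite covE; last by move=> s; apply: tang; auto.
rewrite covE; last by move=> s; apply: tang; auto.
rewrite /curvature gu orth.
by rewrite scale0r subr0 scale1r /garc; apply: row4P; rewrite !crdL; ring.
Qed.

(** Differentiating the orthogonality relations shows that N' is again tangent and orthogonal to g'.
    Covariant derivatives of N are therefore ordinary ones, and the Jacobi equation reads N'' = -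
    kappa N. *)
Lemma jacobi_is_arc g N : unit_speed_geodesic kappa g -> jacobi_fields kappa g N ->
  N = garc (N 0) (derive1 N 0) /\ tangent_pair (g 0) (derive1 g 0) (N 0) (derive1 N 0).
Proof.
move=> Hg [sN tN oN eN].
have sg : smooth_on setT g by case: Hg.
have ut t := geodesic_unit_tangent t Hg.
have Ng t : kf (N t) (g t) = 0 by rewrite kformC; apply/tangent_formE.
have DN t := is_derive_derive1 t sN.
have Dg t := is_derive_derive1 t sg.
have DN' t := is_derive_derive1 t (smooth_on_derive1 sN).
have Dg' t := is_derive_derive1 t (smooth_on_derive1 sg).
have g2 t : derive1 (derive1 g) t = - kappa *: g t.
  rewrite [in LHS](geodesic_arc Hg) !derive1_arc [in RHS](geodesic_arc Hg) /garc.
  by apply: row4P; rewrite !crdL; ring.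
have Ng' t : kf (N t) (derive1 g t) = 0.
  have xx := unit_tangent_kform (ut t).
  by rewrite (kform_tangent (x := g t)) // 1?kformC // oN mulr0.
have N'g t : kf (derive1 N t) (g t) = 0.
  have := is_derive_cst0 Ng (is_derive_bilinear (bilinear_kform kappa) (DN t) (Dg t)).
  by rewrite Ng' addr0.
have N'g' t : dk (derive1 N t) (derive1 g t) = 0.
  have := is_derive_cst0 oN (is_derive_bilinear (bilinear_dotk kappa) (DN t) (Dg' t)).
  rewrite g2 => H; rewrite -[LHS]addr0 -[RHS]H; congr (_ + _).
  transitivity (- (kappa * dk (N t) (g t))); last by rewrite !dotkE !crdL; ring.
  by rewrite kappa_dotk Ng !mulr0 oppr0.
split; last by split; rewrite // kformC.
have covN : covD kappa g N = derive1 N.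
  apply/funext => t; rewrite /covD /tproj kappa_dotk N'g.
  by rewrite !mulr0 scale0r subr0.
apply: eq_arc => // t; apply: is_derive_eq (DN' t) _.
have := eN t; rewrite covN /curvature (_ : dk (derive1 g t) _ = 1); last by have [] := ut t.
rewrite oN scale0r subr0 scale1r /covD /tproj kappa_dotk.
have -> : kappa * (kappa * kf (derive1 (derive1 N) t) (g t)) = 0.
  have := is_derive_cst0 N'g (is_derive_bilinear (bilinear_kform kappa) (DN' t) (Dg t)).
  move=> /eqP; rewrite addr_eq0 => /eqP ->.
  by rewrite mulrN kappa_kform N'g' !mulr0 oppr0 mulr0.
by rewrite scale0r subr0 scaleNr => /eqP; rewrite addr_eq0 => /eqP.
Qed.

(** In the zeroth coordinate the factors kappa of [cross] and [dotk] multiply to kappa^2, which is 1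
    unless kappa = 0; in that case the coordinate of [w] is zero. *)
Lemma dotk_cross (p u v w : E4) : (kappa = 0 -> crd 0 w = 0) ->
  dk (cross kappa p u v) w = vol p u v w.
Proof.
move=> w0.
have cE (i : nat) : (i < 4)%N -> crd i (cross kappa p u v) =
    (if i == 0%N then kappa else 1) * vol p u v (delta_mx 0 (inord i)).
  move=> i4; rewrite crdE mxE.
  by rewrite (_ : (inord i == 0 :> 'I_4) = (i == 0%N)) // -val_eqE /= inordK.
have dE (i j : nat) : (i < 4)%N -> (j < 4)%N ->
    crd i (delta_mx 0 (inord j) : E4) = (i == j)%:R.
  by move=> i4 j4; rewrite crdE mxE eqxx -val_eqE /= !inordK.
rewrite dotkE !cE // !volE !dE //= /det3.
case: hkappa => k0; rewrite k0; [rewrite (w0 k0)|..]; ring.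
Qed.

(** Of the four terms of the Klein product two have a repeated vector, and the mixed ones are the
    triple products of the metric up to sign. The projection in the covariant derivative changes the
    arguments by multiples of the footpoint, which [vol] does not see. *)
Lemma cross_metric_klein g I J : unit_speed_geodesic kappa g ->
  cross_metric kappa g I J = - 2^-1 *
    klein (bivector (g 0) (derive1 g 0) (I 0) (derive1 I 0))
          (bivector (g 0) (derive1 g 0) (J 0) (derive1 J 0)).
Proof.
move=> Hg; have ut := geodesic_unit_tangent 0 Hg.
have xx := unit_tangent_kform ut; have [_ xy _] := ut.
have y0 : kappa = 0 -> crd 0 (derive1 g 0) = 0.
  move=> k0; move: xx xy; rewrite /kform k0 !mul0r !addr0 => xx.
  move=> /eqP; rewrite mulf_eq0 => /orP[/eqP x0|/eqP //].
  by move: xx; rewrite x0 mul0r => /eqP; rewrite eq_sym oner_eq0.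
have bD a b c : dk (a + b) c = dk a c + dk b c by rewrite !dotkE !crdL; ring.
rewrite /cross_metric bD /covD /tproj; move: y0.
move: (g 0) (derive1 g 0) (I 0) (J 0) (derive1 I 0) (derive1 J 0) => x y i j i' j' y0.
rewrite (dotk_cross _ _ _ y0) (dotk_cross _ _ _ y0).
have volN c u v : vol x u (v - c *: x) y = vol x u v y.
  by rewrite !volE /det3 !crdL; ring.
rewrite !volN /bivector !kleinDl !kleinDr !klein_plucker.
have volD (u v w : E4) : vol u v w v = 0 by rewrite !volE /det3; ring.
have volD' (u v w : E4) : vol u v u w = 0 by rewrite !volE /det3; ring.
rewrite !volD !volD'.
rewrite !volE /det3; ring.
Qed.

End Geodesics.

(** * Families of geodesics *)

Section GeodesicFamilies.
Context {R : realType}.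
Variable kappa : R.
Hypothesis hkappa : [\/ kappa = 0, kappa = 1 | kappa = -1].
Local Notation E4 := 'rV[R]_4.
Local Notation kf := (kform kappa).
Local Notation dk := (dotk kappa).
Local Notation garc := (garc kappa).
Local Notation ck := (ck kappa).
Local Notation sk := (sk kappa).

Lemma is_derive_open_cst (U : normedModType R) (W : set U) (f : U -> R) c w e l :
  open W -> W w -> (forall w', W w' -> f w' = c) -> is_derive w e f l -> l = 0.
Proof.
move=> oW Ww fc [_ <-].
rewrite (near_eq_derive (g := fun=> c)); first exact: derive_cst.
exact: (open_near_eq (g := fun=> c) oW fc Ww).
Qed.

Definition plg (g : R -> E4) : 'rV[R]_6 := plucker (g 0) (derive1 g 0).

Lemma half_eq0 (a b : R) : a = b -> a + b = 0 -> b = 0.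
Proof. by move=> ->; lra. Qed.

(** The three equations are the derivatives of kform x x = 1, kform x y = 0 and dotk y y = 1.
    Removing the component a = dotk X y along the geodesic subtracts a times the field g', whose own
    derivative is - kappa g; hence the correction + kappa a x. *)
Lemma variation_tangent_pair x y X Y : unit_tangent kappa x y ->
  kf x X = 0 -> kf X y + kf x Y = 0 -> dk Y y = 0 ->
  tangent_pair kappa x y (X - dk X y *: y) (Y + (kappa * dk X y) *: x).
Proof.
move=> ut xX Exy Yy; have xx := unit_tangent_kform ut; have [_ xy yy] := ut.
set a := dk X y.
have yyk : kf y y = kappa by rewrite (kform_tangent hkappa _ xx xy) yy mulr1.
have kxy : kappa * dk x y = 0 by rewrite kappa_dotk // xy !mulr0.
have xJ0 : kf x (X - a *: y) = 0.
  transitivity (kf x X - a * kf x y); first by rewrite /kform !crdL; ring.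
  by rewrite xX xy mulr0 subr0.
have J0y : dk (X - a *: y) y = 0.
  transitivity (dk X y - a * dk y y); first by rewrite !dotkE !crdL; ring.
  by rewrite yy -/a mulr1 subrr.
split=> //.
  have Xyk : kf X y = kappa * a.
    have : kf (X - a *: y) y = 0 by rewrite (kform_tangent hkappa _ xx xJ0) J0y mulr0.
    have -> : kf (X - a *: y) y = kf X y - a * kf y y by rewrite /kform !crdL; ring.
    by rewrite yyk mulrC => /eqP; rewrite subr_eq0 => /eqP.
  transitivity (kf x Y + kappa * a * kf x x); first by rewrite /kform !crdL; ring.
  by rewrite xx mulr1 -Xyk addrC.
transitivity (dk Y y + a * (kappa * dk x y)); first by rewrite !dotkE !crdL; ring.
by rewrite Yy kxy mulr0 addr0.
Qed.

(** The component of the variation field along the velocity is constant in t, so it can be removed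
    from the initial data once and for all. *)
Lemma variation_field x y X Y t : unit_tangent kappa x y ->
  kf x X = 0 -> kf X y + kf x Y = 0 -> dk Y y = 0 ->
  let v := garc y (- kappa *: x) t in
  let Z := ck t *: X + sk t *: Y in
  Z - dk Z v *: v = garc (X - dk X y *: y) (Y + (kappa * dk X y) *: x) t.
Proof.
move=> ut xX Exy Yy v Z; have xx := unit_tangent_kform ut; have [_ xy yy] := ut.
have yyk : kf y y = kappa by rewrite (kform_tangent hkappa _ xx xy) yy mulr1.
have kXx : kappa * dk X x = 0 by rewrite kappa_dotk // kformC xX !mulr0.
have kYx : kappa * dk Y x = - (kappa * dk X y).
  rewrite kappa_dotk // kformC (_ : kf x Y = - kf X y).
    by rewrite !mulrN [in RHS]kappa_dotk.
  by apply/eqP; rewrite -addr_eq0 addrC; apply/eqP.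
have -> : dk Z v = dk X y.
  rewrite -[RHS]mul1r -(ck2Dsk2 hkappa t).
  transitivity (ck t * ck t * dk X y - ck t * sk t * (kappa * dk X x)
    + ck t * sk t * dk Y y - sk t * sk t * (kappa * dk Y x)).
    by rewrite /Z /v /garc !dotkE !crdL; ring.
  by rewrite kXx kYx Yy; ring.
by rewrite /Z /v /garc; apply: row4P; rewrite !crdL; ring.
Qed.

(** The bridge between Jacobi fields and the Pluecker embedding: the differential of a family, as a
    Jacobi field, has as bivector the derivative of the Pluecker vector. Immersivity and the metric
    can then be read in R^6. *)
Lemma dfamily_arc (U : normedModType R) (W : set U) (Gam : U -> R -> E4) w e :
  open W -> geodesic_family kappa W Gam -> W w ->
  exists J0 J1, [/\ dfamily kappa Gam w e = garc J0 J1,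
    tangent_pair kappa (Gam w 0) (derive1 (Gam w) 0) J0 J1 &
    is_derive w e (fun w' => plg (Gam w')) (bivector (Gam w 0) (derive1 (Gam w) 0) J0 J1)].
Proof.
move=> oW [us s0 s1] Ww.
have ut w' : W w' -> unit_tangent kappa (Gam w' 0) (derive1 (Gam w') 0).
  by move=> Ww'; exact: geodesic_unit_tangent (us w' Ww').
have gE w' : W w' -> Gam w' = garc (Gam w' 0) (derive1 (Gam w') 0).
  by move=> Ww'; exact: geodesic_arc (us w' Ww').
have DX := derivableP (smooth_on_derivable (v := e) s0 Ww).
have DY := derivableP (smooth_on_derivable (v := e) s1 Ww).
have Exx := half_eq0 (kformC _ _ _) (is_derive_open_cst (c := 1) oW Ww
  (fun w' h => unit_tangent_kform (ut w' h))
  (is_derive_bilinear (bilinear_kform kappa) DX DX)).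
have Exy := is_derive_open_cst (c := 0) oW Ww
  (fun w' h => let: And3 _ h2 _ := ut w' h in h2)
  (is_derive_bilinear (bilinear_kform kappa) DX DY).
have Eyy := half_eq0 (dotkC _ _ _) (is_derive_open_cst (c := 1) oW Ww
  (fun w' h => let: And3 _ _ h3 := ut w' h in h3)
  (is_derive_bilinear (bilinear_dotk kappa) DY DY)).
have Dplg := is_derive_bilinear (@bilinear_plucker R) DX DY.
have Dt t : 'D_e (fun w' => Gam w' t) w = ck t *: 'D_e (fun w' => Gam w' 0) w +
    sk t *: 'D_e (fun w' => derive1 (Gam w') 0) w.
  rewrite (near_eq_derive (g := (ck t \*: (fun w' => Gam w' 0)) +
      (sk t \*: (fun w' => derive1 (Gam w') 0)))).
    by have [_ ->] := is_deriveD (is_deriveZ (ck t) DX) (is_deriveZ (sk t) DY).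
  apply: (open_near_eq oW) Ww => w' Ww'.
  by rewrite [LHS](congr1 (fun h => h t) (gE w' Ww')).
have gw := gE w Ww; have utw := ut w Ww.
have dgw t : derive1 (Gam w) t = garc (derive1 (Gam w) 0) (- kappa *: Gam w 0) t.
  by rewrite [in LHS]gw derive1_arc.
have {Dt dgw} -> : dfamily kappa Gam w e = fun t =>
    let Z := ck t *: 'D_e (fun w' => Gam w' 0) w +
      sk t *: 'D_e (fun w' => derive1 (Gam w') 0) w in
    let v := garc (derive1 (Gam w) 0) (- kappa *: Gam w 0) t in
    Z - dk Z v *: v.
  by apply/funext => t; rewrite /dfamily Dt dgw.
move: ('D_e (fun w' => Gam w' 0) w) ('D_e (fun w' => derive1 (Gam w') 0) w)
  Exx Exy Eyy Dplg => X Y Exx Exy Eyy Dplg.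
rewrite dotkC in Eyy.
exists (X - dk X (derive1 (Gam w) 0) *: derive1 (Gam w) 0),
  (Y + (kappa * dk X (derive1 (Gam w) 0)) *: Gam w 0); split.
- by apply/funext => t; exact: (variation_field t utw Exx Exy Eyy).
- exact: variation_tangent_pair.
apply: is_derive_eq Dplg _; move: (Gam w 0) (derive1 (Gam w) 0) => x y.
by rewrite /bivector; apply: row6P; rewrite !(crdL, crd_plucker); ring.
Qed.

Lemma shift_geodesic g t0 : unit_speed_geodesic kappa g ->
  (fun t => g (t + t0)) = garc (g t0) (derive1 g t0).
Proof.
move=> Hg; have gE := geodesic_arc hkappa Hg; have [sg _ _ _] := Hg.
have D1 (t : R) : is_derive t 1 (fun t => g (t + t0)) (derive1 g (t + t0)).
  by apply: is_derive_translate; exact: is_derive_derive1.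
have D2 (t : R) : is_derive t 1 (fun t => derive1 g (t + t0)) (- kappa *: g (t + t0)).
  apply: is_derive_translate.
  apply: is_derive_eq (is_derive_derive1 _ (smooth_on_derive1 sg)) _.
  rewrite [in LHS]gE !derive1_arc // [in RHS]gE /garc.
  by apply: row4P; rewrite !crdL; ring.
by have := eq_arc hkappa D1 D2; rewrite add0r.
Qed.

Lemma geod_class_refl (g : R -> E4) : geod_class g g.
Proof. by exists 0; apply/funext => t; rewrite addr0. Qed.

Lemma geod_class_mem g d : unit_speed_geodesic kappa g -> geod_class g d ->
  unit_speed_geodesic kappa d /\ plg d = plg g.
Proof.
move=> Hg [t0 ->]; rewrite (shift_geodesic t0 Hg).
have ut := geodesic_unit_tangent t0 Hg.
split; first exact: arc_geodesic.
rewrite /plg (derive1_arc hkappa) !(arc0 hkappa) -(arc_derive_plucker hkappa (g 0) (derive1 g 0) t0).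
by rewrite -(derive1_arc hkappa) -(geodesic_arc hkappa Hg).
Qed.

Lemma geod_class_plg g d : unit_speed_geodesic kappa g -> geod_class g = geod_class d ->
  plg d = plg g.
Proof.
by move=> Hg gd; apply: (geod_class_mem Hg _).2; rewrite gd; exact: geod_class_refl.
Qed.

(** [plg] is constant on each class of geodesics, so the chosen representative is immaterial; the
    value is 0 on sets that are not such classes. *)
Definition plc (l : set (R -> E4)) : 'rV[R]_6 :=
  xget 0 [set B | exists2 g, unit_speed_geodesic kappa g /\ l = geod_class g & B = plg g].

Lemma plcE g : unit_speed_geodesic kappa g -> plc (geod_class g) = plg g.
Proof.
move=> Hg; rewrite /plc; case: xgetP => [B -> [d [Hd gd] ->]|/(_ (plg g))[]].
  exact: geod_class_plg.
by exists g.
Qed.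

Lemma plg_unit g : unit_speed_geodesic kappa g ->
  klein (plg g) (plg g) = 0 /\ hform kappa (plg g) (plg g) = 1.
Proof.
move=> Hg; have ut := geodesic_unit_tangent 0 Hg.
have xx := unit_tangent_kform ut; have [_ xy yy] := ut.
have yyk : kf (derive1 g 0) (derive1 g 0) = kappa.
  by rewrite (kform_tangent hkappa _ xx xy) yy mulr1.
rewrite /plg klein_plucker volE /det3; split; first by ring.
move: (g 0) (derive1 g 0) {ut} xx xy yy yyk => x y.
case: hkappa => ->; last 2 first.
- move=> xx xy _ yy; transitivity (kform 1 x x * kform 1 y y - kform 1 x y * kform 1 x y).
    by rewrite /hform !crd_plucker /kform; ring.
  by rewrite xx xy yy; ring.
- move=> xx xy _ yy.
  transitivity (- (kform (-1) x x * kform (-1) y y - kform (-1) x y * kform (-1) x y)).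
    by rewrite /hform !crd_plucker /kform; ring.
  by rewrite xx xy yy; ring.
rewrite /kform dotkE => xx xy yy _.
have y0 : crd 0 y = 0.
  have : crd 0 x * crd 0 y = 0 by lra.
  move=> /eqP; rewrite mulf_eq0 => /orP[/eqP x0|/eqP //].
  by move: xx; rewrite x0; lra.
rewrite /hform !crd_plucker y0; have {}xx : crd 0 x * crd 0 x = 1 by lra.
transitivity (crd 0 x * crd 0 x * (crd 1 y * crd 1 y + crd 2 y * crd 2 y + crd 3 y * crd 3 y)).
  by ring.
by rewrite xx; lra.
Qed.

(** Interior product of a bivector with the covector [f]: it maps x /\ y to f(x) y - f(y) x. *)
Definition contract (f : E4) (B : 'rV[R]_6) : E4 := \row_i nth 0
  [:: - crd 1 f * crd 0 B - crd 2 f * crd 1 B - crd 3 f * crd 2 B;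
      crd 0 f * crd 0 B - crd 2 f * crd 5 B + crd 3 f * crd 4 B;
      crd 0 f * crd 1 B + crd 1 f * crd 5 B - crd 3 f * crd 3 B;
      crd 0 f * crd 2 B - crd 1 f * crd 4 B + crd 2 f * crd 3 B] i.

Lemma crd_contract f B :
  (crd 0 (contract f B) = - crd 1 f * crd 0 B - crd 2 f * crd 1 B - crd 3 f * crd 2 B) *
  (crd 1 (contract f B) = crd 0 f * crd 0 B - crd 2 f * crd 5 B + crd 3 f * crd 4 B) *
  (crd 2 (contract f B) = crd 0 f * crd 1 B + crd 1 f * crd 5 B - crd 3 f * crd 3 B) *
  (crd 3 (contract f B) = crd 0 f * crd 2 B - crd 1 f * crd 4 B + crd 2 f * crd 3 B).
Proof. by do !split; rewrite [LHS]crdE mxE inordK. Qed.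

(** Lowering of an index: [lower 1 kappa x] is the covector of [kform x], and [lower kappa 1 y] that
    of [dotk y]. *)
Definition lower (a b : R) (x : E4) : E4 :=
  \row_i nth 0 [:: a * crd 0 x; b * crd 1 x; b * crd 2 x; b * crd 3 x] i.

Lemma crd_lower a b x :
  (crd 0 (lower a b x) = a * crd 0 x) * (crd 1 (lower a b x) = b * crd 1 x) *
  (crd 2 (lower a b x) = b * crd 2 x) * (crd 3 (lower a b x) = b * crd 3 x).
Proof. by do !split; rewrite [LHS]crdE mxE inordK. Qed.

(** Contracting with [kform x] isolates J1; once it is zero, contracting with [dotk y] isolates
    J0. *)
Lemma bivector_eq0 x y J0 J1 : unit_tangent kappa x y ->
  tangent_pair kappa x y J0 J1 -> bivector x y J0 J1 = 0 -> J0 = 0 /\ J1 = 0.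
Proof.
move=> ut [xJ0 xJ1 J0y J1y] B0; have xx := unit_tangent_kform ut; have [_ xy yy] := ut.
have c0 f : contract f 0 = 0 by apply: row4P; rewrite !crd_contract !crd0; ring.
have J10 : J1 = 0.
  have := c0 (lower 1 kappa x); rewrite -B0.
  have -> : contract (lower 1 kappa x) (bivector x y J0 J1) =
      kf x J0 *: y - kf x y *: J0 + kf x x *: J1 - kf x J1 *: x.
    by rewrite /bivector /kform; apply: row4P;
       rewrite !(crdL, crd_contract, crd_lower, crd_plucker); ring.
  by rewrite xJ0 xy xx xJ1 !scale0r scale1r !subr0 add0r.
split=> //; move: B0; rewrite /bivector J10 (_ : plucker x 0 = 0) ?addr0; last first.
  by apply: row6P; rewrite !(crdL, crd_plucker); ring.
move=> B0; have := c0 (lower kappa 1 y); rewrite -B0.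
have -> : contract (lower kappa 1 y) (plucker J0 y) = dk J0 y *: y - dk y y *: J0.
  rewrite !dotkE; apply: row4P;
    rewrite !(crdL, crd_contract, crd_lower, crd_plucker); ring.
by rewrite J0y yy scale0r scale1r sub0r => /eqP; rewrite oppr_eq0 => /eqP.
Qed.

(* Contracting p /\ x /\ y with the covectors [kform x] and [dotk y]. *)
Lemma vol_eq0_span x y p : unit_tangent kappa x y ->
  (forall z, vol p z x y = 0) ->
  p = kf x p *: x + (dk y p - kf x p * dk y x) *: y.
Proof.
move=> ut H; have xx := unit_tangent_kform ut; have [_ xy yy] := ut.
(* The coordinates of the trivector p /\ x /\ y; wedging with the four basis vectors gives all of
   them up to sign. *)
pose M a b c := (crd a x * crd b y - crd a y * crd b x) * crd c p +
  (crd a y * crd b p - crd a p * crd b y) * crd c x +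
  (crd a p * crd b x - crd a x * crd b p) * crd c y.
have dE (i j : nat) : (i < 4)%N -> (j < 4)%N ->
    crd i (delta_mx 0 (inord j) : E4) = (i == j)%:R.
  by move=> i4 j4; rewrite crdE mxE eqxx -val_eqE /= !inordK.
have M0 a b c : (a < 4)%N -> (b < 4)%N -> (c < 4)%N -> M a b c = 0.
  have := H (delta_mx 0 (inord 0)); have := H (delta_mx 0 (inord 1)).
  have := H (delta_mx 0 (inord 2)); have := H (delta_mx 0 (inord 3)).
  rewrite !volE !dE // /det3 /= => h3 h2 h1 h0.
  case: a => [|[|[|[|//]]]] _; case: b => [|[|[|[|//]]]] _;
    case: c => [|[|[|[|//]]]] _; rewrite /M; first [ring|lra].
pose f := lower 1 kappa x; pose g := lower kappa 1 y.
have E c : (c < 4)%N -> (kf x x * dk y y - kf x y * dk y x) * crd c p +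
    (kf x y * dk y p - kf x p * dk y y) * crd c x +
    (kf x p * dk y x - kf x x * dk y p) * crd c y = 0.
  move=> c4.
  transitivity
    (crd 0 f * (crd 0 g * M 0 0 c + crd 1 g * M 0 1 c + crd 2 g * M 0 2 c + crd 3 g * M 0 3 c)
    + crd 1 f * (crd 0 g * M 1 0 c + crd 1 g * M 1 1 c + crd 2 g * M 1 2 c + crd 3 g * M 1 3 c)
    + crd 2 f * (crd 0 g * M 2 0 c + crd 1 g * M 2 1 c + crd 2 g * M 2 2 c + crd 3 g * M 2 3 c)
    + crd 3 f * (crd 0 g * M 3 0 c + crd 1 g * M 3 1 c + crd 2 g * M 3 2 c + crd 3 g * M 3 3 c)).
    by rewrite /M /f /g !crd_lower /kform !dotkE; ring.
  by rewrite !M0 //; ring.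
rewrite xx xy yy in E.
by apply: row4P; rewrite !crdL; [have := E 0 isT|have := E 1 isT|have := E 2 isT|
  have := E 3 isT]; lra.
Qed.

(** The point lies in the plane of the geodesic, with coefficients on the conic a^2 + kappa b^2 = 1,
    so it is g t or - g t. The second possibility occurs only for kappa <= 0 and is excluded by the
    sign of the zeroth coordinate. *)
Lemma point_on_geodesic g p : unit_speed_geodesic kappa g -> space_form kappa p ->
  (forall z, vol p z (g 0) (derive1 g 0) = 0) -> exists t, g t = p.
Proof.
move=> Hg /space_formE[pp p0] H; have ut := geodesic_unit_tangent 0 Hg.
have [_ gs _ _] := Hg.
have := vol_eq0_span ut H.
set a := kf _ p; set b := _ - _ => pE.
have xx := unit_tangent_kform ut; have [_ xy yy] := ut.
have yyk : kf (derive1 g 0) (derive1 g 0) = kappa.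
  by rewrite (kform_tangent hkappa _ xx xy) yy mulr1.
have ab : a * a + kappa * (b * b) = 1.
  rewrite -pp [in RHS]pE; move: (g 0) (derive1 g 0) xx xy yyk => x y xx xy yyk.
  transitivity (a * a * kf x x + (1 + 1) * a * b * kf x y + b * b * kf y y).
    by rewrite xx xy yyk; ring.
  by rewrite /kform !crdL; ring.
have [t [[ta tb]|[k0 [ta tb]]]] := ck_sk_surj hkappa ab; exists t.
  by rewrite (geodesic_arc hkappa Hg) /garc -ta -tb -pE.
have /space_formE[_ /(_ k0)] := gs t.
have -> : g t = - p.
  rewrite [LHS](congr1 (fun h => h t) (geodesic_arc hkappa Hg)) pE /garc ta tb.
  by rewrite !scaleNr -opprD opprK.
by rewrite crdN oppr_gt0 => /lt_trans /(_ (p0 k0)); rewrite ltxx.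
Qed.

Lemma smooth_plg (U : normedModType R) (W : set U) (Gam : U -> R -> E4) : open W ->
  geodesic_family kappa W Gam -> smooth_on W (fun w => plg (Gam w)).
Proof.
by move=> oW [_ s0 s1]; exact: smooth_on_bilinear (@bilinear_plucker R) _ _ oW s0 s1.
Qed.

Lemma differentiable_plg n (W : set 'rV[R]_n) (Gam : 'rV[R]_n -> R -> E4) w : open W ->
  geodesic_family kappa W Gam -> W w -> differentiable (fun w => plg (Gam w)) w.
Proof.
move=> oW HG Ww; apply: (C1_differentiable_row oW) => //.
exact: smooth_plg oW HG 1%N.
Qed.

Lemma row_free_jacobian_plg n (W : set 'rV[R]_n) (Gam : 'rV[R]_n -> R -> E4) w :
  open W -> geodesic_family kappa W Gam -> immersive kappa W Gam -> W w ->
  row_free (jacobian (fun w => plg (Gam w)) w).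
Proof.
move=> oW HG HI Ww; rewrite -kermx_eq0; apply/rowV0P => u /sub_kermxP uJ.
apply: (HI w) => //.
have [J0 [J1 [-> tp [_ D]]]] := dfamily_arc u oW HG Ww.
have ut : unit_tangent kappa (Gam w 0) (derive1 (Gam w) 0).
  by apply: geodesic_unit_tangent; have [us _ _] := HG; exact: us.
have [|-> ->] := bivector_eq0 ut tp.
  by rewrite -D deriveEjacobian //; exact: differentiable_plg oW HG Ww.
by apply/funext => t; rewrite /garc !scaler0 addr0.
Qed.

End GeodesicFamilies.

(** * Geodesics of the cross metric *)

Section ChartGeodesics.
Context {R : realType}.

Lemma derive_symmetric_row n m (W : set 'rV[R]_n) (f : 'rV[R]_n -> 'rV[R]_m) w u v :
  open W -> Ck_on 2 W f -> W w -> 'D_u ('D_v f) w = 'D_v ('D_u f) w.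
Proof.
move=> oW Hf Ww; apply/rowP => a.
pose fa (z : 'rV[R]_n) : R := f z 0 a.
have comp x y : ('D_x ('D_y f) w) 0 a = 'D_x ('D_y fa) w.
  have [_ [df /(_ y) [_ [ddf _]]]] := Hf.
  rewrite (derive_mx (ddf w x Ww)) mxE; apply: near_eq_derive.
  apply: (open_near_eq oW) Ww => z Wz.
  by rewrite (derive_mx (df z y Wz)) mxE.
have Hfa : Ck_on 2 W fa := Ck_on_coord 0 a oW Hf.
have E := derive_symmetric u v oW Hfa Ww.
exact: etrans (comp u v) (etrans E (esym (comp v u))).
Qed.

(** The algebra that turns the intrinsic geodesic equation into the extrinsic one. [kl] stands for
    products of first derivatives of the embedding, [P] for products of second with first
    derivatives, [DM] for derivatives of the metric; the conclusion says that the acceleration is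
    normal. *)
Lemma christoffel_normal (g : 'M[R]_4) (P DM : 'I_4 -> 'I_4 -> 'I_4 -> R)
    (kl : 'I_4 -> 'I_4 -> R) (x1 x2 : 'I_4 -> R) : g \in unitmx ->
  (forall i j, g i j = - 2^-1 * kl i j) -> (forall i j, kl i j = kl j i) ->
  (forall i j l, P i j l = P j i l) ->
  (forall l i j, DM l i j = - 2^-1 * (P i l j + P j l i)) ->
  (forall k, x2 k + \sum_i \sum_j (2^-1 * \sum_l invmx g k l *
     (DM i j l + DM j i l - DM l i j)) * x1 i * x1 j = 0) ->
  forall l, \sum_i x2 i * kl i l + \sum_i \sum_j x1 i * x1 j * P i j l = 0.
Proof.
move=> gu gE klC PC DME ode l.
pose r l := \sum_i \sum_j x1 i * x1 j * P i j l.
have x2E k : x2 k = 2^-1 * \sum_l invmx g k l * r l.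
  apply/eqP; rewrite -subr_eq0; apply/eqP; rewrite -[RHS](ode k); congr (_ + _).
  (* The three derivatives of the metric combine, by symmetry of [P], into a single term. *)
  have brE i j m : DM i j m + DM j i m - DM m i j = - P i j m.
    by rewrite !DME (PC j i) (PC m i) (PC m j); lra.
  rewrite mulr_sumr -sumrN.
  transitivity (\sum_m \sum_i \sum_j
      (- (2^-1 * (invmx g k m * (x1 i * x1 j * P i j m))))).
    apply: eq_bigr => m _; rewrite /r mulr_sumr mulr_sumr -sumrN.
    by apply: eq_bigr => i _; rewrite mulr_sumr mulr_sumr -sumrN.
  rewrite exchange_big; apply: eq_bigr => i _.
  rewrite exchange_big; apply: eq_bigr => j _.
  rewrite mulr_sumr !mulr_suml; apply: eq_bigr => m _; rewrite brE; ring.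
have X2 : \col_k x2 k = 2^-1 *: (invmx g *m \col_l r l).
  apply/colP => k; rewrite !mxE x2E; congr (_ * _).
  by apply: eq_bigr => m _; rewrite mxE.
have := congr1 (fun M : 'cV[R]_4 => (g *m M) l 0) X2.
rewrite -scalemxAr mulKVmx // !mxE -/(r l).
under eq_bigr do rewrite mxE gE.
move=> E.
have -> : \sum_i x2 i * kl i l = - (1 + 1) * \sum_j - 2^-1 * kl l j * x2 j.
  rewrite mulr_sumr; apply: eq_bigr => i _; rewrite klC.
  move: (kl l i) (x2 i) => a b; lra.
rewrite E -/(r l); move: (r l) => a; lra.
Qed.

(** [C] is the second derivative of f o x. Its products with the partial derivatives of [f] are the
    expressions of [christoffel_normal], the symmetry of [P] being that of second derivatives. *)
Lemma chart_geodesic_normal (W : set 'rV[R]_4) (A : set R)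
    (f : 'rV[R]_4 -> 'rV[R]_6) (x : R -> 'rV[R]_4) (M : 'rV[R]_4 -> 'M[R]_4) s0 :
  open W -> smooth_on W f -> open A -> A s0 -> smooth_on A x ->
  (forall s, A s -> W (x s)) ->
  (forall w i j, W w -> M w i j =
     - 2^-1 * klein ('D_(delta_mx 0 i) f w) ('D_(delta_mx 0 j) f w)) ->
  M (x s0) \in unitmx ->
  (forall k, derive1 (derive1 x) s0 0 k + \sum_i \sum_j
     (2^-1 * \sum_l invmx (M (x s0)) k l *
       ('D_(delta_mx 0 i) (fun w => M w j l) (x s0) +
        'D_(delta_mx 0 j) (fun w => M w i l) (x s0) -
        'D_(delta_mx 0 l) (fun w => M w i j) (x s0))) *
     derive1 x s0 0 i * derive1 x s0 0 j = 0) ->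
  exists C, [/\ forall s, A s -> is_derive s 1 (f \o x) ('D_(derive1 x s) f (x s)),
    is_derive s0 1 (fun s => 'D_(derive1 x s) f (x s)) C &
    forall l, klein C ('D_(delta_mx 0 l) f (x s0)) = 0].
Proof.
move=> oW sf oA As0 sx AW ME Mu ode.
have Wx0 := AW s0 As0.
have dx s : A s -> is_derive s 1 x (derive1 x s).
  by move=> As; rewrite derive1E; apply: derivableP; exact: smooth_on_derivable sx As.
have dx' s : A s -> is_derive s 1 (derive1 x) (derive1 (derive1 x) s).
  move=> As; rewrite [X in is_derive _ _ _ X]derive1E; apply: derivableP.
  exact: smooth_on_derivable (smooth_on_derive1 sx) As.
have dif g w : smooth_on W g -> W w -> differentiable (g : 'rV[R]_4 -> 'rV[R]_6) w.
  by move=> sg Ww; apply: (C1_differentiable_row oW (sg 1%N) Ww).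
have dfx g s : smooth_on W (g : _ -> 'rV[R]_6) -> A s ->
    is_derive s 1 (g \o x) ('D_(derive1 x s) g (x s)).
  move=> sg As; apply: is_derive_comp_curve; first by have [] := dx s As.
  exact: dif (AW s As).
pose e (i : 'I_4) : 'rV[R]_4 := delta_mx 0 i.
have sfi i : smooth_on W ('D_(e i) f) by exact: smooth_on_derive.
exists (\sum_i (derive1 x s0 0 i *: 'D_(derive1 x s0) ('D_(e i) f) (x s0) +
  derive1 (derive1 x) s0 0 i *: 'D_(e i) f (x s0))); split.
- by move=> s As; exact: dfx.
- apply: (near_eq_is_derive (f := \sum_i
      (fun s => derive1 x s 0 i *: ('D_(e i) f \o x) s))).
    apply: (open_near_eq oA) As0 => s As.
    by rewrite fct_sumE (derive_row _ (dif f _ sf (AW s As))).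
  apply: is_derive_sum => i.
  have [d1 e1] := is_derive_crd i (dx' s0 As0).
  have [d2 e2] := dfx ('D_(e i) f) s0 (sfi i) As0.
  by apply: is_derive_eq (is_derive_scale d1 d2) _; rewrite e1 e2.
move=> l; rewrite klein_suml.
have DM m i j : 'D_(e m) (fun w => M w i j) (x s0) = - 2^-1 *
    (klein ('D_(e m) ('D_(e i) f) (x s0)) ('D_(e j) f (x s0)) +
     klein ('D_(e m) ('D_(e j) f) (x s0)) ('D_(e i) f (x s0))).
  have D i' : is_derive (x s0) (e m) ('D_(e i') f) ('D_(e m) ('D_(e i') f) (x s0)).
    by apply: derivableP; exact: smooth_on_derivable (sfi i') Wx0.
  have DK := is_deriveZ (- 2^-1 : R) (is_derive_bilinear (@bilinear_klein R) (D i) (D j)).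
  rewrite [X in _ + X]kleinC; have [_ E] := DK; refine (etrans _ E).
  apply: near_eq_derive; apply: (open_near_eq oW) Wx0 => w Ww.
  exact: ME.
pose P i j k := klein ('D_(e j) ('D_(e i) f) (x s0)) ('D_(e k) f (x s0)).
have sym i j : 'D_(e j) ('D_(e i) f) (x s0) = 'D_(e i) ('D_(e j) f) (x s0).
  exact: (derive_symmetric_row _ _ oW (sf 2%N) Wx0).
have := christoffel_normal (P := P)
  (kl := fun i j => klein ('D_(e i) f (x s0)) ('D_(e j) f (x s0)))
  Mu (fun i j => ME (x s0) i j Wx0) (fun i j => kleinC _ _)
  (fun i j k => congr1 (fun z => klein z ('D_(e k) f (x s0))) (sym i j)) DM ode l.
move=> E; refine (etrans _ E); rewrite -big_split /=; apply: eq_bigr => i _.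
rewrite kleinDl !kleinZl addrC; congr (_ + _).
rewrite (derive_row _ (dif _ _ (sfi i) Wx0)) klein_suml mulr_sumr.
by apply: eq_bigr => j _; rewrite kleinZl mulrA.
Qed.

(** The four rows of [L] together with B and star B form a basis of R^6: pairing a relation with B
    isolates the coefficient of star B, pairing with star B then isolates that of B. A vector Klein
    orthogonal to a basis is zero. *)
Lemma frame_nondegenerate kappa (L : 'M[R]_(4, 6)) B Z : row_free L ->
  (forall i, klein (row i L) B = 0) -> (forall i, hform kappa (row i L) B = 0) ->
  klein B B = 0 -> hform kappa B B = 1 ->
  (forall i, klein (row i L) Z = 0) -> klein B Z = 0 -> hform kappa Z B = 0 -> Z = 0.
Proof.
move=> fL LB LhB BB hB LZ BZ hZ.
pose M : 'M[R]_(4 + (1 + 1), 6) := col_mx L (col_mx B (star kappa B)).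
have fM : row_free M.
  rewrite -kermx_eq0; apply/rowV0P => u /sub_kermxP.
  have [u1 [u2 [u3 ->]]] : exists (u1 : 'rV[R]_4) (u2 u3 : 'rV[R]_1),
      u = row_mx u1 (row_mx u2 u3) :> 'rV[R]_(4 + (1 + 1)).
    exists (lsubmx (u : 'rV[R]_(4 + (1 + 1)))), (lsubmx (rsubmx (u : 'rV[R]_(4 + (1 + 1))))),
      (rsubmx (rsubmx (u : 'rV[R]_(4 + (1 + 1))))).
    by rewrite !hsubmxK.
  rewrite /M !mul_row_col.
  have rE (v : 'rV[R]_1) (X : 'rV[R]_6) : v *m X = v 0 0 *: X.
    by apply/rowP => j; rewrite mxE big_ord1 mxE.
  rewrite !rE => E.
  have uL X : (forall i, klein (row i L) X = 0) -> klein (u1 *m L) X = 0.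
    move=> H; rewrite mulmx_sum_row klein_suml big1 // => i _.
    by rewrite kleinZl H mulr0.
  have u30 : u3 0 0 = 0.
    have := congr1 (klein B) E; rewrite klein0r !kleinDr !kleinZr klein_star hB BB.
    by rewrite kleinC (uL _ LB) mulr0 mulr1 !add0r.
  rewrite u30 scale0r addr0 in E.
  have u20 : u2 0 0 = 0.
    have := congr1 (klein (star kappa B)) E; rewrite klein0r kleinDr kleinZr.
    rewrite [klein _ B]kleinC klein_star hB mulr1 kleinC uL ?add0r // => i.
    by rewrite klein_star.
  move: E; rewrite u20 scale0r addr0 => E.
  have -> : u1 = 0.
    by apply: (row_free_inj fL); rewrite mul0mx.
  have -> : u2 = 0 by apply/rowP => i; rewrite ord1 mxE.
  have -> : u3 = 0 by apply/rowP => i; rewrite ord1 mxE.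
  by rewrite !row_mx0.
have Mu : (M : 'M[R]_6) \in unitmx by rewrite -row_free_unit.
suff H (i : 'I_(4 + (1 + 1))) : klein (row i M) Z = 0.
  by apply: (klein_nondegenerate Mu) => i; exact: H.
rewrite /M; have := splitK (i : 'I_(4 + (1 + 1))).
case: (@fintype.split 4 (1 + 1) i) => j <- /=; first by rewrite rowKu.
rewrite rowKd; have := splitK j.
case: (@fintype.split 1 1 j) => k <- /=; first by rewrite rowKu row_id.
by rewrite rowKd row_id kleinC klein_star.
Qed.

End ChartGeodesics.

(** * The geodesic equation in Pluecker coordinates *)

Section CrossGeodesics.
Context {R : realType}.
Variable kappa : R.
Hypothesis hkappa : [\/ kappa = 0, kappa = 1 | kappa = -1].
Local Notation E4 := 'rV[R]_4.
Local Notation hf := (hform kappa).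

Lemma hformC X Y : hf X Y = hf Y X.
Proof. by rewrite /hform; ring. Qed.

Lemma jacobian_row n m (f : 'rV[R]_n -> 'rV[R]_m) w i : differentiable f w ->
  row i (jacobian f w) = 'D_(delta_mx 0 i) f w.
Proof. by move=> df; rewrite deriveEjacobian // -rowE. Qed.

Lemma plg_derive_normal (U : normedModType R) (W : set U) (Gam : U -> R -> E4) w e :
  open W -> geodesic_family kappa W Gam -> W w ->
  klein ('D_e (fun w' => plg (Gam w')) w) (plg (Gam w)) = 0 /\
  hf ('D_e (fun w' => plg (Gam w')) w) (plg (Gam w)) = 0.
Proof.
move=> oW HG Ww.
have pu w' : W w' -> klein (plg (Gam w')) (plg (Gam w')) = 0 /\
    hf (plg (Gam w')) (plg (Gam w')) = 1.
  by move=> Ww'; apply: (plg_unit hkappa); have [us _ _] := HG; exact: us.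
have D := derivableP (smooth_on_derivable (v := e) (smooth_plg oW HG) Ww).
split.
  have := is_derive_open_cst oW Ww (fun w' h => (pu w' h).1)
    (is_derive_bilinear (@bilinear_klein R) D D).
  by move=> /(half_eq0 (kleinC _ _)); rewrite kleinC.
have := is_derive_open_cst oW Ww (fun w' h => (pu w' h).2)
  (is_derive_bilinear (bilinear_hform kappa) D D).
by move=> /(half_eq0 (hformC _ _)); rewrite hformC.
Qed.

Lemma metric_coef_klein (W : set E4) (Gam : E4 -> R -> E4) w i j :
  open W -> geodesic_family kappa W Gam -> W w ->
  metric_coef kappa Gam w i j = - 2^-1 *
    klein ('D_(delta_mx 0 i) (fun w' => plg (Gam w')) w)
          ('D_(delta_mx 0 j) (fun w' => plg (Gam w')) w).
Proof.
move=> oW HG Ww; rewrite mxE.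
have Hw : unit_speed_geodesic kappa (Gam w) by have [us _ _] := HG; exact: us.
have [I0 [I1 [-> _ [_ ->]]]] := dfamily_arc hkappa (delta_mx 0 i) oW HG Ww.
have [J0 [J1 [-> _ [_ ->]]]] := dfamily_arc hkappa (delta_mx 0 j) oW HG Ww.
by rewrite (cross_metric_klein hkappa _ _ Hw) !(derive1_arc hkappa) !(arc0 hkappa).
Qed.

(** A vector in the kernel of the Gram matrix gives a tangent vector that is Klein orthogonal to the
    tangent space and to both normals B and star B, hence zero. Invertibility gives [invmx] in the
    Christoffel symbols its intended meaning. *)
Lemma metric_coef_unit (W : set E4) (Gam : E4 -> R -> E4) w :
  local_parametrization kappa W Gam -> W w -> metric_coef kappa Gam w \in unitmx.
Proof.
move=> [oW HG HI _] Ww; rewrite -row_free_unit -kermx_eq0; apply/rowV0P => u /sub_kermxP uG.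
have df := differentiable_plg oW HG Ww.
have fL := row_free_jacobian_plg hkappa oW HG HI Ww.
have Hw : unit_speed_geodesic kappa (Gam w) by have [us _ _] := HG; exact: us.
have [BB hB] := plg_unit hkappa Hw.
have N e := plg_derive_normal e oW HG Ww.
have Du := deriveEjacobian u df.
apply: (row_free_inj fL); rewrite mul0mx -Du.
apply: (frame_nondegenerate (kappa := kappa) (B := plg (Gam w)) fL _ _ BB hB).
- by move=> i; rewrite jacobian_row //; exact: (N _).1.
- by move=> i; rewrite jacobian_row //; exact: (N _).2.
- move=> j; rewrite jacobian_row // (derive_row u df) klein_sumr.
  have := congr1 (fun v : 'rV[R]_4 => v 0 j) uG; rewrite !mxE => E.
  have : \sum_i u 0 i * (- 2^-1 * klein ('D_(delta_mx 0 i) (fun w' => plg (Gam w')) w)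
      ('D_(delta_mx 0 j) (fun w' => plg (Gam w')) w)) = 0.
    by rewrite -[RHS]E; apply: eq_bigr => i _; rewrite (metric_coef_klein i j oW HG Ww).
  move=> /(congr1 (fun z => - (1 + 1) * z)); rewrite mulr0 mulr_sumr => E2.
  have aux (X Y : 'rV[R]_6) (c : R) :
      klein Y (c *: X) = - (1 + 1) * (c * (- 2^-1 * klein X Y)).
    by rewrite kleinZr kleinC; move: (klein _ _) => a; lra.
  by refine (etrans _ E2); apply: eq_bigr => i _; exact: aux.
- by rewrite kleinC; exact: (N _).1.
- exact: (N _).2.
Qed.

(** The geodesic equation freed from charts: the rows of [L] are a basis of the tangent space in
    R^6, which contains the velocity and to which the acceleration [C] is Klein orthogonal. *)
Lemma cross_geodesic_plucker (D : set R) (sigma : R -> set (R -> E4)) s0 :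
  cross_geodesic kappa D sigma -> D s0 ->
  exists C (L : 'M[R]_(4, 6)) u,
  [/\ \forall s \near s0, derivable (plc kappa \o sigma) s 1,
      is_derive s0 1 (derive1 (plc kappa \o sigma)) C,
      exists2 g, unit_speed_geodesic kappa g & sigma s0 = geod_class g,
      derive1 (plc kappa \o sigma) s0 = u *m L &
      [/\ row_free L, forall i, klein (row i L) (plc kappa (sigma s0)) = 0,
          forall i, hf (row i L) (plc kappa (sigma s0)) = 0 &
          forall i, klein (row i L) C = 0]].
Proof.
move=> /[apply] -[W [Gam [A [x [lp [oA As0 sx] AW ode]]]]].
have [oW HG HI _] := lp.
have WA s : A s -> W (x s) by move=> /AW[].
have us s : A s -> unit_speed_geodesic kappa (Gam (x s)).
  by move=> /WA Wx; have [us _ _] := HG; exact: us.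
have Wx0 := WA s0 As0.
have [C [D1 D2 CN]] := chart_geodesic_normal oW (smooth_plg oW HG) oA As0 sx WA
  (fun w i j => metric_coef_klein i j oW HG) (metric_coef_unit lp Wx0)
  (fun k => ode s0 k As0).
have BE s : A s -> (plc kappa \o sigma) s = ((fun w => plg (Gam w)) \o x) s.
  by move=> As; rewrite /= (AW s As).2 (plcE hkappa) //; exact: us.
have BD s : A s -> is_derive s 1 (plc kappa \o sigma)
    ('D_(derive1 x s) (fun w => plg (Gam w)) (x s)).
  move=> As; apply: near_eq_is_derive (D1 s As).
  by apply: (open_near_eq oA) As => t At; rewrite BE.
have B'E s : A s -> derive1 (plc kappa \o sigma) s =
    'D_(derive1 x s) (fun w => plg (Gam w)) (x s).
  by move=> As; rewrite derive1E; have [_] := BD s As.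
have df := differentiable_plg oW HG Wx0.
exists C, (jacobian (fun w => plg (Gam w)) (x s0)), (derive1 x s0); split.
- have nA : nbhs s0 A by exact: open_nbhs_nbhs.
  by apply: filterS nA => s As; have [] := BD s As.
- apply: near_eq_is_derive D2.
  by apply: (open_near_eq oA) As0 => t At; rewrite B'E.
- by exists (Gam (x s0)); [exact: us|rewrite (AW s0 As0).2].
- by rewrite B'E // deriveEjacobian.
have -> : plc kappa (sigma s0) = plg (Gam (x s0)) := BE s0 As0.
split=> [|i|i|i]; first exact: row_free_jacobian_plg oW HG HI Wx0.
- by rewrite jacobian_row //; exact: (plg_derive_normal _ oW HG Wx0).1.
- by rewrite jacobian_row //; exact: (plg_derive_normal _ oW HG Wx0).2.
- by rewrite jacobian_row // kleinC; exact: CN.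
Qed.

(* The uniqueness of the solution of f'' = - lam f with zero initial data
   follows from the conservation of f'^2 + lam f^2. *)
Lemma harmonic_eq0 (D : set R) (lam : R) (f f' : R -> R) : open D -> is_interval D ->
  D 0 -> 0 <= lam -> (forall s, D s -> is_derive s 1 f (f' s)) ->
  (forall s, D s -> is_derive s 1 f' (- lam * f s)) -> f 0 = 0 -> f' 0 = 0 ->
  forall s, D s -> f s = 0.
Proof.
move=> oD iD D0 lam0 df df' f0 f'0.
have E s : D s -> f' s * f' s + lam * (f s * f s) = 0.
  move=> Ds.
  pose h : R -> R := (f' * f') + (lam *: (f * f)).
  have dh t : D t -> is_derive t 1 h 0.
    move=> Dt; have Df := df t Dt; have Df' := df' t Dt.
    apply: is_derive_eq (is_deriveD (is_deriveM Df' Df') (is_deriveZ lam (is_deriveM Df Df))) _.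
    by rewrite /GRing.scale /=; ring.
  have := is_derive0_interval_cst oD iD D0 dh Ds.
  rewrite -[h s]/(f' s * f' s + lam * (f s * f s)).
  by rewrite -[h 0]/(f' 0 * f' 0 + lam * (f 0 * f 0)) f0 f'0 !mulr0 addr0.
move=> s Ds; rewrite -f0; apply: (is_derive0_interval_cst oD iD D0) Ds => t Dt.
apply: is_derive_eq (df t Dt) _.
have := E t Dt; have : 0 <= lam * (f t * f t) by rewrite mulr_ge0 // -expr2 sqr_ge0.
move: (f' t) (lam * _) => a b b0 ab; nra.
Qed.

Lemma cross_geodesic_harmonic (D : set R) (sigma : R -> set (R -> E4)) (Y : 'rV[R]_6) :
  open D -> is_interval D -> D 0 -> cross_geodesic kappa D sigma ->
  let B := plc kappa \o sigma in let B' := derive1 B in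
  klein (B' 0) (B' 0) = 0 -> 0 <= hf (B' 0) (B' 0) ->
  klein Y (B 0) = 0 -> klein Y (B' 0) = 0 -> forall s, D s -> klein Y (B s) = 0.
Proof.
move=> oD iD D0 cg B B' nul pos Y0 Y0'.
have H s (Ds : D s) := cross_geodesic_plucker cg Ds.
have dB s : D s -> is_derive s 1 B (B' s).
  move=> Ds; have [C [L [u [n _ _ _ _]]]] := H s Ds.
  by rewrite /B' derive1E; apply: derivableP; exact: nbhs_singleton n.
have dB' s : D s -> is_derive s 1 B' (derive1 B' s).
  move=> Ds; have [C [L [u [_ DC _ _ _]]]] := H s Ds.
  by rewrite [X in is_derive _ _ _ X]derive1E; have [_ ->] := DC.
have pu s : D s -> klein (B s) (B s) = 0 /\ hf (B s) (B s) = 1.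
  move=> Ds; have [C [L [u [_ _ [g Hg sg] _ _]]]] := H s Ds.
  rewrite /B /= sg (plcE hkappa) //; exact: plg_unit.
have BB' s : D s -> klein (B s) (B' s) = 0.
  move=> Ds; have := is_derive_open_cst oD Ds (fun t h => (pu t h).1)
    (is_derive_bilinear (@bilinear_klein R) (dB s Ds) (dB s Ds)).
  exact: half_eq0 (kleinC _ _).
have hBB' s : D s -> hf (B s) (B' s) = 0.
  move=> Ds; have := is_derive_open_cst oD Ds (fun t h => (pu t h).2)
    (is_derive_bilinear (bilinear_hform kappa) (dB s Ds) (dB s Ds)).
  exact: half_eq0 (hformC _ _).
have BB2 s : D s -> klein (B' s) (B' s) + klein (B s) (derive1 B' s) = 0.
  move=> Ds; exact: is_derive_open_cst oD Ds BB'
    (is_derive_bilinear (@bilinear_klein R) (dB s Ds) (dB' s Ds)).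
have hBB2 s : D s -> hf (B' s) (B' s) + hf (B s) (derive1 B' s) = 0.
  move=> Ds; exact: is_derive_open_cst oD Ds hBB'
    (is_derive_bilinear (bilinear_hform kappa) (dB s Ds) (dB' s Ds)).
have Cpar s : D s -> klein (B' s) (derive1 B' s) = 0.
  move=> Ds; have [C [L [u [_ DC _ BE [_ _ _ LC]]]]] := H s Ds.
  have -> : derive1 B' s = C by rewrite derive1E; have [_ ->] := DC.
  rewrite /B' BE mulmx_sum_row klein_suml big1 // => i _.
  by rewrite kleinZl LC mulr0.
have nul_s s : D s -> klein (B' s) (B' s) = 0.
  move=> Ds; rewrite -nul.
  apply: (is_derive0_interval_cst (f := fun s => klein (B' s) (B' s)) oD iD D0) Ds => t Dt.
  apply: is_derive_eq (is_derive_bilinear (@bilinear_klein R) (dB' t Dt) (dB' t Dt)) _.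
  by rewrite [X in X + _]kleinC Cpar // addr0.
(* The sum B'' + hform B' B' B is tested against the frame: it is orthogonal to the tangent space,
   to B because B' is null, and to star B by differentiating hform B B' = 0. *)
have acc s : D s -> derive1 B' s = - hf (B' s) (B' s) *: B s.
  move=> Ds; have [C [L [u [_ DC _ _ [fL LB LhB LC]]]]] := H s Ds.
  have CE : derive1 B' s = C by rewrite derive1E; have [_ ->] := DC.
  rewrite -CE in LC; have [kBB hBB] := pu s Ds.
  apply/eqP; rewrite scaleNr -addr_eq0; apply/eqP.
  apply: (frame_nondegenerate fL LB LhB kBB hBB).
  - by move=> i; rewrite kleinDr kleinZr LC LB mulr0 addr0.
  - rewrite kleinDr kleinZr [X in _ + _ * X]kBB mulr0 addr0.
    by have := BB2 s Ds; rewrite (nul_s s Ds) add0r.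
  - have hD X X' Z : hf (X + X') Z = hf X Z + hf X' Z by rewrite /hform !crdL; ring.
    have hZ a X Z : hf (a *: X) Z = a * hf X Z by rewrite /hform !crdL; ring.
    rewrite hD hZ [X in _ + _ * X]hBB mulr1 hformC addrC; exact: hBB2.
(* The derivative of hform B' B' is a multiple of hform B' B = 0, so the frequency is constant. *)
have cst s : D s -> hf (B' s) (B' s) = hf (B' 0) (B' 0).
  apply: (is_derive0_interval_cst (f := fun s => hf (B' s) (B' s)) oD iD D0) => t Dt.
  apply: is_derive_eq (is_derive_bilinear (bilinear_hform kappa) (dB' t Dt) (dB' t Dt)) _.
  have hZ a X Z : hf X (a *: Z) = a * hf X Z by rewrite /hform !crdL; ring.
  by rewrite [X in X + _]hformC acc // !hZ [hf (B' t) (B t)]hformC hBB' // mulr0 addr0.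
apply: (harmonic_eq0 (f' := fun s => klein Y (B' s)) oD iD D0 pos) => // s Ds.
  have DY := is_derive_cst Y s (1 : R).
  apply: is_derive_eq (is_derive_bilinear (@bilinear_klein R) DY (dB s Ds)) _.
  by rewrite kleinC klein0r add0r.
have DY := is_derive_cst Y s (1 : R).
apply: is_derive_eq (is_derive_bilinear (@bilinear_klein R) DY (dB' s Ds)) _.
by rewrite kleinC klein0r add0r acc // kleinZr cst.
Qed.

End CrossGeodesics.

(** * Geodesics tangent to a surface *)

Section SurfaceCharts.
Context {R : realType}.
Variable kappa : R.
Hypothesis hkappa : [\/ kappa = 0, kappa = 1 | kappa = -1].
Local Notation E4 := 'rV[R]_4.
Local Notation kf := (kform kappa).
Local Notation dk := (dotk kappa).
Local Notation garc := (garc kappa).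

Definition surface_chart (S : set E4) (p : E4) (W : set 'rV[R]_2)
    (phi : 'rV[R]_2 -> E4) (w : 'rV[R]_2) : Prop :=
  [/\ open W /\ smooth_on W phi, W w /\ p = phi w,
      forall w' e, W w' -> 'D_e phi w' = 0 -> e = 0
    & forall W1, open W1 -> W1 `<=` W ->
        exists2 O : set E4, open O & phi @` W1 = S `&` O].

Lemma closed_surface_chart S p : closed_surface kappa S -> S p ->
  exists W phi w, surface_chart S p W phi w.
Proof.
move=> [_ _ _ /(_ p) + Sp] => /(_ Sp)[W [phi [ow [w Ww pw] _ im H]]].
by exists W, phi, w.
Qed.

(** The exponential is f^(-1/2), the factor that normalizes a vector field of squared length [f]. *)
Lemma derivable_inv_sqrt (f : R -> R) : derivable f 0 1 -> 0 < f 0 ->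
  derivable (fun s => expR (- 2^-1 * ln (f s))) 0 1.
Proof.
move=> df f0.
have dln : differentiable (@ln R \o f) 0.
  apply: differentiable_comp; first exact/derivable1_diffP.
  by apply/derivable1_diffP; have [] := is_derive1_ln f0.
have dz : derivable ((- 2^-1 : R) \*: (@ln R \o f)) 0 1.
  by apply: derivableZ; exact/derivable1_diffP.
apply/derivable1_diffP.
have : differentiable (@expR R \o ((- 2^-1 : R) \*: (@ln R \o f))) 0.
  apply: differentiable_comp; first exact/derivable1_diffP.
  exact/derivable1_diffP/derivable_expR.
by [].
Qed.

Lemma expR_half_ln (y : R) : 0 < y ->
  expR (- 2^-1 * ln y) * expR (- 2^-1 * ln y) * y = 1.
Proof.
move=> y0; rewrite -[X in _ * X](lnK y0) -!expRD.
by rewrite (_ : _ + _ = 0) ?expR0 //; move: (ln y) => a; lra.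
Qed.

Lemma continuous_near_gt0 (f : R -> R) (x : R) : {for x, continuous f} -> 0 < f x ->
  \forall y \near x, 0 < f y.
Proof.
move=> cf fx; have e0 : 0 < f x / 2 by rewrite divr_gt0.
apply: filterS (continuous_dist_le cf e0) => y; rewrite ler_norml => /andP[_].
move: (f x) (f y) fx => a b; lra.
Qed.

Lemma dotkZZ a (x : E4) : dk (a *: x) (a *: x) = a * a * dk x x.
Proof. by rewrite !dotkE !crdL; ring. Qed.

Lemma is_derive_near_cst (f : R -> R) c (x : R) l :
  (\forall y \near x, f y = c) -> is_derive x 1 f l -> l = 0.
Proof. by move=> fc [_ <-]; rewrite (near_eq_derive (g := fun=> c)) ?derive_cst. Qed.

Section Chart.
Variables (S : set E4) (p : E4) (W : set 'rV[R]_2) (phi : 'rV[R]_2 -> E4) (w0 : 'rV[R]_2).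
Hypothesis sS : S `<=` space_form kappa.
Hypothesis hchart : surface_chart S p W phi w0.

Let oW : open W. Proof. by have [[]] := hchart. Qed.
Let sphi : smooth_on W phi. Proof. by have [[]] := hchart. Qed.
Let Ww0 : W w0. Proof. by have [_ []] := hchart. Qed.
Let pE : p = phi w0. Proof. by have [_ []] := hchart. Qed.

Lemma chart_in_surface w : W w -> S (phi w).
Proof.
move=> Ww; have [_ _ _ H] := hchart; have [Q _ E] := H W oW (@subset_refl _ W).
by have : (phi @` W) (phi w) by [exists w]; rewrite E => -[].
Qed.

Lemma chart_differentiable w : W w -> differentiable phi w.
Proof. by move=> Ww; apply: (C1_differentiable_row oW (sphi 1%N) Ww). Qed.

Lemma is_derive_chart_line w e : W w -> is_derive (0 : R) 1 (phi \o line w e) ('D_e phi w).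
Proof.
move=> Ww; have lw : line w e 0 = w by rewrite /line scale0r addr0.
split; last by rewrite derive_line lw scale1r.
by apply: derivable_line; rewrite lw scale1r; exact: smooth_on_derivable sphi Ww.
Qed.

Lemma chart_surface_tangent w e : W w -> surface_tangent S (phi w) ('D_e phi w).
Proof.
move=> Ww; have lw : line w e 0 = w by rewrite /line scale0r addr0.
exists (line w e @^-1` W), (phi \o line w e); split.
- by split; [exact: open_line|rewrite /= lw].
- by move=> k; apply: Ck_on_line; exact: sphi.
- by move=> s; exact: chart_in_surface.
- by rewrite /= lw.
- by rewrite derive1E; have [_] := is_derive_chart_line e Ww.
Qed.

Lemma chart_tangent w e : W w -> kf (phi w) ('D_e phi w) = 0.
Proof.
move=> Ww; have D := derivableP (smooth_on_derivable (v := e) sphi Ww).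
have ff w' : W w' -> kf (phi w') (phi w') = 1.
  by move=> Ww'; have /space_formE[] := sS (chart_in_surface Ww').
have := is_derive_open_cst oW Ww ff (is_derive_bilinear (bilinear_kform kappa) D D).
by move=> /(half_eq0 (kformC _ _ _)).
Qed.

(** Relative openness of the images of small balls around [w0] makes points of the curve close to
    [p] images of parameters close to [w0], as [immersion_curve_velocity] requires. *)
Lemma surface_tangent_chart u : surface_tangent S p u -> exists e, 'D_e phi w0 = u.
Proof.
move=> [A [c [[oA A0] sc Sc c0 <-]]].
have [_ _ im H] := hchart.
apply: (immersion_curve_velocity (f := phi) (c := c)) => //.
- exact: chart_differentiable.
- rewrite -kermx_eq0; apply/rowV0P => x /sub_kermxP xJ; apply: (im w0) => //.
  by rewrite deriveEjacobian //; exact: chart_differentiable.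
- rewrite derive1E; apply: derivableP; exact: smooth_on_derivable sc A0.
- by rewrite c0.
move=> r r0.
have oW1 : open (W `&` ball w0 r) by apply: openI => //; exact: ball_open.
have [Q oQ QE] := H _ oW1 (@subIsetl _ _ _).
have Qc0 : Q (c 0).
  have : (phi @` (W `&` ball w0 r)) (c 0).
    by exists w0; [split=> //; exact: ballxx|rewrite c0 pE].
  by rewrite QE => -[].
have nA : \forall s \near (0 : R), A s by exact: open_nbhs_nbhs.
have nO : \forall s \near (0 : R), Q (c s).
  by apply: (smooth_on_continuous sc A0); exact: open_nbhs_nbhs.
near=> s.
have : (phi @` (W `&` ball w0 r)) (c s).
  by rewrite QE; split; [apply: Sc; near: s; exact: nA|near: s; exact: nO].
move=> [w [Ww wr] <-]; exists w => //.
by move: wr; rewrite -ball_normE /= distrC.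
Unshelve. all: by end_near. Qed.

Lemma is_derive_chart_derive w e f : W w ->
  is_derive (0 : R) 1 ('D_f phi \o line w e) ('D_e ('D_f phi) w).
Proof.
move=> Ww; have lw : line w e 0 = w by rewrite /line scale0r addr0.
split; last by rewrite derive_line lw scale1r.
apply: derivable_line; rewrite lw scale1r.
exact: smooth_on_derivable (smooth_on_derive f sphi) Ww.
Qed.

(* The footpoint moves along the image of w0 + s e, and the direction is the
   normalized derivative of phi along a + s b. *)
Lemma tangent_curve e a b : dk ('D_a phi w0) ('D_a phi w0) = 1 ->
  let q := phi \o line w0 e in
  exists V V1 c, [/\ V 0 = 'D_a phi w0, is_derive (0 : R) 1 V V1,
    V1 = 'D_e ('D_a phi) w0 + 'D_b phi w0 + c *: 'D_a phi w0,
    dk V1 ('D_a phi w0) = 0 &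
    \forall s \near (0 : R), [/\ unit_tangent kappa (q s) (V s),
      S (q s) & surface_tangent S (q s) (V s)]].
Proof.
move=> aa q; have lw : line w0 e 0 = w0 by rewrite /line scale0r addr0.
(* This is the derivative of [phi] along a + s b at the moving footpoint, hence tangent to the
   surface there before and after normalization. *)
pose X (s : R) := 'D_a phi (line w0 e s) + s *: 'D_b phi (line w0 e s).
have X0 : X 0 = 'D_a phi w0 by rewrite /X lw scale0r addr0.
have DX : is_derive (0 : R) 1 X ('D_e ('D_a phi) w0 + 'D_b phi w0).
  have Da := is_derive_chart_derive e a Ww0.
  have [db eb] := is_derive_chart_derive e b Ww0.
  have Did : is_derive (0 : R) 1 (id : R -> R) 1 := is_derive_id _ _.
  have [di ei] := Did.
  apply: is_derive_eq (is_deriveD Da (is_derive_scale di db)) _.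
  by rewrite ei scale0r add0r scale1r /= lw.
pose f (s : R) := dk (X s) (X s).
have Df := is_derive_bilinear (bilinear_dotk kappa) DX DX.
have f0 : f 0 = 1 by rewrite /f X0.
pose u (s : R) := expR (- 2^-1 * ln (f s)).
have u0 : u 0 = 1 by rewrite /u f0 ln1 mulr0 expR0.
have du : derivable u 0 1.
  by apply: derivable_inv_sqrt; [have [] := Df|rewrite f0].
have uuf s : 0 < f s -> u s * u s * f s = 1.
  exact: expR_half_ln.
have [dX eX] := DX.
have DV := is_derive_scale du dX; rewrite eX u0 scale1r X0 in DV.
exists (fun s => u s *: X s), ('D_e ('D_a phi) w0 + 'D_b phi w0 + 'D_1 u 0 *: 'D_a phi w0),
  ('D_1 u 0); split=> //; first by rewrite u0 scale1r X0.
- have nf : \forall s \near (0 : R), dk (u s *: X s) (u s *: X s) = 1.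
    have cf : {for 0, continuous f}.
      by apply: differentiable_continuous; apply/derivable1_diffP; have [] := Df.
    have nf0 : \forall s \near (0 : R), 0 < f s.
      by apply: (continuous_near_gt0 cf); rewrite f0.
    by apply: filterS nf0 => s fs; rewrite dotkZZ; exact: uuf.
  have := is_derive_near_cst nf (is_derive_bilinear (bilinear_dotk kappa) DV DV).
  by rewrite u0 scale1r X0 addrC; apply: half_eq0; exact: dotkC.
have cf : {for 0, continuous f}.
  by apply: differentiable_continuous; apply/derivable1_diffP; have [] := Df.
have nf0 : \forall s \near (0 : R), 0 < f s.
  by apply: (continuous_near_gt0 cf); rewrite f0.
have nW : \forall s \near (0 : R), W (line w0 e s).
  have o : open (line w0 e @^-1` W) by exact: open_line.
  by apply: open_nbhs_nbhs; split=> //=; rewrite lw.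
near=> s.
have fs : 0 < f s by near: s; exact: nf0.
have Ws : W (line w0 e s) by near: s; exact: nW.
have uX : u s *: X s = 'D_(u s *: (a + s *: b)) phi (line w0 e s).
  have d := chart_differentiable Ws.
  by rewrite (deriveZdir _ _ d) (deriveDdir _ _ d) (deriveZdir _ _ d).
split.
- split; first exact: sS (chart_in_surface Ws).
  + by rewrite uX; exact: chart_tangent.
  + by rewrite dotkZZ; exact: uuf.
- exact: chart_in_surface.
- by rewrite uX; exact: chart_surface_tangent.
Unshelve. all: by end_near. Qed.

End Chart.

End SurfaceCharts.

(** * The tangent space of the hypersurface as the range of a differential *)

Section TangentHypersurface.
Context {R : realType}.
Variable kappa : R.
Hypothesis hkappa : [\/ kappa = 0, kappa = 1 | kappa = -1].
Local Notation E4 := 'rV[R]_4.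
Local Notation kf := (kform kappa).
Local Notation dk := (dotk kappa).
Local Notation hf := (hform kappa).
Local Notation garc := (garc kappa).
Local Notation ck := (ck kappa).
Local Notation sk := (sk kappa).

Lemma tangent_garc_derive x y J0 J1 t : unit_tangent kappa x y ->
  tangent_pair kappa x y J0 J1 -> kf (garc x y t) (garc J1 (- kappa *: J0) t) = 0.
Proof.
move=> ut [xJ0 xJ1 J0y J1y]; have xx := unit_tangent_kform ut.
have J0yk : kf J0 y = 0 by rewrite (kform_tangent hkappa _ xx xJ0) J0y mulr0.
have J1yk : kf J1 y = 0 by rewrite (kform_tangent hkappa _ xx xJ1) J1y mulr0.
transitivity (ck t * ck t * kf x J1 - kappa * ck t * sk t * kf x J0
  + ck t * sk t * kf J1 y - kappa * sk t * sk t * kf J0 y).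
  by rewrite /garc /kform !crdL; ring.
by rewrite xJ0 xJ1 J0yk J1yk; ring.
Qed.

(** Applied to the initial velocity p /\ u it shows that the constant of the harmonic equation is
    |u|^2, hence nonnegative. *)
Lemma hform_plucker x y : kf x x = 1 -> kf x y = 0 ->
  hf (plucker x y) (plucker x y) = dk y y.
Proof.
rewrite dotkE; case: hkappa => ->; last 2 first.
- move=> xx xy; transitivity (kform 1 x x * kform 1 y y - kform 1 x y * kform 1 x y).
    by rewrite /hform !crd_plucker /kform; ring.
  by rewrite xx xy /kform; ring.
- move=> xx xy.
  transitivity (- (kform (-1) x x * kform (-1) y y - kform (-1) x y * kform (-1) x y)).
    by rewrite /hform !crd_plucker /kform; ring.
  by rewrite xx xy /kform; ring.
rewrite /kform => xx xy.
have y0 : crd 0 y = 0.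
  have : crd 0 x * crd 0 y = 0 by lra.
  move=> /eqP; rewrite mulf_eq0 => /orP[/eqP x0|/eqP //].
  by move: xx; rewrite x0; lra.
rewrite /hform !crd_plucker y0; have {}xx : crd 0 x * crd 0 x = 1 by lra.
transitivity (crd 0 x * crd 0 x * (crd 1 y * crd 1 y + crd 2 y * crd 2 y + crd 3 y * crd 3 y)).
  by ring.
by rewrite xx; lra.
Qed.

(** A linear relation is tested in turn with [kform p], [dotk n], [dotk w] and [dotk v], each of
    which isolates one coefficient once the previous ones are known to vanish. *)
Lemma vol_neq0 p v w z n : kf p p = 1 -> kf p v = 0 -> kf p w = 0 -> kf p z = 0 ->
  dk v v = 1 -> dk v w = 0 -> dk w w <> 0 -> dk n v = 0 -> dk n w = 0 -> dk n z <> 0 ->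
  vol p v w z <> 0.
Proof.
move=> pp pv pw pz vv vw ww nv nw nz /vol_eq0_comb[r0 [r1 [r2 [r3 [Nr E]]]]]; apply: Nr.
have kE a b c d (x y z' t u : E4) : kf u (a *: x + b *: y + c *: z' + d *: t) =
    a * kf u x + b * kf u y + c * kf u z' + d * kf u t by rewrite /kform !crdL; ring.
have dE a b c d (x y z' t u : E4) : dk u (a *: x + b *: y + c *: z' + d *: t) =
    a * dk u x + b * dk u y + c * dk u z' + d * dk u t by rewrite !dotkE !crdL; ring.
have k0 u : kf u 0 = 0 by rewrite /kform !crd0; ring.
have d0 u : dk u 0 = 0 by rewrite !dotkE !crd0; ring.
have r00 : r0 = 0.
  by have := kE r0 r1 r2 r3 p v w z p; rewrite E k0 pp pv pw pz; lra.
rewrite r00 in E *.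
have r30 : r3 = 0.
  have := dE 0 r1 r2 r3 p v w z n; rewrite E d0 nv nw !mulr0 mul0r !add0r.
  by move=> /esym/eqP; rewrite mulf_eq0 => /orP[/eqP //|/eqP].
rewrite r30 in E *.
have r20 : r2 = 0.
  have := dE 0 r1 r2 0 p v w z w; rewrite E d0 [dk w v]dotkC vw mulr0 !mul0r addr0 !add0r.
  by move=> /esym/eqP; rewrite mulf_eq0 => /orP[/eqP //|/eqP].
rewrite r20 in E *.
have := dE 0 r1 0 0 p v w z v; rewrite E d0 vv !mul0r !addr0 add0r mulr1 => <-.
by split.
Qed.

Lemma plg_garc x y : plg (garc x y) = plucker x y.
Proof. by rewrite /plg (derive1_arc hkappa) !(arc0 hkappa). Qed.

Definition hypersurface_chart (M : set (set (R -> E4))) l (W : set 'rV[R]_3)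
    (Gam : 'rV[R]_3 -> R -> E4) w0 : Prop :=
  [/\ open W, W w0 /\ l = geod_class (Gam w0),
      [/\ geodesic_family kappa W Gam, immersive kappa W Gam &
          injective_family W Gam]
    & forall W1, open W1 -> W1 `<=` W ->
        exists2 Q, open_oriented_geodesics kappa Q &
          [set geod_class (Gam w) | w in W1] = M `&` Q].

Section Chart.
Variables (M : set (set (R -> E4))) (g : R -> E4) (W : set 'rV[R]_3).
Variables (Gam : 'rV[R]_3 -> R -> E4) (w0 : 'rV[R]_3).
Hypothesis Hg : unit_speed_geodesic kappa g.
Hypothesis hc : hypersurface_chart M (geod_class g) W Gam w0.

Let oW : open W. Proof. by have [] := hc. Qed.
Let Ww0 : W w0. Proof. by have [_ []] := hc. Qed.
Let lE : geod_class g = geod_class (Gam w0). Proof. by have [_ []] := hc. Qed.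
Let HG : geodesic_family kappa W Gam. Proof. by have [_ _ []] := hc. Qed.
Let HI : immersive kappa W Gam. Proof. by have [_ _ []] := hc. Qed.
Let us w : W w -> unit_speed_geodesic kappa (Gam w).
Proof. by move=> Ww; have [H _ _] := HG; exact: H. Qed.
Local Notation F := (fun w => plg (Gam w)).

(** Open sets of geodesics are open conditions on initial point and velocity, so a continuous motion
    of these data stays in the image of a small ball around [w0]; [immersion_curve_velocity] then
    applies in R^6. *)
Lemma hypersurface_curve_velocity (q V : R -> E4) q1 V1 :
  is_derive (0 : R) 1 q q1 -> is_derive (0 : R) 1 V V1 ->
  (\forall s \near (0 : R), unit_tangent kappa (q s) (V s) /\
     M (geod_class (garc (q s) (V s)))) ->
  geod_class (garc (q 0) (V 0)) = geod_class g ->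
  exists e, 'D_e F w0 = plucker q1 (V 0) + plucker (q 0) V1.
Proof.
move=> Dq DV nM c0.
have [ut0 _] := nbhs_singleton nM.
have Hc0 := arc_geodesic hkappa ut0.
have plE : plucker (q 0) (V 0) = plg (Gam w0).
  by rewrite -plg_garc; apply: (geod_class_plg hkappa (us Ww0)); rewrite c0 lE.
have Dc := is_derive_bilinear (@bilinear_plucker R) Dq DV.
apply: (immersion_curve_velocity (differentiable_plg oW HG Ww0)
  (row_free_jacobian_plg hkappa oW HG HI Ww0) Dc plE) => r r0.
have oW1 : open (W `&` ball w0 r) by apply: openI => //; exact: ball_open.
have [_ _ _ H] := hc; have [Q [B oB QB] QE] := H _ oW1 (@subIsetl _ _ _).
have Ql : Q (geod_class (garc (q 0) (V 0))).
  have : [set geod_class (Gam w) | w in W `&` ball w0 r] (geod_class g).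
    by exists w0; [split=> //; exact: ballxx|rewrite lE].
  by rewrite QE c0 => -[].
have gB x y : unit_tangent kappa x y -> Q (geod_class (garc x y)) <-> B (x, y).
  move=> ut; have := QB _ (arc_geodesic hkappa ut).
  by rewrite (derive1_arc hkappa) !(arc0 hkappa).
have B0 : B (q 0, V 0) by apply/gB.
have cq : {for 0, continuous q}.
  by apply: differentiable_continuous; apply/derivable1_diffP; have [] := Dq.
have cV : {for 0, continuous V}.
  by apply: differentiable_continuous; apply/derivable1_diffP; have [] := DV.
have nB : \forall s \near (0 : R), B (q s, V s).
  have nB0 : nbhs (q 0, V 0) B by exact: open_nbhs_nbhs.
  exact: (cvg_pair cq cV) nB0.
near=> s.
have [uts Ms] : unit_tangent kappa (q s) (V s) /\ M (geod_class (garc (q s) (V s))).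
  by near: s; exact: nM.
have Bs : B (q s, V s) by near: s; exact: nB.
have : [set geod_class (Gam w) | w in W `&` ball w0 r] (geod_class (garc (q s) (V s))).
  by rewrite QE; split=> //; apply/gB.
move=> [w [Ww wr] wE]; exists w; first by move: wr; rewrite -ball_normE /= distrC.
by rewrite -plg_garc; apply: (geod_class_plg hkappa (arc_geodesic hkappa uts)).
Unshelve. all: by end_near. Qed.

(** One half of the identification of the tangent space with the range of the differential of the
    Pluecker vector; [hypersurface_line_tangent] is the other half. *)
Lemma hypersurface_tangent_range X : submanifold_tangent kappa M g X ->
  exists e, 'D_e F w0 = bivector (g 0) (derive1 g 0) (X 0) (derive1 X 0).
Proof.
move=> [_ [sigma [nM [A [Gam' [[oA A0] HG' sE g0 XE]]]]]].
have [us' s0 s1] := HG'.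
have ut s : A s -> unit_tangent kappa (Gam' s 0) (derive1 (Gam' s) 0).
  by move=> As; exact: geodesic_unit_tangent (us' s As).
have [J0 [J1 [DE _ [_ DF]]]] := dfamily_arc hkappa (1 : R) oA HG' A0.
have Dq := derivableP (smooth_on_derivable (v := (1 : R)) s0 A0).
have DV := derivableP (smooth_on_derivable (v := (1 : R)) s1 A0).
have gE s : A s -> garc (Gam' s 0) (derive1 (Gam' s) 0) = Gam' s.
  by move=> As; rewrite -(geodesic_arc hkappa (us' s As)).
have [||e eE] := hypersurface_curve_velocity Dq DV.
- have nA : \forall s \near (0 : R), A s by exact: open_nbhs_nbhs.
  near=> s; have As : A s by near: s; exact: nA.
  split; first exact: ut.
  by rewrite gE // -sE //; near: s; exact: nM.
- by rewrite gE // g0.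
exists e; rewrite eE.
have [_ <-] := is_derive_bilinear (@bilinear_plucker R) Dq DV.
have -> : X 0 = J0 by rewrite -XE DE (arc0 hkappa).
have -> : derive1 X 0 = J1 by rewrite -XE DE (derive1_arc hkappa) (arc0 hkappa).
by rewrite -g0 -DF.
Unshelve. all: by end_near. Qed.

Lemma hypersurface_line_tangent e : exists X, submanifold_tangent kappa M g X /\
  bivector (g 0) (derive1 g 0) (X 0) (derive1 X 0) = 'D_e F w0.
Proof.
(* [g] and [Gam w0] may differ by a shift of parameter. Shifting the whole family by the same [t1]
   makes it pass through [g] itself and leaves the classes unchanged. *)
have [t1 gE] : exists t1, g = fun t => Gam w0 (t + t1).
  have : geod_class (Gam w0) g by rewrite -lE; exact: geod_class_refl.
  by [].
pose A := line w0 e @^-1` W.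
have lw : line w0 e 0 = w0 by rewrite /line scale0r addr0.
have A0 : A 0 by rewrite /A /= lw.
have oA : open A by exact: open_line.
pose Gam' (s : R) := fun t => Gam (line w0 e s) (t + t1).
have G'E s : A s -> Gam' s = garc (Gam (line w0 e s) t1) (derive1 (Gam (line w0 e s)) t1).
  by move=> As; exact: (shift_geodesic hkappa t1 (us As)).
have [_ sG0 sG1] := HG.
have sx : smooth_on A ((fun w => Gam w 0) \o line w0 e) by move=> k; exact: Ck_on_line.
have sy : smooth_on A ((fun w => derive1 (Gam w) 0) \o line w0 e).
  by move=> k; exact: Ck_on_line.
have smooth_comb (f : R -> E4) (a b : R) : (forall s, A s -> f s =
    a *: Gam (line w0 e s) 0 + b *: derive1 (Gam (line w0 e s)) 0) -> smooth_on A f.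
  move=> fE k; apply: (Ck_on_eq (f := (fun s => a *: ((fun w => Gam w 0) \o line w0 e) s) \+
      (fun s => b *: ((fun w => derive1 (Gam w) 0) \o line w0 e) s))) => //.
    by move=> s As; rewrite fE.
  by apply: smooth_onD => //; exact: smooth_onZ.
have HG' : geodesic_family kappa A Gam'.
  split=> [s As||].
  - rewrite G'E //; exact: (arc_geodesic hkappa (geodesic_unit_tangent t1 (us As))).
  - apply: (smooth_comb _ (ck t1) (sk t1)) => s As; rewrite /Gam' add0r.
    by rewrite [LHS](congr1 (fun h => h t1) (geodesic_arc hkappa (us As))).
  - apply: (smooth_comb _ (- kappa * sk t1) (ck t1)) => s As.
    rewrite G'E // (derive1_arc hkappa) (arc0 hkappa).
    rewrite [LHS](congr1 (fun h => derive1 h t1) (geodesic_arc hkappa (us As))).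
    rewrite (derive1_arc hkappa) /garc addrC scalerA.
    by rewrite [sk t1 * _]mulrC.
have g0 : Gam' 0 = g by rewrite /Gam' lw gE.
have [J0 [J1 [DE tp DF]]] := dfamily_arc hkappa (1 : R) oA HG' A0.
rewrite g0 in tp DF.
have ut := geodesic_unit_tangent 0 Hg.
exists (dfamily kappa Gam' 0 1); split.
  split.
    by rewrite DE [g in jacobi_fields _ g](geodesic_arc hkappa Hg); exact: jacobi_arc.
  exists (fun s => geod_class (Gam (line w0 e s))); split.
    have nA : \forall s \near (0 : R), A s by exact: open_nbhs_nbhs.
    have [_ _ _ H] := hc; have [Q _ QE] := H W oW (@subset_refl _ W).
    apply: filterS nA => s As.
    have : [set geod_class (Gam w) | w in W] (geod_class (Gam (line w0 e s))).
      by exists (line w0 e s).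
    by rewrite QE => -[].
  exists A, Gam'; split=> // s As.
  rewrite /Gam' /geod_class; apply/seteqP; split=> d /= [t2 ->].
    by exists (t2 - t1); apply/funext => t; rewrite -addrA subrK.
  by exists (t1 + t2); apply/funext => t; rewrite addrAC addrA addrAC.
have -> : dfamily kappa Gam' 0 1 0 = J0 by rewrite DE (arc0 hkappa).
have -> : derive1 (dfamily kappa Gam' 0 1) 0 = J1.
  by rewrite DE (derive1_arc hkappa) (arc0 hkappa).
have [_ <-] := DF.
have <- : 'D_1 (F \o line w0 e) 0 = 'D_e F w0 by rewrite derive_line lw scale1r.
apply: near_eq_derive; apply: (open_near_eq oA) A0 => s As /=.
have Gd : geod_class (Gam (line w0 e s)) (Gam' s) by exists t1.
exact: (geod_class_mem hkappa (us As) Gd).2.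
Qed.

End Chart.

End TangentHypersurface.

(** * Three tangent directions of the hypersurface at the contact point *)

Section NormalVectors.
Context {R : realType}.
Variable kappa : R.
Hypothesis hkappa : [\/ kappa = 0, kappa = 1 | kappa = -1].
Local Notation E4 := 'rV[R]_4.
Local Notation kf := (kform kappa).
Local Notation dk := (dotk kappa).
Local Notation hf := (hform kappa).
Local Notation garc := (garc kappa).

Lemma row3_basis (e1 e2 e3 : 'rV[R]_3) :
  (forall a b c, a *: e1 + b *: e2 + c *: e3 = 0 -> [/\ a = 0, b = 0 & c = 0]) ->
  forall e, exists a b c, e = a *: e1 + b *: e2 + c *: e3.
Proof.
move=> H e.
have rE (v : 'rV[R]_1) (X : 'rV[R]_3) : v *m X = v 0 0 *: X.
  by apply/rowP => j; rewrite mxE big_ord1 mxE.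
pose N : 'M[R]_(1 + (1 + 1), 3) := col_mx e1 (col_mx e2 e3).
have NE (u : 'rV[R]_(1 + (1 + 1))) : u *m N = lsubmx u 0 0 *: e1 +
    lsubmx (rsubmx u) 0 0 *: e2 + rsubmx (rsubmx u) 0 0 *: e3.
  rewrite -{1}(hsubmxK u) -{1}(hsubmxK (rsubmx u)) /N !mul_row_col !rE.
  by rewrite addrA.
have fN : row_free N.
  rewrite -kermx_eq0; apply/rowV0P => u /sub_kermxP; rewrite NE => /H[h1 h2 h3].
  rewrite -(hsubmxK u) -(hsubmxK (rsubmx u)).
  have z (v : 'rV[R]_1) : v 0 0 = 0 -> v = 0 by move=> v0; apply/rowP => j; rewrite ord1 mxE.
  by rewrite (z _ h1) (z _ h2) (z _ h3) !row_mx0.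
have Nu : (N : 'M[R]_3) \in unitmx by rewrite -row_free_unit.
pose u : 'rV[R]_(1 + (1 + 1)) := e *m invmx (N : 'M[R]_3).
exists (lsubmx u 0 0), (lsubmx (rsubmx u) 0 0), (rsubmx (rsubmx u) 0 0).
by rewrite -NE /u; exact: esym (mulmxKV Nu e).
Qed.

Section TangentPlane.
Variables (S : set E4) (g : R -> E4) (p v : E4).
Variables (W : set 'rV[R]_3) (Gam : 'rV[R]_3 -> R -> E4) (w3 : 'rV[R]_3).
Hypothesis sS : S `<=` space_form kappa.
Hypothesis Hg : unit_speed_geodesic kappa g.
Hypothesis hc : hypersurface_chart kappa (tangent_geodesics kappa S) (geod_class g) W Gam w3.
Hypothesis gpv : geod_class (garc p v) = geod_class g.
Local Notation F := (fun w => plg (Gam w)).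

Section Chart.
Variables (W2 : set 'rV[R]_2) (phi : 'rV[R]_2 -> E4) (w0 a : 'rV[R]_2).
Hypothesis hchart : surface_chart S p W2 phi w0.
Hypothesis aE : 'D_a phi w0 = v.
Hypothesis vv : dk v v = 1.

(** The last two equations are derivatives along the curve of the relations kform q V = 0 and dotk
    nu V = 0; the latter brings in the second fundamental form. *)
Lemma tangent_curve_velocity e b : exists V1 c,
  [/\ exists e3, 'D_e3 F w3 = plucker ('D_e phi w0) v + plucker p V1,
      V1 = 'D_e ('D_a phi) w0 + 'D_b phi w0 + c *: v, dk V1 v = 0,
      kf ('D_e phi w0) v + kf p V1 = 0
    & forall Q nu, unit_normal_field kappa S Q nu -> Q p ->
        dk ('D_('D_e phi w0) nu p) v + dk (nu p) V1 = 0].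
Proof.
have [_ [Ww0 pE] _ _] := hchart.
have lw : line w0 e 0 = w0 by rewrite /line scale0r addr0.
have aa : dk ('D_a phi w0) ('D_a phi w0) = 1 by rewrite aE.
have [V [V1 [c [V0 DV V1E V1v nV]]]] := tangent_curve sS hchart e b aa.
rewrite aE in V0 V1E V1v.
have Dq := is_derive_chart_line hchart e Ww0.
set q := phi \o line w0 e in nV Dq.
have q0 : q 0 = p by rewrite /q /= lw pE.
have Fe := hypersurface_curve_velocity hkappa hc Dq DV.
rewrite V0 q0 in Fe.
exists V1, c; split=> //.
- apply: Fe => //; apply: filterS nV => s [ut Sq tq]; split=> //.
  have Hs := arc_geodesic hkappa ut.
  split; first by exists (garc (q s) (V s)).
  exists (garc (q s) (V s)), 0; split; first exact: geod_class_refl.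
    by rewrite (arc0 hkappa).
  by rewrite (derive1_arc hkappa) !(arc0 hkappa).
- have nk : \forall s \near (0 : R), kf (q s) (V s) = 0.
    by apply: filterS nV => s [[]].
  have := is_derive_near_cst nk (is_derive_bilinear (bilinear_kform kappa) Dq DV).
  by rewrite V0 q0.
move=> Q nu [oQ snu nuS] Qp.
have dnu : differentiable nu (q 0).
  by rewrite q0; exact: (C1_differentiable_row oQ (snu 1%N) Qp).
have [dq eq] := Dq.
have := is_derive_comp_curve dq dnu; rewrite derive1E eq q0 => Dn.
have cq : {for 0, continuous q}.
  by apply: differentiable_continuous; apply/derivable1_diffP.
have nQ : \forall s \near (0 : R), Q (q s).
  by apply: cq; rewrite q0; exact: open_nbhs_nbhs.
have nk : \forall s \near (0 : R), dk ((nu \o q) s) (V s) = 0.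
  near=> s.
  have [_ Sq tq] : [/\ unit_tangent kappa (q s) (V s), S (q s) &
      surface_tangent S (q s) (V s)] by near: s; exact: nV.
  have Qq : Q (q s) by near: s; exact: nQ.
  by have [_ _ H] := nuS (q s) Sq Qq; exact: H.
have := is_derive_near_cst nk (is_derive_bilinear (bilinear_dotk kappa) Dn DV).
by rewrite /= V0 -/(q 0) q0.
Unshelve. all: by end_near. Qed.

End Chart.

Hypothesis hS : closed_surface kappa S.
Hypothesis hconvex : quadratically_convex kappa S.
Hypothesis Sp : S p.
Hypothesis tv : surface_tangent S p v.
Hypothesis ut : unit_tangent kappa p v.

Lemma tangent_plane_vectors : exists w z n V3,
  [/\ [/\ kf p w = 0, dk v w = 0 & dk w w <> 0],
      [/\ kf p n = 0, dk n v = 0, dk n w = 0 & dk n n = 1],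
      kf p z = 0 /\ dk n z <> 0,
      exists e, 'D_e F w3 = plucker p w
    & (exists e, 'D_e F w3 = plucker p z) /\
      exists e, 'D_e F w3 = plucker w v + plucker p V3].
Proof.
have pp := unit_tangent_kform ut; have [_ pv vv] := ut.
have [Q [nu [Qp nuf conv]]] := hconvex Sp.
have [oQ snu nuS] := nuf; have [pn nn nt] := nuS p Sp Qp.
move/tangent_formE in pn.
have [W2 [phi [w0 hchart]]] := closed_surface_chart hS Sp.
have [_ [Ww0 pE] im _] := hchart.
have [a aE] := surface_tangent_chart hchart tv.
have dphi := chart_differentiable hchart Ww0.
(* A quarter turn of [a] in the parameter plane gives a direction independent of [a]; removing the
   component of its image along v yields w. *)
pose e' : 'rV[R]_2 := \row_j (if j == 0 then - a 0 1 else a 0 0).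
pose v2 := 'D_e' phi w0; pose ew := e' - dk v2 v *: a; pose w := 'D_ew phi w0.
have wE : w = v2 - dk v2 v *: v.
  rewrite /w /ew -scaleNr (deriveDdir _ _ dphi) (deriveZdir _ _ dphi) aE.
  by rewrite scaleNr.
have pw : kf p w = 0 by rewrite pE; exact: (chart_tangent sS hchart).
have vw : dk v w = 0.
  have dB c x : dk v (x - c *: v) = dk v x - c * dk v v.
    by rewrite !dotkE !crdL; ring.
  by rewrite wE dB vv mulr1 dotkC subrr.
have w_neq0 : w <> 0.
  move=> /(im w0 ew Ww0); rewrite /ew; move: (dk v2 v) => c ec0.
  have h0 : - a 0 1 = c * a 0 0.
    have := congr1 (fun x : 'rV[R]_2 => x 0 0) ec0; rewrite !mxE /=.
    by move=> /eqP; rewrite subr_eq0 => /eqP.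
  have h1 : a 0 0 = c * a 0 1.
    have := congr1 (fun x : 'rV[R]_2 => x 0 1) ec0; rewrite !mxE /=.
    by move=> /eqP; rewrite subr_eq0 => /eqP.
  have a00 : a 0 0 = 0 by nra.
  have a01 : a 0 1 = 0 by move: h0; rewrite a00 mulr0 => /eqP; rewrite oppr_eq0 => /eqP.
  have a0 : a = 0.
    apply/rowP => j; rewrite mxE; case: j => [[|[|//]]] ?.
      by rewrite -[RHS]a00; congr (a 0 _); exact: val_inj.
    by rewrite -[RHS]a01; congr (a 0 _); exact: val_inj.
  by move: vv; rewrite -aE a0 derive0 dotkE !crd0; lra.
have ww : dk w w <> 0.
  by have /eqP := gt_eqF (dotk_tangent_gt0 hkappa pp pw w_neq0).
have nv : dk (nu p) v = 0 by exact: nt.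
have nw : dk (nu p) w = 0.
  by apply: nt; rewrite pE; exact: (chart_surface_tangent hchart).
have kpv : kappa * dk p v = 0 by rewrite kappa_dotk // pv !mulr0.
have knp : kappa * dk (nu p) p = 0 by rewrite kappa_dotk // kformC pn !mulr0.
have v_neq0 : v <> 0 by move=> v0; move: vv; rewrite v0 dotkE !crd0; lra.
have shape : dk ('D_v nu p) v <> 0.
  have sE : dk (shape_operator kappa nu p v) v = - dk ('D_v nu p) v.
    rewrite /shape_operator /tproj; move: ('D_v nu p) => d.
    transitivity (- dk d v + dk d p * (kappa * dk p v)).
      by rewrite !dotkE !crdL; ring.
    by rewrite kpv mulr0 addr0.
  move=> d0; case: conv => /(_ v tv v_neq0); by rewrite sE d0 oppr0 ltxx.
(* The three motions: fixed footpoint with the direction turning towards w, footpoint moving along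
   v, footpoint moving along w. *)
have [V1 [c1 [E1 V1E V1v _ _]]] := tangent_curve_velocity hchart aE vv 0 ew.
have [V2 [c2 [E2 _ V2v kV2 nV2]]] := tangent_curve_velocity hchart aE vv a 0.
have [V3 [c3 [E3 _ _ _ _]]] := tangent_curve_velocity hchart aE vv ew 0.
have {}V1E : V1 = w.
  move: V1E; rewrite derive0 add0r -/w => V1E.
  suff c10 : c1 = 0 by rewrite V1E c10 scale0r addr0.
  move: V1v; rewrite V1E => <-.
  transitivity (dk v w + c1 * dk v v); first by rewrite vw vv add0r mulr1.
  by rewrite !dotkE !crdL; ring.
have p0 x : plucker 0 x = 0 by rewrite -(scale0r 0) pluckerZl scale0r.
have vvk : kf v v = kappa by rewrite (kform_tangent hkappa _ pp pv) vv mulr1.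
have {}nV2 := nV2 Q nu nuf Qp.
rewrite aE in kV2 nV2 E2.
(* Adding kappa p makes V2 tangent at [p] and does not change p /\ V2. The normal component of the
   sum is the second fundamental form on v, nonzero by definiteness. *)
exists w, (V2 + kappa *: p), (nu p), V3; split=> //.
- split.
    transitivity (kf p V2 + kappa * kf p p); first by rewrite /kform !crdL; ring.
    by rewrite pp mulr1 addrC; move: kV2; rewrite vvk.
  have -> : dk (nu p) (V2 + kappa *: p) = dk (nu p) V2 + kappa * dk (nu p) p.
    by rewrite !dotkE !crdL; ring.
  rewrite knp addr0 => n0; apply: shape; move: nV2; by rewrite n0 addr0.
- by move: E1; rewrite derive0 p0 add0r V1E.
split=> //; move: E2; rewrite pluckerxx add0r => -[e eE]; exists e.
by rewrite eE pluckerDr pluckerZr pluckerxx scaler0 addr0.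
Qed.

End TangentPlane.

End NormalVectors.

(** * Degeneracy, and geodesics that keep passing through the contact point *)

Theorem proposition1p5 (R : realType) (kappa : R) (S : set 'rV[R]_4)
    (gamma : R -> 'rV[R]_4)
    (hkappa : [\/ kappa = 0, kappa = 1 | kappa = -1])
    (hS : closed_surface kappa S)
    (hconvex : quadratically_convex kappa S)
    (hM : smooth_hypersurface kappa (tangent_geodesics kappa S))
    (hgamma : unit_speed_geodesic kappa gamma)
    (hl : tangent_geodesics kappa S (geod_class gamma)) :
  let T := submanifold_tangent kappa (tangent_geodesics kappa S) gamma in
  degenerate_on kappa gamma T /\
  forall N, cross_normal kappa gamma T N ->
  forall (D : set R) (sigma : R -> set (R -> 'rV[R]_4)),
    open D -> is_interval D -> D 0 ->
    cross_geodesic kappa D sigma ->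
    sigma 0 = geod_class gamma ->
    has_velocity kappa sigma 0 gamma (complex_structure kappa gamma N) ->
    sigma @` D `&` billiard_table kappa S = set0.
Proof.
have sS : S `<=` space_form kappa by case: hS.
have [t0 [Sp tv]] : exists t0, S (gamma t0) /\ surface_tangent S (gamma t0) (derive1 gamma t0).
  have [_ [g [t [[a ga] Sg tg]]]] := hl; exists (t + a).
  have sg : smooth_on setT gamma by case: hgamma.
  have [_ E] := is_derive_translate (is_derive_derive1 (t + a) sg).
  by move: Sg tg; rewrite ga derive1E E.
set p := gamma t0 in Sp tv *; set v := derive1 gamma t0 in tv *.
have ut : unit_tangent kappa p v := geodesic_unit_tangent t0 hgamma.
have gE := geodesic_arc hkappa hgamma.
have pE : p = garc kappa (gamma 0) (derive1 gamma 0) t0 := congr1 (fun h => h t0) gE.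
have vE : v = garc kappa (derive1 gamma 0) (- kappa *: gamma 0) t0.
  by rewrite -(derive1_arc hkappa) -gE.
have gpv : geod_class (garc kappa p v) = geod_class gamma.
  rewrite -(shift_geodesic hkappa t0 hgamma); apply/seteqP; split=> d [t1 ->].
    by exists (t1 + t0); apply/funext => t; rewrite addrA.
  by exists (t1 - t0); apply/funext => t; rewrite -addrA subrK.
have [W [Gam [w3 hc]]] : exists W Gam w3,
    hypersurface_chart kappa (tangent_geodesics kappa S) (geod_class gamma) W Gam w3.
  have [_ /(_ _ hl)[W [Gam [oW [w3 Ww3 lE] HG H]]]] := hM.
  by exists W, Gam, w3.
have [oW [Ww3 _] [HG _ _] _] := hc.
have dF := differentiable_plg oW HG Ww3.
have [w [z [n [V3 [[pw vw ww] [pn nv nw nn] [pz nz] [e1 E1] [[e2 E2] [e3 E3]]]]]]] :=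
  tangent_plane_vectors hkappa sS hc gpv hS hconvex Sp tv ut.
have pp := unit_tangent_kform ut; have [pS pv vv] := ut.
have vol_n : vol p v w n <> 0.
  by apply: (vol_neq0 (kappa := kappa) (n := n)) => //; rewrite nn; apply/eqP/oner_neq0.
have vol_z : vol p v w z <> 0 by apply: (vol_neq0 (kappa := kappa) (n := n)).
(* Bivectors are constant along the geodesic, so the data at 0 are traded for those at the contact
   time [t0]. *)
have biv0 J : J = garc kappa (J 0) (derive1 J 0) ->
    bivector (gamma 0) (derive1 gamma 0) (J 0) (derive1 J 0) =
    plucker (J t0) v + plucker p (derive1 J t0).
  move=> JE; rewrite -(bivector_arc hkappa _ _ _ _ t0) /bivector -pE -vE.
  rewrite -(congr1 (fun h => h t0) JE) -(derive1_arc hkappa) -JE; done.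
have [X1 [TX1 B1]] := hypersurface_line_tangent hkappa hgamma hc e1.
have [X2 [TX2 B2]] := hypersurface_line_tangent hkappa hgamma hc e2.
rewrite E1 in B1; rewrite E2 in B2.
split.
  (* [X1] has bivector p /\ w; it is not zero because its product with v /\ n is, up to sign, vol p
     v w n. *)
  exists X1; split=> // [X10|X TX].
    apply: vol_n; have := klein_plucker p w v n; rewrite -B1 X10.
    rewrite derive1_cst /bivector -(scale0r 0) pluckerZl pluckerZr !scale0r addr0.
    rewrite kleinC klein0r => /esym h; rewrite -[RHS]oppr0 -[in RHS]h.
    by rewrite !volE /det3; ring.
  have [e eE] := hypersurface_tangent_range hkappa hc TX.
  rewrite (cross_metric_klein hkappa _ _ hgamma) -eE B1.
  have Dsum a b c : 'D_(a *: e1 + b *: e2 + c *: e3) (fun w' => plg (Gam w')) w3 =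
      a *: plucker p w + b *: plucker p z + c *: (plucker w v + plucker p V3).
    by rewrite !(deriveDdir _ _ dF) !(deriveZdir _ _ dF) E1 E2 E3.
  (* Independence of e1, e2, e3 is seen on their images: products with p /\ n, v /\ w and v /\ n
     isolate c, b and a, with factors vol p v w n or vol p v w z up to sign. *)
  have [|a [b [c ->]]] := row3_basis (e1 := e1) (e2 := e2) (e3 := e3) _ e.
    move=> a b c abc; have := Dsum a b c; rewrite abc derive0 => E.
    have c0 : c = 0.
      have := congr1 (klein (plucker p n)) E; rewrite klein0r !(kleinDr, kleinZr) !klein_plucker.
      have -> : vol p n p w = 0 by rewrite !volE /det3; ring.
      have -> : vol p n p z = 0 by rewrite !volE /det3; ring.
      have -> : vol p n p V3 = 0 by rewrite !volE /det3; ring.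
      have -> : vol p n w v = - vol p v w n by rewrite !volE /det3; ring.
      rewrite !mulr0 !add0r addr0 => /esym/eqP; rewrite mulf_eq0 => /orP[/eqP //|].
      by rewrite oppr_eq0 => /eqP.
    have b0 : b = 0.
      have := congr1 (klein (plucker v w)) E.
      rewrite c0 klein0r !(kleinDr, kleinZr) !klein_plucker.
      have -> : vol v w p w = 0 by rewrite !volE /det3; ring.
      have -> : vol v w p z = vol p v w z by rewrite !volE /det3; ring.
      rewrite mulr0 mul0r addr0 add0r => /esym/eqP; rewrite mulf_eq0 => /orP[/eqP //|].
      by move=> /eqP.
    split=> //; have := congr1 (klein (plucker v n)) E.
    rewrite c0 b0 klein0r !(kleinDr, kleinZr) !klein_plucker !mul0r !addr0.
    have -> : vol v n p w = - vol p v w n by rewrite !volE /det3; ring.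
    move=> /esym/eqP; rewrite mulf_eq0 => /orP[/eqP //|].
    by rewrite oppr_eq0 => /eqP.
  rewrite Dsum !(kleinDr, kleinZr) !klein_plucker.
  have -> : vol p w p w = 0 by rewrite !volE /det3; ring.
  have -> : vol p w p z = 0 by rewrite !volE /det3; ring.
  have -> : vol p w p V3 = 0 by rewrite !volE /det3; ring.
  have -> : vol p w w v = 0 by rewrite !volE /det3; ring.
  by rewrite !(mulr0, addr0).
move=> N [jN NT] D sigma oD iD D0 cg s0 [A [Gam2 [[oA A0] HG2 sE g20 JE]]].
have [_ tN oN _] := jN.
have [NE _] := jacobi_is_arc hkappa hgamma jN.
have BN X B : submanifold_tangent kappa (tangent_geodesics kappa S) gamma X ->
    bivector (gamma 0) (derive1 gamma 0) (X 0) (derive1 X 0) = B ->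
    klein (plucker (N t0) v + plucker p (derive1 N t0)) B = 0.
  move=> TX XB; have := NT X TX; rewrite (cross_metric_klein hkappa _ _ hgamma) XB.
  rewrite (biv0 N NE) => /eqP; rewrite mulf_eq0 oppr_eq0 invr_eq0 (_ : (2 == 0 :> R) = false).
    by move=> /eqP.
  by rewrite pnatr_eq0.
(* Normality to p /\ w puts N t0 in the span of p, v and w. Being tangent at p and orthogonal to v
   it is a multiple of w, and normality to p /\ z makes the multiple zero since vol p v w z is
   not. *)
have Nt0 : N t0 = 0.
  have := BN X1 _ TX1 B1; have := BN X2 _ TX2 B2.
  rewrite (kleinDl _ _ (plucker p z)) (kleinDl _ _ (plucker p w)) !klein_plucker.
  have -> : vol p (derive1 N t0) p z = 0 by rewrite !volE /det3; ring.
  have -> : vol p (derive1 N t0) p w = 0 by rewrite !volE /det3; ring.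
  rewrite !addr0 => hz hw.
  have pN : kform kappa p (N t0) = 0 by apply/tangent_formE; exact: tN.
  have vN : dotk kappa v (N t0) = 0 by rewrite dotkC; exact: oN.
  have h : vol p v w (N t0) = 0.
    transitivity (vol (N t0) v p w); last exact: hw.
    by rewrite !volE /det3; ring.
  have [r0 [r1 [r2 [r3 [Nr E]]]]] := vol_eq0_comb h.
  have r00 : r0 = 0.
    have : kform kappa p (r0 *: p + r1 *: v + r2 *: w + r3 *: N t0) =
      r0 * kform kappa p p + r1 * kform kappa p v + r2 * kform kappa p w +
      r3 * kform kappa p (N t0) by rewrite /kform !crdL; ring.
    by rewrite E pp pv pw pN !mulr0 !addr0 mulr1 => <-; rewrite /kform !crd0; ring.
  rewrite r00 scale0r add0r in E.
  have r10 : r1 = 0.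
    have : dotk kappa v (r1 *: v + r2 *: w + r3 *: N t0) =
      r1 * dotk kappa v v + r2 * dotk kappa v w + r3 * dotk kappa v (N t0).
      by rewrite !dotkE !crdL; ring.
    by rewrite E vv vw vN !mulr0 !addr0 mulr1 => <-; rewrite !dotkE !crd0; ring.
  rewrite r10 scale0r add0r in E.
  have w_neq0 : w != 0.
    by apply/eqP => w0; apply: ww; rewrite w0 !dotkE !crd0; ring.
  have r30 : r3 != 0.
    apply/eqP => r30; apply: Nr; split=> //; move: E; rewrite r30 scale0r addr0.
    by move=> /eqP; rewrite scaler_eq0 (negbTE w_neq0) orbF => /eqP.
  have N_eq : N t0 = (- r2 / r3) *: w.
    apply: (scalerI r30); rewrite scalerA mulrC divfK // scaleNr.
    by apply/eqP; rewrite -addr_eq0 addrC E.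
  have : - (- r2 / r3) * vol p v w z = 0.
    by rewrite -[RHS]hz N_eq !volE /det3 !crdL; ring.
  move=> /eqP; rewrite mulf_eq0 oppr_eq0 => /orP[/eqP r|/eqP //].
  by rewrite N_eq r scale0r.
have [us2 _ _] := HG2.
have [J0 [J1 [DE tp DF]]] := dfamily_arc hkappa (1 : R) oA HG2 A0.
rewrite g20 in tp DF.
(* The rotated field vanishes together with [N] at the contact time, so its bivector reduces to p /\
   u with u its derivative there. *)
have Jt0 : garc kappa J0 J1 t0 = 0.
  rewrite -DE JE /complex_structure Nt0 /cross; apply/rowP => i; rewrite !mxE.
  by rewrite volE /det3 !crd0; ring.
pose u := garc kappa J1 (- kappa *: J0) t0.
have B'E : bivector (gamma 0) (derive1 gamma 0) J0 J1 = plucker p u.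
  rewrite -(bivector_arc hkappa _ _ _ _ t0) /bivector -pE -vE Jt0.
  by rewrite -(scale0r 0) pluckerZl scale0r add0r.
have pu : kform kappa p u = 0.
  by rewrite pE; exact: (tangent_garc_derive hkappa t0 (geodesic_unit_tangent 0 hgamma) tp).
have plc0 : (plc kappa \o sigma) 0 = plucker p v.
  rewrite /= s0 (plcE hkappa hgamma) /plg pE vE.
  by rewrite (arc_derive_plucker hkappa).
have dplc0 : derive1 (plc kappa \o sigma) 0 = plucker p u.
  rewrite derive1E -B'E; have [_ <-] := DF.
  apply: near_eq_derive; apply: (open_near_eq oA) A0 => s As /=.
  by rewrite (sE s As); exact: (plcE hkappa (us2 s As)).
(* All p /\ Z have zero Klein product with p /\ v and p /\ u, which are the initial data of the
   harmonic equation. *)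
have harm Z s : D s -> klein (plucker p Z) (plc kappa (sigma s)) = 0.
  move=> Ds; apply: (cross_geodesic_harmonic hkappa (Y := plucker p Z) oD iD D0 cg) Ds.
  - by rewrite dplc0 klein_plucker volE /det3; ring.
  - rewrite dplc0 (hform_plucker hkappa pp pu).
    have [->|/eqP u0] := eqVneq u 0; first by rewrite dotkE !crd0 !mulr0 !addr0.
    exact: ltW (dotk_tangent_gt0 hkappa pp pu u0).
  - by rewrite plc0 klein_plucker volE /det3; ring.
  - by rewrite dplc0 klein_plucker volE /det3; ring.
apply/seteqP; split=> // l [[s Ds <-] [_ nm _]]; apply: nm.
have [_ [_ [_ [_ _ [g Hg sg] _ _]]]] := cross_geodesic_plucker hkappa cg Ds.
(* Vanishing products with all p /\ Z mean that p lies in the plane of the geodesic, which therefore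
   meets [S] at p. *)
have [Z|t gt] := point_on_geodesic hkappa Hg pS.
  have := harm Z s Ds; rewrite sg (plcE hkappa Hg) /plg klein_plucker.
  by [].
exists g, t; rewrite gt; split=> //; rewrite sg; exact: geod_class_refl.
Qed.
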